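(* There exist universal constants $c_0>0$ and $\varepsilon_0>0$ such that the following holds for every $N\ge 1$, $d=2^N$, and every $\varepsilon\in(0,\varepsilon_0]$. Suppose an algorithm receives $n$ copies of an unknown $N$-qubit state $\rho\in\mathbb{C}^{d\times d}$, measures each copy with a single-qubit measurement, where the measurement applied to the $t$-th copy may be chosen adaptively as a function of the outcomes observed on copies $1,\dots,t-1$, and then outputs an estimate $\hat\rho$ of $\rho$ computed from all outcomes. If for every $N$-qubit state $\rho$ the output satisfies $\|\hat\rho-\rho\|_1\le\varepsilon$ with probability at least $0.9$, then \[ n\;\ge\; c_0\,\frac{10^{N}}{\sqrt{N}\,\varepsilon^{2}}. \]
   Context: An $N$-qubit state is a density matrix $\rho\in\mathbb{C}^{d\times d}$, $d=2^N$ (Hermitian, $\rho\succeq 0$, $\mathrm{Tr}\,\rho=1$). $\|A\|_1$ denotes the trace norm (sum of singular values). A POVM is a finite collection $\{M_x\}_{x}$ of positive semidefinite matrices summing to the identity; measuring $\rho$ yields outcome $x$ with probability $\mathrm{Tr}[M_x\rho]$. A single-qubit measurement on $N$ qubits is a POVM of product form: for each qubit $i\in[N]$ a POVM $\{M^i_{o}\}_{o\in O_i}$ on $\mathbb{C}^2$ is chosen, and the $N$-qubit POVM is $\{M^1_{o_1}\otimes\cdots\otimes M^N_{o_N}\}_{(o_1,\dots,o_N)}$. Each copy of $\rho$ is measured exactly once. *)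

(* Defs.v *)
(* Scalars: the complex numbers C := R[i] (mathcomp-real-closed
   'complex'), built on Stdlib's concrete real numbers R (a realType / rcfType
   via Rstruct). *)
From HB Require Import structures.
From mathcomp Require Import all_boot all_order all_algebra.
From mathcomp Require Import Rstruct complex.
Set Implicit Arguments. Unset Strict Implicit. Unset Printing Implicit Defensive.
Import Order.TTheory GRing.Theory Num.Theory.
Local Open Scope ring_scope.

Notation RR := Rdefinitions.R.
Notation CC := (Rdefinitions.R[i]).

(* conjugate transpose A^dagger *)
Definition dagger (m n : nat) (A : 'M[CC]_(m, n)) : 'M[CC]_(n, m) :=
  (map_mx (fun z : CC => z^*) A)^T.

(* positive semidefinite: Hermitian and v^dagger A v >= 0 for all v *)
Definition psd (n : nat) (A : 'M[CC]_n) : Prop :=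
  dagger A = A /\ forall v : 'cV[CC]_n, 0 <= (dagger v *m A *m v) 0 0.

(* N-qubit density matrix, d = 2^N *)
Definition is_state (N : nat) (rho : 'M[CC]_(2 ^ N)) : Prop :=
  psd rho /\ \tr rho = 1.

(* the eigenvalues (with multiplicity) of a square complex matrix:
   the roots of its characteristic polynomial *)
Definition eigvals (n : nat) (A : 'M[CC]_n) : seq CC :=
  sval (closed_field_poly_normal (char_poly A)).

(* trace norm ||A||_1 = sum of singular values = sum of square roots of the
   eigenvalues of A^dagger A *)
Definition trnorm (n : nat) (A : 'M[CC]_n) : RR :=
  complex.Re (\sum_(z <- eigvals (dagger A *m A)) sqrtC z).

(* A single-qubit POVM with outcome set 'I_K (outcomes with zero effect are
   allowed, so any finite POVM with at most K outcomes is covered). *)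
Definition qubit_povm (K : nat) (M : 'I_K -> 'M[CC]_2) : Prop :=
  (forall o, psd (M o)) /\ \sum_(o < K) M o = 1%:M.

(* k-th bit of a computational-basis index i of (C^2)^{\otimes N}: the
   factor of the tensor product corresponding to qubit k. *)
Definition bitk (N : nat) (i : 'I_(2 ^ N)) (k : 'I_N) : 'I_2 :=
  inord ((i %/ 2 ^ k) %% 2).

(* M^1_{o_1} (x) ... (x) M^N_{o_N}, written entrywise in the computational basis
   (Kronecker product). *)
Definition prod_effect (N K : nat) (Ms : 'I_N -> 'I_K -> 'M[CC]_2)
    (o : {ffun 'I_N -> 'I_K}) : 'M[CC]_(2 ^ N) :=
  \matrix_(i, j) \prod_(k < N) Ms k (o k) (bitk i k) (bitk j k).

(* outcome of measuring one copy: one outcome per qubit *)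
Definition outcome (N K : nat) := {ffun 'I_N -> 'I_K}.

(* An adaptive single-qubit-measurement protocol on n copies: for copy t, given
   the outcomes of copies 0..t-1, a single-qubit measurement (one qubit POVM per
   qubit); and an estimator mapping all outcomes to a d x d matrix. *)
Record protocol (N K n : nat) := Protocol {
  meas : forall t : 'I_n, {ffun 'I_t -> outcome N K} -> 'I_N -> 'I_K -> 'M[CC]_2;
  estimate : {ffun 'I_n -> outcome N K} -> 'M[CC]_(2 ^ N) }.

Definition valid_protocol (N K n : nat) (P : protocol N K n) : Prop :=
  forall (t : 'I_n) (h : {ffun 'I_t -> outcome N K}) (k : 'I_N),
    qubit_povm (@meas N K n P t h k).

(* outcomes of the first t copies *)
Definition prefix (N K n : nat) (h : {ffun 'I_n -> outcome N K}) (t : 'I_n)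
  : {ffun 'I_t -> outcome N K} :=
  [ffun i : 'I_t => h (widen_ord (ltnW (ltn_ord t)) i)].

(* probability of observing the full outcome record h on rho^{\otimes n} *)
Definition record_prob (N K n : nat) (P : protocol N K n)
    (rho : 'M[CC]_(2 ^ N)) (h : {ffun 'I_n -> outcome N K}) : RR :=
  \prod_(t < n)
     complex.Re (\tr (prod_effect (@meas N K n P t (prefix h t)) (h t) *m rho)).

(* probability that the estimate is eps-close to rho in trace norm *)
Definition success_prob (N K n : nat) (P : protocol N K n)
    (rho : 'M[CC]_(2 ^ N)) (eps : RR) : RR :=
  \sum_(h : {ffun 'I_n -> outcome N K} | trnorm (estimate P h - rho) <= eps)
     record_prob P rho h.

(* Main.v *)
(* Let W be the Pauli operators of weight w, with m = |W| and w maximising 'C(N,w) 9^w, which is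
   at least 10^N / (3 sqrt N).  For signs v : W -> {1,-1} put X_v = m^(-1/2) sum_P v_P P.  The
   unknown states are (1 + alpha X_v) / 2^N with alpha of order eps, for the v in the set G of
   signs with Tr X_v^(2N) <= kappa^(2N), so that X_v has operator norm at most kappa.

   Most signs are in G because the averaged normalised moments of X_v are at most C^N.  Discrete
   integration by parts expands M_(2p) into terms tau(P X^a P X^b); along an interpolation between
   two independent copies of X and one common copy, these decouple into M_a M_b up to terms with
   two crossing pairs of Paulis, which are negligible since m >= 3^N / 27.

   For a product effect E, the sum over P in W of Tr(E P)^2 is at most 'C(N,w) (Tr E)^2.  Hence,
   for u in G and any record h of outcomes, the likelihood of h under X_u is at most exp(n beta)
   times its average over v in G under X_u + X_v, where beta is of order eps^2 / 3^w.  Summing over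
   the records compatible with u, and using that X_u + X_v takes at most 3^m values while the u
   compatible with one record lie in a Hamming ball of radius m / 50, gives
   |G|^2 <= O(1) exp(n beta) 3^m (17/15)^m.  As |G| >= (9/10) 2^m, n beta is at least of order m,
   that is, n is at least of order 'C(N,w) 9^w / eps^2. *)

Require Import Defs.
From HB Require Import structures.
From mathcomp Require Import all_boot all_order all_algebra.
From mathcomp Require Import spectral sesquilinear polyrcf.
From mathcomp Require Import Rstruct complex.
From mathcomp Require Import ring lra zify.
From Stdlib Require Rpower.
Set Implicit Arguments. Unset Strict Implicit. Unset Printing Implicit Defensive.
Import Order.TTheory GRing.Theory Num.Theory.
Local Open Scope ring_scope.

(** * Complex matrices and real traces *)

(** The obstacle is the operator norm of X_v. Trace-norm separation comes from testing X_u - X_v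
    against itself, which divides its normalised square by its operator norm. A norm of order sqrt
    N, as from general matrix concentration, would force alpha of order sqrt N eps and lose a factor
    N. Norm O(1) follows from the moment of order 2N, where the dimension 2^N costs only a constant
    after taking a 2N-th root, provided that the moments obey the recursion of the semicircle law up
    to exponentially small errors. Summing the crossing terms over all pairs of Paulis at once,
    trace orthogonality gives order m 2^N instead of m^2, a relative gain of 2^N / m.

    The comparison with X_u + X_v takes the place of an information inequality: there are about 4^m
    pairs (u, v) but at most 3^m sums, so exp(n beta) has to make up for the ratio of 4^m to
    (3.4)^m.

    The quotient m / beta is of order 'C(N,w) 9^w / eps^2. The sum of 'C(N,w) 9^w over w is 10^N,
    concentrated on order sqrt N weights; restricting to a single weight is the origin of the factor
    sqrt N. *)

Definition rc (r : RR) : CC := (r%:C)%C.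

Lemma rcD x y : rc (x + y) = rc x + rc y. Proof. exact: rmorphD. Qed.
Lemma rcN x : rc (- x) = - rc x. Proof. exact: rmorphN. Qed.
Lemma rcM x y : rc (x * y) = rc x * rc y. Proof. exact: rmorphM. Qed.
Lemma rc1 : rc 1 = 1. Proof. exact: rmorph1. Qed.
Lemma rcX x k : rc (x ^+ k) = rc x ^+ k. Proof. exact: rmorphXn. Qed.
Lemma rc_conj r : (rc r)^* = rc r.
Proof. by apply/CrealP; rewrite /rc complex_real. Qed.

Definition cRe (z : CC) : RR := complex.Re z.
Lemma cReD : {morph cRe : x y / x + y}. Proof. by case=> a b [c d]. Qed.
Lemma cReN : {morph cRe : x / - x}. Proof. by case=> a b. Qed.
Lemma cRe0 : cRe 0 = 0. Proof. by []. Qed.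
Lemma cRe_sum (I : Type) (r : seq I) (P : pred I) (F : I -> CC) :
  cRe (\sum_(i <- r | P i) F i) = \sum_(i <- r | P i) cRe (F i).
Proof. exact: (big_morph cRe cReD cRe0). Qed.
Lemma cReZ r z : cRe (rc r * z) = r * cRe z.
Proof. by case: z => a b /=; rewrite mul0r subr0. Qed.
Lemma cRe_rc r : cRe (rc r) = r. Proof. by []. Qed.
Lemma cRe_conj z : cRe z^* = cRe z. Proof. by case: z. Qed.

Section Dagger.
Lemma daggerE m n (A : 'M[CC]_(m, n)) i j : dagger A i j = (A j i)^*.
Proof. by rewrite !mxE. Qed.
Lemma daggerK m n (A : 'M[CC]_(m, n)) : dagger (dagger A) = A.
Proof. by apply/matrixP => i j; rewrite !daggerE conjCK. Qed.
Lemma daggerM m n p (A : 'M[CC]_(m, n)) (B : 'M[CC]_(n, p)) :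
  dagger (A *m B) = dagger B *m dagger A.
Proof. by rewrite /dagger map_mxM trmx_mul. Qed.
Lemma daggerD m n : {morph @dagger m n : A B / A + B}.
Proof. by move=> A B; rewrite /dagger map_mxD raddfD. Qed.
Lemma daggerN m n : {morph @dagger m n : A / - A}.
Proof. by move=> A; rewrite /dagger map_mxN raddfN. Qed.
Lemma dagger0 m n : dagger (0 : 'M[CC]_(m, n)) = 0.
Proof. by apply/matrixP => i j; rewrite daggerE !mxE conjC0. Qed.
Lemma dagger1 n : dagger (1 : 'M[CC]_n) = 1.
Proof. by apply/matrixP => i j; rewrite daggerE !mxE eq_sym; case: eqP; rewrite ?conjC0 ?conjC1. Qed.
Lemma daggerZ m n r (A : 'M[CC]_(m, n)) : dagger (rc r *: A) = rc r *: dagger A.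
Proof. by apply/matrixP => i j; rewrite !(daggerE, mxE) rmorphM /= rc_conj. Qed.
Lemma dagger_sum m n (I : Type) (r : seq I) (P : pred I) (F : I -> 'M[CC]_(m, n)) :
  dagger (\sum_(i <- r | P i) F i) = \sum_(i <- r | P i) dagger (F i).
Proof. exact: (big_morph (@dagger m n) (@daggerD m n) (@dagger0 m n)). Qed.
End Dagger.

Section Rtr.
Variable n : nat.
Implicit Types A B : 'M[CC]_n.

Definition rtr (A : 'M[CC]_n) : RR := cRe (\tr A).

Lemma dagger_mul A B : dagger (A * B) = dagger B * dagger A.
Proof. exact: daggerM. Qed.
Lemma daggerX A k : dagger (A ^+ k) = dagger A ^+ k.
Proof. by elim: k => [|k IH]; rewrite ?expr0 ?dagger1 // exprS dagger_mul IH -exprSr. Qed.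

Lemma rtrD : {morph rtr : A B / A + B}.
Proof. by move=> A B; rewrite /rtr mxtraceD cReD. Qed.
Lemma rtrN : {morph rtr : A / - A}.
Proof. by move=> A; rewrite /rtr raddfN cReN. Qed.
Lemma rtrB : {morph rtr : A B / A - B}.
Proof. by move=> A B; rewrite rtrD rtrN. Qed.
Lemma rtr0 : rtr 0 = 0. Proof. by rewrite /rtr mxtrace0. Qed.
Lemma rtr_sum (I : Type) (r : seq I) (P : pred I) (F : I -> 'M[CC]_n) :
  rtr (\sum_(i <- r | P i) F i) = \sum_(i <- r | P i) rtr (F i).
Proof. exact: (big_morph rtr rtrD rtr0). Qed.
Lemma rtrZ r A : rtr (rc r *: A) = r * rtr A.
Proof. by rewrite /rtr mxtraceZ cReZ. Qed.
Lemma rtrC A B : rtr (A * B) = rtr (B * A).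
Proof. by rewrite /rtr [\tr (A * B)]mxtrace_mulC. Qed.
Lemma rtr_dagger A : rtr (dagger A) = rtr A.
Proof.
rewrite /rtr /mxtrace !cRe_sum; apply: eq_bigr => i _; by rewrite daggerE cRe_conj.
Qed.
Lemma rtr1 : rtr 1 = n%:R.
Proof. by rewrite /rtr mxtrace1 -(rmorph_nat (real_complex RR)). Qed.
Lemma rtr_sq_ge0 A : 0 <= rtr (A * dagger A).
Proof.
rewrite /rtr /mxtrace cRe_sum; apply: sumr_ge0 => i _.
rewrite mxE cRe_sum; apply: sumr_ge0 => j _; rewrite daggerE.
by case: (A i j) => a b /=; rewrite mulrN opprK addr_ge0 // -expr2 sqr_ge0.
Qed.
Lemma rtr_cs A B : `|rtr (A * B)| <= (rtr (A * dagger A) + rtr (dagger B * B)) / 2.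
Proof.
have H1 := rtr_sq_ge0 (A - dagger B); have H2 := rtr_sq_ge0 (A + dagger B).
move: H1 H2; rewrite daggerD daggerN daggerD daggerK.
rewrite !(mulrDl, mulrDr, mulrN, mulNr, opprK) !(rtrD, rtrN).
have -> : rtr (dagger B * dagger A) = rtr (A * B) by rewrite -dagger_mul rtr_dagger.
by move=> H1 H2; rewrite ler_norml; lra.
Qed.
End Rtr.
Arguments rtr {n} A.

(** * Hoelder's inequality for words *)

Section Words.
Variables (n : nat) (T : finType) (y : T -> 'M[CC]_n).
Hypothesis yH : forall t, dagger (y t) = y t.

Definition word (w : seq T) : 'M[CC]_n := \prod_(t <- w) y t.

Lemma word_cat w1 w2 : word (w1 ++ w2) = word w1 * word w2.
Proof. by rewrite /word big_cat. Qed.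
Lemma word_cons t w : word (t :: w) = y t * word w.
Proof. by rewrite /word big_cons. Qed.
Lemma word_rot w1 w2 : rtr (word (w1 ++ w2)) = rtr (word (w2 ++ w1)).
Proof. by rewrite !word_cat rtrC. Qed.
Lemma word_rev w : word (rev w) = dagger (word w).
Proof.
elim: w => [|t w IH]; first by rewrite /rev /= /word !big_nil dagger1.
by rewrite rev_cons -cats1 word_cat IH /word big_seq1 big_cons dagger_mul yH.
Qed.
Lemma word_nseq r t : word (nseq r t) = y t ^+ r.
Proof. by rewrite /word big_nseq iter_mulr_1. Qed.

(* A maximiser of |tr w| over words of even length stays one after reflecting one
   half of it (Cauchy-Schwarz); reflecting the half which ends with a run of a letter
   doubles that run, so some power of a single letter is a maximiser. *)
Lemma word_holder (q : nat) (B : RR) (w : seq T) : (0 < q)%N -> size w = q.*2 ->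
  (forall t, rtr (y t ^+ q.*2) <= B) -> `|rtr (word w)| <= B.
Proof.
move=> q0 sw HB.
pose F (u : q.*2.-tuple T) : RR := `|rtr (word u)|.
have sw' : size w == q.*2 by apply/eqP.
pose u0 := [arg max_(u > Tuple sw') F u]%O.
pose mu := F u0.
have Fmax u : size u = q.*2 -> `|rtr (word u)| <= mu.
  move=> /eqP su; rewrite /mu /u0; case: (@arg_maxP _ _ _ _ predT F) => // i _ Hi.
  exact: (Hi (Tuple su) isT).
apply: le_trans (Fmax _ sw) _.
suff H r : (0 < r <= q)%N -> exists t w', size w' = (q.*2 - r)%N /\
    mu = `|rtr (word (nseq r t ++ w'))|.
  have [|t [w' [s' mE]]] := H q; first by rewrite q0 leqnn.
  have : mu <= (rtr (word (nseq q t) * dagger (word (nseq q t))) +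
       rtr (dagger (word w') * word w')) / 2.
    rewrite mE word_cat; exact: rtr_cs.
  have : rtr (dagger (word w') * word w') <= mu.
    rewrite -word_rev -word_cat; apply: le_trans (Fmax _ _); first exact: ler_norm.
    by rewrite size_cat size_rev s' -addnn; lia.
  have : rtr (word (nseq q t) * dagger (word (nseq q t))) <= B.
    by rewrite -word_rev word_nseq rev_nseq word_nseq -exprD addnn.
  lra.
elim: r => [//|[_ _|r IH /andP[_ rq]]].
  have : size u0 = q.*2 by rewrite size_tuple.
  have -> : mu = `|rtr (word u0)| by [].
  case: (tval u0) => [|t u]; first by move=> /eqP; rewrite eq_sym double_eq0; case: (q) q0.
  by move=> /= su; exists t, u; split => //; lia.
have [|t [w' [s' mE]]] := IH; first by rewrite /= (ltnW rq).
(* The cyclic word is cut into two halves of length q: [a], and [b] followed by the run of [t].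
   Reflecting the second half joins the run to its mirror image. *)
set b := drop q w'; set a := take q w'.
have sa : size a = q by rewrite size_takel // s'; lia.
have sb : size b = (q - r.+1)%N by rewrite size_drop s'; lia.
have mE2 : mu = `|rtr (word a * word (b ++ nseq r.+1 t))|.
  by rewrite mE -[w'](cat_take_drop q) -/a -/b word_rot -catA word_cat.
have h1 : mu <= (rtr (word a * dagger (word a)) +
    rtr (dagger (word (b ++ nseq r.+1 t)) * word (b ++ nseq r.+1 t))) / 2.
  rewrite mE2; exact: rtr_cs.
have h2 : rtr (word a * dagger (word a)) <= mu.
  rewrite -word_rev -word_cat; apply: le_trans (Fmax _ _); first exact: ler_norm.
  by rewrite size_cat size_rev sa addnn.
(* The new run has 2(r+1) letters; r+2 of them are displayed and the other r stay in the
   remainder. *)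
exists t, (nseq r t ++ (rev b ++ b)); split.
  by rewrite !size_cat size_nseq size_rev sb; lia.
have E : rtr (dagger (word (b ++ nseq r.+1 t)) * word (b ++ nseq r.+1 t)) =
         rtr (word (nseq r.+2 t ++ nseq r t ++ rev b ++ b)).
  rewrite -word_rev -word_cat rev_cat rev_nseq [nseq r.+2 t ++ _]catA -nseqD.
  have -> : (r.+2 + r = r.+1 + r.+1)%N by lia.
  by rewrite nseqD -!catA [RHS]word_rot -!catA.
apply/le_anti/andP; split.
  by apply: le_trans (ler_norm _); rewrite -E; lra.
by apply: Fmax; rewrite !size_cat !size_nseq size_rev sb; lia.
Qed.
End Words.

(** * Diagonalisation of Hermitian matrices *)

Section Spectral.
Variable n : nat.
Implicit Types A B U : 'M[CC]_n.

Definition dg (r : 'I_n -> RR) : 'M[CC]_n := diag_mx (\row_i rc (r i)).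

Lemma dgE r i j : dg r i j = if i == j then rc (r i) else 0.
Proof. by rewrite !mxE; case: eqP => [->|]; rewrite ?mulr1n ?mulr0n. Qed.
Lemma dgX r k : dg r ^+ k = dg (fun i => r i ^+ k).
Proof.
elim: k => [|k IH].
  by apply/matrixP => i j; rewrite expr0 dgE expr0 rc1 mxE; case: eqP.
rewrite exprS IH; apply/matrixP => i j; rewrite mxE dgE (bigD1 i) //= big1 => [|l li].
  by rewrite !dgE eqxx addr0; case: eqP => [->|]; rewrite ?exprS ?rcM ?mulr0.
by rewrite dgE eq_sym (negbTE li) mul0r.
Qed.

Lemma herm_spectral A : dagger A = A -> exists U r,
  [/\ dagger U * U = 1, U * dagger U = 1 & A = U * dg r * dagger U].
Proof.
move=> AH.
have Ah : A \is hermsymmx.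
  apply/is_hermitianmxP; rewrite expr0 scale1r -[LHS]AH.
  by apply/matrixP => i j; rewrite !mxE.
have /orthomx_spectralP := hermitian_normalmx Ah.
have := hermitian_spectral_diag_real Ah.
have := spectral_unitarymx A; set P := spectralmx A; set D := spectral_diag A.
move=> Pu /mxOverP Dr AE.
have PdE : dagger P = invmx P.
  by rewrite invmx_unitary //; apply/matrixP => i j; rewrite !mxE.
exists (dagger P), (fun i => cRe (D ord0 i)); rewrite daggerK PdE; split.
- by rewrite -mulmxE mulmxV // spectral_unit.
- by rewrite -mulmxE mulVmx // spectral_unit.
rewrite {1}AE; congr (_ *m _ *m _); apply/matrixP => i j; rewrite dgE !mxE.
case: eqP => [_|]; rewrite ?mulr1n ?mulr0n //; rewrite /rc /cRe RRe_real //.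
Qed.

Lemma conjU_X U A k : dagger U * U = 1 -> U * dagger U = 1 ->
  (U * A * dagger U) ^+ k = U * A ^+ k * dagger U.
Proof.
move=> U1 U2; elim: k => [|k IH]; first by rewrite !expr0 mulr1 U2.
by rewrite exprS IH !mulrA -(mulrA _ (dagger U) U) U1 mulr1 exprS !mulrA.
Qed.
Lemma rtr_dg r : rtr (dg r) = \sum_i r i.
Proof. by rewrite /rtr /mxtrace cRe_sum; apply: eq_bigr => i _; rewrite dgE eqxx. Qed.
Lemma rtr_conjU U A : dagger U * U = 1 -> rtr (U * A * dagger U) = rtr A.
Proof. by move=> U1; rewrite -mulrA rtrC -mulrA U1 mulr1. Qed.
End Spectral.

(** * Crossing pairs *)

Section Crossing.
Variables (n : nat) (I : finType).

Definition n2 (z : CC) : RR := cRe (z * z^*).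
Lemma n2_mul z w : `|cRe (z * w)| <= (n2 z + n2 w) / 2.
Proof.
case: z w => a b [c d]; rewrite /n2 /= !mulrN !opprK ler_norml.
have := sqr_ge0 (a - c); have := sqr_ge0 (b - d).
have := sqr_ge0 (a + c); have := sqr_ge0 (b + d); rewrite !expr2; lra.
Qed.

Definition orth_unitary (F : I -> 'M[CC]_n) :=
  [/\ forall k, F k * dagger (F k) = 1, forall k, dagger (F k) * F k = 1
    & forall k l, k != l -> \tr (F k * dagger (F l)) = 0].

Lemma orth_unitary_conj F U V : orth_unitary F ->
  dagger U * U = 1 -> U * dagger U = 1 -> dagger V * V = 1 -> V * dagger V = 1 ->
  orth_unitary (fun k => dagger U * F k * V).
Proof.
move=> [F1 F2 F3] U1 U2 V1 V2; split=> [k|k|k l kl].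
- by rewrite !dagger_mul daggerK !mulrA -(mulrA _ V) V2 mulr1 -(mulrA _ (F k)) F1 mulr1.
- by rewrite !dagger_mul daggerK !mulrA -(mulrA _ U) U2 mulr1 -(mulrA _ _ (F k)) F2 mulr1.
rewrite !dagger_mul daggerK !mulrA -(mulrA _ V) V2 mulr1.
by rewrite [LHS]mxtrace_mulC -mulmxE !mulmxA !mulmxE U2 mul1r F3.
Qed.

Lemma tr_dagger_entries (A B : 'M[CC]_n) :
  \tr (A * dagger B) = \sum_a \sum_b A a b * (B a b)^*.
Proof.
by rewrite /mxtrace; apply: eq_bigr => a _; rewrite mxE; apply: eq_bigr => b _; rewrite daggerE.
Qed.

(** Expanding the square gives a double sum over k and l; trace orthogonality of [Z] leaves k = l,
    where each term is a unit norm times n. In the applications [y] is a row or a column of the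
    unitaries of a second family. *)
Lemma kernel_sum (J : finType) (y : I -> J -> CC) (Z : I -> 'M[CC]_n) :
  (forall k, \sum_j y k j * (y k j)^* = 1) -> orth_unitary Z ->
  \sum_j \sum_a \sum_b n2 (\sum_k y k j * Z k a b) = #|I|%:R * n%:R.
Proof.
move=> y1 [Z1 _ Z3].
have E j a b : n2 (\sum_k y k j * Z k a b) =
    cRe (\sum_k \sum_l (y k j * (y l j)^*) * (Z k a b * (Z l a b)^*)).
  rewrite /n2 mulr_suml; congr cRe; apply: eq_bigr => k _.
  rewrite rmorph_sum mulr_sumr; apply: eq_bigr => l _ /=.
  by rewrite rmorphM /=; ring.
under eq_bigr do under eq_bigr do under eq_bigr do rewrite E.
under eq_bigr do under eq_bigr do rewrite -cRe_sum.
under eq_bigr do rewrite -cRe_sum.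
rewrite -cRe_sum.
have -> : \sum_j \sum_a \sum_b \sum_k \sum_l y k j * (y l j)^* * (Z k a b * (Z l a b)^*)
   = \sum_k \sum_l (\sum_j y k j * (y l j)^*) * \tr (Z k * dagger (Z l)).
  under eq_bigr do under eq_bigr do rewrite exchange_big.
  under eq_bigr do rewrite exchange_big.
  rewrite exchange_big; apply: eq_bigr => k _.
  under eq_bigr do under eq_bigr do rewrite exchange_big.
  under eq_bigr do rewrite exchange_big.
  rewrite exchange_big; apply: eq_bigr => l _.
  rewrite mulr_suml; apply: eq_bigr => j _.
  by rewrite tr_dagger_entries mulr_sumr; apply: eq_bigr => a _; rewrite mulr_sumr.
rewrite (eq_bigr (fun=> rc n%:R)) => [|k _].
  by rewrite cRe_sum sumr_const cRe_rc mulr_natl.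
rewrite (bigD1 k) //= y1 mul1r Z1 mxtrace1 big1 => [|l lk].
  by rewrite addr0 /rc rmorph_nat.
by rewrite Z3 ?mulr0 // eq_sym.
Qed.

Lemma row_norm1 (A : 'M[CC]_n) i : A * dagger A = 1 -> \sum_j A i j * (A i j)^* = 1.
Proof.
move=> /(congr1 (fun M : 'M[CC]_n => M i i)); rewrite !mxE eqxx mulr1n => <-.
by apply: eq_bigr => j _; rewrite daggerE.
Qed.
Lemma col_norm1 (A : 'M[CC]_n) j : dagger A * A = 1 -> \sum_i A i j * (A i j)^* = 1.
Proof.
move=> /(congr1 (fun M : 'M[CC]_n => M j j)); rewrite !mxE eqxx mulr1n => <-.
by apply: eq_bigr => i _; rewrite daggerE mulrC.
Qed.

Lemma exchange_big22 (F : 'I_n -> 'I_n -> 'I_n -> 'I_n -> RR) :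
  \sum_i \sum_j \sum_a \sum_b F i j a b = \sum_a \sum_b \sum_i \sum_j F i j a b.
Proof.
rewrite pair_big /=; under eq_bigr do rewrite pair_big /=.
rewrite exchange_big /= [RHS]pair_big /=.
by apply: eq_bigr => p _; rewrite pair_big.
Qed.

Lemma weighted_sum (f : 'I_n -> RR) (F : 'I_n -> 'I_n -> 'I_n -> 'I_n -> RR) c :
  (forall i, \sum_j \sum_a \sum_b F i j a b = c) ->
  \sum_i \sum_j \sum_a \sum_b f i * F i j a b = c * \sum_i f i.
Proof.
move=> H; rewrite mulr_sumr; apply: eq_bigr => i _; rewrite -[in RHS](H i) mulrC mulr_sumr.
apply: eq_bigr => j _; rewrite mulr_sumr.
by apply: eq_bigr => a _; rewrite mulr_sumr.
Qed.

(** Each weight depends on one of the four indices only. With that index fixed, the sum over the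
    other three is exactly [kernel_sum], a row or column of one family serving as the unit
    vector. *)
Lemma kernel_marginals (Y Z : I -> 'M[CC]_n) (f g h k : 'I_n -> RR) :
  orth_unitary Y -> orth_unitary Z ->
  \sum_i \sum_j \sum_a \sum_b (f i + g j + h a + k b) * n2 (\sum_R Y R i j * Z R a b)
   = #|I|%:R * n%:R * (\sum_i f i + \sum_i g i + \sum_i h i + \sum_i k i).
Proof.
move=> HY HZ; have [Y1 Y2 _] := HY; have [Z1 Z2 _] := HZ.
pose S i j a b := n2 (\sum_R Y R i j * Z R a b).
have SC i j a b : S i j a b = n2 (\sum_R Z R a b * Y R i j).
  by congr n2; apply: eq_bigr => R _; rewrite mulrC.
transitivity (\sum_i \sum_j \sum_a \sum_b f i * S i j a b +
  \sum_j \sum_i \sum_a \sum_b g j * S i j a b +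
  \sum_a \sum_b \sum_i \sum_j h a * S i j a b +
  \sum_b \sum_a \sum_i \sum_j k b * S i j a b).
  rewrite [X in _ + X + _ + _]exchange_big [X in _ + _ + _ + X]exchange_big.
  rewrite -[X in _ + X + _]exchange_big22 -[X in _ + X]exchange_big22.
  rewrite -!big_split; apply: eq_bigr => i _ /=.
  rewrite -!big_split; apply: eq_bigr => j _ /=.
  rewrite -!big_split; apply: eq_bigr => a _ /=.
  rewrite -!big_split; apply: eq_bigr => b _ /=.
  by rewrite !mulrDl.
rewrite !mulrDr; congr (_ + _ + _ + _).
- by apply: weighted_sum => i; apply: kernel_sum => // R; apply: row_norm1.
- apply: (weighted_sum g (F := fun j i a b => S i j a b)) => i.
  by apply: (@kernel_sum _ (fun R j => Y R j i)) => // R; apply: col_norm1.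
- apply: (weighted_sum h (F := fun a b i j => S i j a b)) => i.
  under eq_bigr do under eq_bigr do under eq_bigr do rewrite SC.
  by apply: (@kernel_sum _ (fun R j => Z R i j)) => // R; apply: row_norm1.
- apply: (weighted_sum k (F := fun b a i j => S i j a b)) => i.
  under eq_bigr do under eq_bigr do under eq_bigr do rewrite SC.
  by apply: (@kernel_sum _ (fun R j => Z R j i)) => // R; apply: col_norm1.
Qed.

Lemma mxtrace_dg4 (f g h k : 'I_n -> RR) (A B C D : 'M[CC]_n) :
  \tr (dg f * A * dg g * B * dg h * C * dg k * D) =
  \sum_i \sum_j \sum_a \sum_b rc (f i * g j * h a * k b) * (A i j * B j a * C a b * D b i).
Proof.
have dgl (q : 'I_n -> RR) (M N : 'M[CC]_n) i l : (M * dg q * N) i l = \sum_j M i j * rc (q j) * N j l.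
  rewrite mxE; apply: eq_bigr => j _; rewrite mxE (bigD1 j) //= dgE eqxx big1 ?addr0 //.
  by move=> t tj; rewrite dgE (negbTE tj) mulr0.
have dg0 (q : 'I_n -> RR) (N : 'M[CC]_n) i l : (dg q * N) i l = rc (q i) * N i l.
  by rewrite -[dg q]mul1r dgl (bigD1 i) //= mxE eqxx mulr1n mul1r big1 ?addr0 // => t ti;
    rewrite mxE eq_sym (negbTE ti) mulr0n !mul0r.
apply: eq_bigr => i _.
under [RHS]eq_bigr do rewrite exchange_big.
rewrite dgl [RHS]exchange_big /=; apply: eq_bigr => b _.
rewrite [RHS]exchange_big /= dgl !mulr_suml; apply: eq_bigr => a _.
rewrite dgl !mulr_suml; apply: eq_bigr => j _.
by rewrite dg0 !rcM; ring.
Qed.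

(** The product is at most the K-th power of the largest absolute value, and that power is one of
    the four summands; evenness of K makes all of them nonnegative. *)
Lemma even_powers_le (x y z w : RR) a b c e (K := (a + b + c + e)%N) : ~~ odd K ->
  `|x ^+ a * y ^+ b * z ^+ c * w ^+ e| <= x ^+ K + y ^+ K + z ^+ K + w ^+ K.
Proof.
move=> Ke.
have nE (u : RR) : u ^+ K = `|u| ^+ K by rewrite -normrX ger0_norm //; apply: exprn_even_ge0.
rewrite !normrM !normrX (nE x) (nE y) (nE z) (nE w).
move: (normr_ge0 x) (normr_ge0 y) (normr_ge0 z) (normr_ge0 w).
move: `|x| `|y| `|z| `|w| => {}x {}y {}z {}w x0 y0 z0 w0.
pose M := Num.max (Num.max x y) (Num.max z w).
have M0 : 0 <= M by rewrite !le_max x0.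
have [xM yM zM wM] : [/\ x <= M, y <= M, z <= M & w <= M].
  by rewrite /M !le_max !lexx !orbT.
apply: (@le_trans _ _ (M ^+ K)).
  by rewrite /K !exprD; do !(apply: ler_pM; rewrite ?mulr_ge0 ?exprn_ge0 //); apply: lerXn2r.
have p (u : RR) : 0 <= u -> 0 <= u ^+ K by exact: exprn_ge0.
have px := p _ x0; have py := p _ y0; have pz := p _ z0; have pw := p _ w0.
rewrite /M; case: (leP x y) => _; case: (leP z w) => _.
- by case: (leP y w) => _; lra.
- by case: (leP y z) => _; lra.
- by case: (leP x w) => _; lra.
- by case: (leP x z) => _; lra.
Qed.

Lemma rtr_conj_shuffle (U U' V V' f g h k R P : 'M[CC]_n) :
  rtr (U * f * U' * R * (U * g * U') * P * (V * h * V') * R * (V * k * V') * P) =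
  rtr (f * (U' * R * U) * g * (U' * P * V) * h * (V' * R * V) * k * (V' * P * U)).
Proof.
have E1 (T : pzRingType) (u u' v v' a b c d r p : T) :
  u * a * u' * r * (u * b * u') * p * (v * c * v') * r * (v * d * v') * p =
  u * (a * u' * r * (u * b * u') * p * (v * c * v') * r * (v * d * v') * p).
  by rewrite !mulrA.
have E2 (T : pzRingType) (u u' v v' a b c d r p : T) :
  a * u' * r * (u * b * u') * p * (v * c * v') * r * (v * d * v') * p * u =
  a * (u' * r * u) * b * (u' * p * v) * c * (v' * r * v) * d * (v' * p * u).
  by rewrite !mulrA.
by rewrite (E1 _ U U' V V' f g h k R P) [LHS]rtrC (E2 _ U U' V V' f g h k R P).
Qed.

(* In eigenbases of X and Y, AM-GM separates the two sums over F into squared norms, whose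
   weighted sums are computed exactly from the orthogonality of F. *)
Lemma crossing_bound (F : I -> 'M[CC]_n) (X Y : 'M[CC]_n) a b c e (K := (a + b + c + e)%N) :
  orth_unitary F -> dagger X = X -> dagger Y = Y -> ~~ odd K ->
  `|\sum_R \sum_P rtr (X ^+ a * F R * X ^+ b * F P * Y ^+ c * F R * Y ^+ e * F P)|
   <= 2 * (#|I|%:R * n%:R) * (rtr (X ^+ K) + rtr (Y ^+ K)).
Proof.
move=> HF /herm_spectral [U [x [U1 U2 ->]]] /herm_spectral [V [y [V1 V2 ->]]] Ke.
rewrite !(conjU_X _ _ U1 U2) !(conjU_X _ _ V1 V2) !dgX !rtr_conjU // !rtr_dg.
set fa := fun i => x i ^+ a; set fb := fun i => x i ^+ b.
set fc := fun i => y i ^+ c; set fe := fun i => y i ^+ e.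
pose R1 k := dagger U * F k * U; pose R2 k := dagger V * F k * V.
pose P1 k := dagger U * F k * V; pose P2 k := dagger V * F k * U.
have HR1 : orth_unitary R1 by apply: orth_unitary_conj.
have HR2 : orth_unitary R2 by apply: orth_unitary_conj.
have HP1 : orth_unitary P1 by apply: orth_unitary_conj.
have HP2 : orth_unitary P2 by apply: orth_unitary_conj.
have E R P : rtr (U * dg fa * dagger U * F R * (U * dg fb * dagger U) * F P *
    (V * dg fc * dagger V) * F R * (V * dg fe * dagger V) * F P) =
    \sum_i \sum_j \sum_k \sum_l fa i * fb j * fc k * fe l *
      cRe (R1 R i j * P1 P j k * R2 R k l * P2 P l i).
  transitivity (rtr (dg fa * R1 R * dg fb * P1 P * dg fc * R2 R * dg fe * P2 P)).
    exact: rtr_conj_shuffle.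
  rewrite /rtr mxtrace_dg4 cRe_sum; apply: eq_bigr => i _.
  rewrite cRe_sum; apply: eq_bigr => j _; rewrite cRe_sum; apply: eq_bigr => k _.
  by rewrite cRe_sum; apply: eq_bigr => l _; rewrite cReZ.
(* For fixed matrix indices, R occurs only in [R1], [R2] and P only in [P1], [P2], so the double sum
   over Paulis is a product of two single sums. *)
pose K1 i j k l := \sum_R R1 R i j * R2 R k l.
pose K2 j k l i := \sum_P P1 P j k * P2 P l i.
have -> : \sum_R \sum_P rtr (U * dg fa * dagger U * F R * (U * dg fb * dagger U) * F P *
    (V * dg fc * dagger V) * F R * (V * dg fe * dagger V) * F P) =
  \sum_i \sum_j \sum_k \sum_l fa i * fb j * fc k * fe l * cRe (K1 i j k l * K2 j k l i).
  under eq_bigr do under eq_bigr do rewrite E.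
  under eq_bigr do rewrite exchange_big; rewrite exchange_big; apply: eq_bigr => i _.
  under eq_bigr do rewrite exchange_big; rewrite exchange_big; apply: eq_bigr => j _.
  under eq_bigr do rewrite exchange_big; rewrite exchange_big; apply: eq_bigr => k _.
  under eq_bigr do rewrite exchange_big; rewrite exchange_big; apply: eq_bigr => l _.
  rewrite /K1 /K2 mulr_suml cRe_sum mulr_sumr; apply: eq_bigr => R _.
  rewrite mulr_sumr cRe_sum mulr_sumr; apply: eq_bigr => P _.
  by congr (_ * cRe _); ring.
pose L := fun i j k l => x i ^+ K + x j ^+ K + y k ^+ K + y l ^+ K.
apply: (@le_trans _ _ (\sum_i \sum_j \sum_k \sum_l
   (L i j k l * n2 (K1 i j k l) + L i j k l * n2 (K2 j k l i)) / 2)).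
  do 4![apply: le_trans (ler_norm_sum _ _ _) _; apply: ler_sum => ? _].
  rewrite normrM -mulrDr -[leRHS]mulrA; apply: ler_pM => //; last exact: n2_mul.
  exact: even_powers_le.
rewrite (_ : \sum_i _ = (\sum_i \sum_j \sum_k \sum_l L i j k l * n2 (K1 i j k l) +
   \sum_j \sum_k \sum_l \sum_i
     (x j ^+ K + y k ^+ K + y l ^+ K + x i ^+ K) * n2 (K2 j k l i)) / 2); last first.
  rewrite [X in (_ + X) / _](_ : _ = \sum_i \sum_j \sum_k \sum_l L i j k l * n2 (K2 j k l i)).
    rewrite -big_split mulr_suml; apply: eq_bigr => i _ /=.
    rewrite -big_split mulr_suml; apply: eq_bigr => j _ /=.
    rewrite -big_split mulr_suml; apply: eq_bigr => k _ /=.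
    by rewrite -big_split mulr_suml; apply: eq_bigr => l _.
  under eq_bigr do under eq_bigr do rewrite exchange_big.
  under eq_bigr do rewrite exchange_big.
  rewrite exchange_big; do 4![apply: eq_bigr => ? _]; rewrite /L; ring.
rewrite (kernel_marginals (fun i => x i ^+ K) (fun i => x i ^+ K) (fun i => y i ^+ K)
  (fun i => y i ^+ K) HR1 HR2).
rewrite (kernel_marginals (fun i => x i ^+ K) (fun i => y i ^+ K) (fun i => y i ^+ K)
  (fun i => x i ^+ K) HP1 HP2).
by rewrite le_eqVlt; apply/orP; left; apply/eqP; field.
Qed.
End Crossing.

Lemma sub_exprs (R : pzRingType) (x y : R) k :
  x ^+ k - y ^+ k = \sum_(a < k) x ^+ a * (x - y) * y ^+ (k - a.+1).
Proof.
elim: k => [|k IH]; first by rewrite big_ord0 !expr0 subrr.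
rewrite big_ord_recr /= subnn expr0 mulr1.
transitivity ((x ^+ k - y ^+ k) * y + x ^+ k * (x - y)).
  by rewrite mulrBl mulrBr -!exprSr [RHS]addrC addrA subrK.
rewrite IH mulr_suml; congr (_ + _); apply: eq_bigr => a _.
by rewrite -mulrA -exprSr subSn // subnSK.
Qed.

Ltac word_size := repeat (progress rewrite ?size_cat ?size_nseq /=).

(** * Random signs *)

Section Signs.
Variables (n : nat) (I : finType) (F : I -> 'M[CC]_n).
Hypothesis n0 : (0 < n)%N.
Hypothesis FH : forall i, dagger (F i) = F i.
Hypothesis FU : forall i, F i * F i = 1.
Variable s : RR.

Definition signs := {ffun I -> bool}.
Implicit Types v w : signs.
Definition sg v i : RR := if v i then -1 else 1.
Definition flip v i : signs := [ffun j => if j == i then ~~ v j else v j].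
Definition sign_sum v : 'M[CC]_n := \sum_i rc (s * sg v i) *: F i.
Definition tau (A : 'M[CC]_n) : RR := rtr A / n%:R.
Definition avg (f : signs -> RR) : RR := (\sum_v f v) / 2 ^+ #|I|.
Definition moment k : RR := avg (fun v => tau (sign_sum v ^+ k)).

Lemma card_signs : #|signs|%:R = 2 ^+ #|I| :> RR.
Proof. by rewrite card_ffun card_bool natrX. Qed.

Lemma flipK i : involutive (flip^~ i).
Proof.
by move=> v; apply/ffunP => j; rewrite !ffunE; case: eqP => // _; rewrite negbK.
Qed.
Lemma sg_flip v i : sg (flip v i) i = - sg v i.
Proof. by rewrite /sg ffunE eqxx; case: (v i); rewrite ?opprK. Qed.
Lemma sg_flip_neq v i j : j != i -> sg (flip v i) j = sg v j.
Proof. by rewrite /sg ffunE => /negbTE ->. Qed.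
Lemma sg_sq v i : sg v i * sg v i = 1.
Proof. by rewrite /sg; case: (v i); rewrite ?mulrNN mulr1. Qed.

Lemma sign_sum_herm v : dagger (sign_sum v) = sign_sum v.
Proof. by rewrite dagger_sum; apply: eq_bigr => i _; rewrite daggerZ FH. Qed.
Lemma sign_sum_flip v i : sign_sum v - sign_sum (flip v i) = rc (2 * s * sg v i) *: F i.
Proof.
rewrite /sign_sum -sumrB (bigD1 i) //= big1 => [|j ji].
  by rewrite addr0 sg_flip -scalerBl -rmorphB /=; congr (rc _ *: _); ring.
by rewrite sg_flip_neq // subrr.
Qed.

Lemma tauD A B : tau (A + B) = tau A + tau B. Proof. by rewrite /tau rtrD mulrDl. Qed.
Lemma tauN A : tau (- A) = - tau A. Proof. by rewrite /tau rtrN mulNr. Qed.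
Lemma tauZ r A : tau (rc r *: A) = r * tau A. Proof. by rewrite /tau rtrZ mulrA. Qed.
Lemma tau_sum (J : Type) (r : seq J) (P : pred J) (G : J -> 'M[CC]_n) :
  tau (\sum_(i <- r | P i) G i) = \sum_(i <- r | P i) tau (G i).
Proof. by rewrite /tau rtr_sum mulr_suml. Qed.
Lemma tau1 : tau 1 = 1. Proof. by rewrite /tau rtr1 divff // pnatr_eq0 -lt0n. Qed.
Lemma tauC A B : tau (A * B) = tau (B * A). Proof. by rewrite /tau rtrC. Qed.
Lemma scale_mull r (A B : 'M[CC]_n) : (r *: A) * B = r *: (A * B).
Proof. by symmetry; exact: scalemxAl. Qed.
Lemma scale_mulr r (A B : 'M[CC]_n) : A * (r *: B) = r *: (A * B).
Proof. by symmetry; exact: scalemxAr. Qed.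

Lemma avg_eq f g : f =1 g -> avg f = avg g.
Proof. by move=> fg; congr (_ / _); apply: eq_bigr. Qed.
Lemma avgD f g : avg (fun v => f v + g v) = avg f + avg g.
Proof. by rewrite /avg big_split mulrDl. Qed.
Lemma avgZ r f : avg (fun v => r * f v) = r * avg f.
Proof. by rewrite /avg -mulr_sumr mulrA. Qed.
Lemma avg_sum (J : Type) (r : seq J) (P : pred J) (G : J -> signs -> RR) :
  avg (fun v => \sum_(i <- r | P i) G i v) = \sum_(i <- r | P i) avg (G i).
Proof. by rewrite /avg exchange_big mulr_suml. Qed.
Lemma avg_le f g : (forall v, f v <= g v) -> avg f <= avg g.
Proof. by move=> fg; apply: ler_wpM2r; [rewrite invr_ge0 exprn_ge0|apply: ler_sum]. Qed.
Lemma avg_const r : avg (fun=> r) = r.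
Proof.
have E : \sum_(v : signs) r = r * 2 ^+ #|I| by rewrite -card_signs mulr_natr sumr_const.
by rewrite /avg E mulfK // expf_neq0 // pnatr_eq0.
Qed.
Lemma avg_norm f : `|avg f| <= avg (fun v => `|f v|).
Proof.
rewrite /avg normrM [`|_^-1|]ger0_norm ?invr_ge0 ?exprn_ge0 //.
by apply: ler_wpM2r; [rewrite invr_ge0 exprn_ge0|apply: ler_norm_sum].
Qed.
Lemma avg_flip f i : avg (fun v => f (flip v i)) = avg f.
Proof. by rewrite /avg [in RHS](reindex_inj (inv_inj (flipK i))). Qed.
(** Flipping sign i preserves the average and negates [sg v i], so averaging the two forms produces
    a discrete derivative. *)
Lemma avg_sg f i :
  avg (fun v => sg v i * f v) = avg (fun v => sg v i * (f v - f (flip v i))) / 2.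
Proof.
have E : avg (fun v => - sg v i * f (flip v i)) = avg (fun v => sg v i * f v).
  rewrite -(avg_flip _ i); apply: avg_eq => v.
  by rewrite sg_flip opprK (flipK i v).
have -> : avg (fun v => sg v i * (f v - f (flip v i))) =
   avg (fun v => sg v i * f v + - sg v i * f (flip v i)).
  by apply: avg_eq => v; ring.
by rewrite avgD E; field.
Qed.

Lemma moment0 : moment 0 = 1.
Proof. by rewrite /moment (avg_eq (g := fun=> 1)) ?avg_const // => v; rewrite expr0 tau1. Qed.
Lemma tau_even_ge0 A k : dagger A = A -> 0 <= tau (A ^+ k.*2).
Proof.
move=> AH; rewrite /tau divr_ge0 // -addnn exprD -{2}AH -daggerX; exact: rtr_sq_ge0.
Qed.
Lemma moment_even_ge0 k : 0 <= moment k.*2.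
Proof.
by rewrite -(avg_const 0); apply: avg_le => v; apply: tau_even_ge0; apply: sign_sum_herm.
Qed.

Definition neg_signs v : signs := [ffun i => ~~ v i].
Lemma neg_signsK : involutive neg_signs.
Proof. by move=> v; apply/ffunP => i; rewrite !ffunE negbK. Qed.
Lemma sg_neg v i : sg (neg_signs v) i = - sg v i.
Proof. by rewrite /sg ffunE; case: (v i); rewrite ?opprK. Qed.
Lemma sign_sum_neg v : sign_sum (neg_signs v) = - sign_sum v.
Proof. by rewrite /sign_sum -sumrN; apply: eq_bigr => i _; rewrite sg_neg mulrN rcN scaleNr. Qed.
Lemma moment_odd k : odd k -> moment k = 0.
Proof.
move=> ko; suff : moment k = - moment k by lra.
rewrite {1}/moment /avg (reindex_inj (inv_inj neg_signsK)) -mulNr -sumrN.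
congr (_ / _); apply: eq_bigr => v _; rewrite sign_sum_neg -tauN; congr tau.
by rewrite exprNn -signr_odd ko expr1 mulN1r.
Qed.

(** Four sign vectors suffice: a mixed difference in two vectors involves v, w and one flip of
    each. *)
Definition letter (vs : 'I_4 -> signs) (t : I + 'I_4) : 'M[CC]_n :=
  match t with inl i => F i | inr j => sign_sum (vs j) end.

(** In [word_holder] the maximum over letters is replaced by a sum; the term 1 accounts for all
    letters [F i] together, since their even powers are the identity. *)
Lemma tau_word_le (vs : 'I_4 -> signs) p (w : seq (I + 'I_4)) : (0 < p)%N -> size w = p.*2 ->
  `|tau (word (letter vs) w)| <= 1 + \sum_j tau (sign_sum (vs j) ^+ p.*2).
Proof.
move=> p0 sw; rewrite /tau normrM [`|_^-1|]ger0_norm ?invr_ge0 ?ler0n //.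
rewrite -mulr_suml ler_pdivrMr ?ltr0n // mulrDl mul1r divfK ?pnatr_eq0 -?lt0n //.
have X0 j : 0 <= rtr (sign_sum (vs j) ^+ p.*2).
  by rewrite -addnn exprD -{2}(sign_sum_herm (vs j)) -daggerX; exact: rtr_sq_ge0.
apply: (@word_holder _ _ _ _ p) => // -[i|j] /=; rewrite ?sign_sum_herm ?FH //.
  rewrite -{1}mul2n exprM expr2 FU expr1n rtr1 lerDl; apply: sumr_ge0 => j _; exact: X0.
by rewrite (bigD1 j) //= addrCA lerDl addr_ge0 ?ler0n ?sumr_ge0.
Qed.

(* Integration by parts: sg v i is averaged against the difference of the remaining factor under
   a flip of sign i. *)
Lemma moment_step k : moment k.+1 =
  s ^+ 2 * \sum_i \sum_(a < k) avg (fun v =>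
    tau (F i * sign_sum v ^+ a * F i * sign_sum (flip v i) ^+ (k - a.+1))).
Proof.
rewrite /moment (avg_eq (g := fun v => \sum_i s * (sg v i * tau (F i * sign_sum v ^+ k)))).
  rewrite avg_sum mulr_sumr; apply: eq_bigr => i _.
  rewrite avgZ avg_sg -avg_sum mulrCA [LHS]mulrC -!avgZ; apply: avg_eq => v.
  rewrite -tauN -tauD -mulrN -mulrDr sub_exprs mulr_sumr tau_sum !mulr_sumr.
  apply: eq_bigr => a _; rewrite sign_sum_flip scale_mulr scale_mull scale_mulr tauZ !mulrA.
  move: (rtr _) (sg_sq v i) => T e.
  transitivity (s ^+ 2 * (sg v i * sg v i) * T / n%:R); last by rewrite e mulr1.
  by field; rewrite pnatr_eq0 -lt0n.
move=> v; rewrite exprS {1}/sign_sum mulr_suml tau_sum; apply: eq_bigr => i _.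
by rewrite scale_mull tauZ mulrA.
Qed.

(** Telescoping the difference of powers replaces one factor X by 2 s times a letter [F i]. The word
    length stays 2p, so each of the b terms is controlled by a moment of order 2p, and flips do not
    change averaged moments. *)
Lemma unflip_error i a b p : (0 < p)%N -> (a + b).+2 = p.*2 -> 0 <= s ->
  `|avg (fun v => tau (F i * sign_sum v ^+ a * F i * sign_sum (flip v i) ^+ b)) -
    avg (fun v => tau (F i * sign_sum v ^+ a * F i * sign_sum v ^+ b))|
   <= 2 * s * b%:R * (1 + 4 * moment p.*2).
Proof.
move=> p0 ab s0.
have -> : avg (fun v => tau (F i * sign_sum v ^+ a * F i * sign_sum (flip v i) ^+ b)) -
    avg (fun v => tau (F i * sign_sum v ^+ a * F i * sign_sum v ^+ b)) =
  avg (fun v => tau (F i * sign_sum v ^+ a * F i * (sign_sum (flip v i) ^+ b - sign_sum v ^+ b))).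
  rewrite -mulN1r -avgZ -avgD; apply: avg_eq => v.
  by rewrite mulN1r -tauN -tauD -mulrN -mulrDr.
apply: le_trans (avg_norm _) _.
pose vs v (j : 'I_4) := if val j == 0%N then v else flip v i.
apply: (@le_trans _ _ (avg (fun v => 2 * s * b%:R * (1 + \sum_j tau (sign_sum (vs v j) ^+ p.*2))))).
  apply: avg_le => v; rewrite -normrN -tauN -mulrN opprB sub_exprs mulr_sumr tau_sum.
  apply: le_trans (ler_norm_sum _ _ _) _.
  rewrite [leRHS](_ : _ = \sum_(c < b) 2 * s * (1 + \sum_j tau (sign_sum (vs v j) ^+ p.*2))); last first.
    by rewrite sumr_const card_ord -[RHS]mulr_natl; ring.
  apply: ler_sum => c _.
  rewrite sign_sum_flip scale_mulr scale_mull scale_mulr tauZ normrM.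
  have -> : `|2 * s * sg v i| = 2 * s.
    by rewrite !normrM [`|2|]ger0_norm // ger0_norm // /sg; case: (v i);
       rewrite ?normrN normr1 mulr1.
  apply: ler_wpM2l; first by rewrite mulr_ge0.
  have := @tau_word_le (vs v) p ([:: inl i] ++ nseq a (inr ord0) ++ [:: inl i] ++ nseq c (inr ord0)
     ++ [:: inl i] ++ nseq (b - c.+1) (inr ord_max)) p0.
  rewrite !word_cat !word_nseq /word !big_seq1 /letter /vs /= !mulrA; apply.
  by word_size; have := ltn_ord c; lia.
rewrite avgZ avgD avg_const avg_sum.
apply: ler_wpM2l; first by rewrite !mulr_ge0.
suff -> : \sum_j avg (fun v => tau (sign_sum (vs v j) ^+ p.*2)) = 4 * moment p.*2 by [].
transitivity (\sum_(j < 4) moment p.*2); last by rewrite sumr_const card_ord mulr_natl.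
apply: eq_bigr => j _; rewrite /vs; case: (val j == 0%N); first exact: erefl.
exact: (avg_flip (fun v => tau (sign_sum v ^+ p.*2))).
Qed.

End Signs.

(** * Interpolation between independent and equal sign vectors *)

Lemma deriv_big_prod (R : comNzRingType) (J : eqType) (r : seq J) (G : J -> {poly R}) : uniq r ->
  (\prod_(i <- r) G i)^`() = \sum_(i <- r) (G i)^`() * \prod_(j <- r | j != i) G j.
Proof.
elim: r => [|i r IH]; first by rewrite !big_nil derivC.
move=> /= /andP[ir ur]; rewrite !big_cons derivM IH // eqxx mulr_sumr.
have -> : \prod_(j <- r | j != i) G j = \prod_(j <- r) G j.
  rewrite big_seq_cond [RHS]big_seq_cond; apply: eq_bigl => j; rewrite andbT.
  by case jr: (j \in r) => //=; apply: contraNneq ir => <-.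
congr (_ + _); apply: eq_big_seq => j jr; rewrite big_cons.
have -> : i != j by apply: contraNneq ir => ->.
by rewrite mulrCA.
Qed.

Section Interpolation.
Variable I : finType.
Local Notation signs := {ffun I -> bool}.
Implicit Types (v w : signs) (t : RR).

(* [avg2 t] is the expectation over pairs of sign vectors with coordinatewise correlation t. *)
Definition kernel t v w : RR := \prod_i ((1 + t * (sg v i * sg w i)) / 2).
Definition avg2 t (f : signs -> signs -> RR) : RR :=
  avg (fun v => \sum_w kernel t v w * f v w).

Lemma kernelC t v w : kernel t v w = kernel t w v.
Proof. by apply: eq_bigr => i _; rewrite (mulrC (sg v i)). Qed.
Lemma kernel_ge0 t v w : -1 <= t <= 1 -> 0 <= kernel t v w.
Proof.
move=> /andP[t1 t2]; apply: prodr_ge0 => i _; rewrite /sg.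
by case: (v i); case: (w i); lra.
Qed.
Lemma kernel_sum1 t v : \sum_w kernel t v w = 1.
Proof.
rewrite -(bigA_distr_bigA (fun i (b : bool) => (1 + t * (sg v i * (if b then -1 else 1))) / 2)).
by rewrite big1 // => i _; rewrite big_bool /=; field.
Qed.
Lemma kernel1 v w : kernel 1 v w = (v == w)%:R.
Proof.
case: eqP => [->|vw].
  by apply: big1 => i _; rewrite sg_sq; field.
have [i vi] : exists i, v i != w i.
  apply/existsP; rewrite -negb_forall; apply/negP => /forallP H.
  by apply: vw; apply/ffunP => i; apply/eqP.
rewrite /kernel (bigD1 i) //= (_ : 1 + 1 * (sg v i * sg w i) = 0) ?mul0r //.
by move: vi; rewrite /sg; case: (v i); case: (w i) => // _; ring.
Qed.

Lemma avg2_1 f : avg2 1 f = avg (fun v => f v v).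
Proof.
apply: avg_eq => v; rewrite (bigD1 v) //= kernel1 eqxx mul1r big1 ?addr0 // => w wv.
by rewrite kernel1 eq_sym (negbTE wv) mul0r.
Qed.
Lemma avg2_0 f : avg2 0 f = avg (fun v => avg (f v)).
Proof.
apply: avg_eq => v; rewrite /avg mulr_suml; apply: eq_bigr => w _.
rewrite mulrC; congr (_ * _); rewrite -exprVn -prodr_const; apply: eq_bigr => i _.
by rewrite mul0r addr0 mul1r.
Qed.
Lemma avg2_l t f : avg2 t (fun v _ => f v) = avg f.
Proof. by apply: avg_eq => v; rewrite -mulr_suml kernel_sum1 mul1r. Qed.
Lemma avg2_r t f : avg2 t (fun _ w => f w) = avg f.
Proof.
rewrite /avg2 avg_sum /avg mulr_suml; apply: eq_bigr => w _.
rewrite -mulr_suml (eq_bigr (fun v => kernel t w v)) ?kernel_sum1 ?mul1r // => v _.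
exact: kernelC.
Qed.
Lemma avg2_le t f g : -1 <= t <= 1 -> (forall v w, f v w <= g v w) -> avg2 t f <= avg2 t g.
Proof.
move=> Ht fg; apply: avg_le => v; apply: ler_sum => w _; apply: ler_wpM2l => //.
exact: kernel_ge0.
Qed.
Lemma avg2D t f g : avg2 t (fun v w => f v w + g v w) = avg2 t f + avg2 t g.
Proof.
rewrite -avgD; apply: avg_eq => v; rewrite -big_split; apply: eq_bigr => w _ /=.
by rewrite mulrDr.
Qed.
Lemma avg2Z t r f : avg2 t (fun v w => r * f v w) = r * avg2 t f.
Proof.
rewrite -avgZ; apply: avg_eq => v; rewrite mulr_sumr; apply: eq_bigr => w _.
by rewrite mulrCA.
Qed.
Lemma avg2_sum (J : Type) (r : seq J) (P : pred J) t (G : J -> signs -> signs -> RR) :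
  avg2 t (fun v w => \sum_(i <- r | P i) G i v w) = \sum_(i <- r | P i) avg2 t (G i).
Proof.
rewrite -avg_sum; apply: avg_eq => v; rewrite exchange_big; apply: eq_bigr => w _.
by rewrite mulr_sumr.
Qed.

Lemma avg2_two t h : avg2 t (fun v w => h v + h w) = 2 * avg h.
Proof. by rewrite avg2D avg2_l avg2_r; ring. Qed.
Lemma avg2_four t h R :
  avg2 t (fun v w => h v + h (flip v R) + h w + h (flip w R)) = 4 * avg h.
Proof.
rewrite !avg2D avg2_l (avg2_l t (fun v => h (flip v R))) avg2_r (avg2_r t (fun v => h (flip v R))).
by rewrite (avg_flip h); ring.
Qed.
Lemma avg2_affine t r c f : avg2 t (fun v w => r * (c + f v w)) = r * (c + avg2 t f).
Proof. by rewrite avg2Z avg2D (avg2_l t (fun=> c)) avg_const. Qed.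

Lemma avg2_norm_le t f g : -1 <= t <= 1 -> (forall v w, `|f v w| <= g v w) ->
  `|avg2 t f| <= avg2 t g.
Proof.
move=> Ht fg; have fg' v w : -1 * g v w <= f v w <= g v w.
  by rewrite mulN1r -ler_norml.
rewrite ler_norml -mulN1r -avg2Z.
by apply/andP; split; apply: avg2_le => // v w; have /andP[] := fg' v w.
Qed.

Definition diff2 (R : I) (f : signs -> signs -> RR) v w : RR :=
  sg v R * sg w R / 4 *
  (f v w - f (flip v R) w - f v (flip w R) + f (flip v R) (flip w R)).

Definition kernel' t (R : I) v w : RR :=
  \prod_(i | i != R) ((1 + t * (sg v i * sg w i)) / 2).

Lemma kernel'_flipl t R v w : kernel' t R (flip v R) w = kernel' t R v w.
Proof. by apply: eq_bigr => i iR; rewrite sg_flip_neq. Qed.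
Lemma kernel'_flipr t R v w : kernel' t R v (flip w R) = kernel' t R v w.
Proof. by apply: eq_bigr => i iR; rewrite sg_flip_neq. Qed.

(** The right-hand side is the derivative of [avg2 t f] in the correlation of coordinate R alone;
    summation by parts over the flips of that coordinate turns it into a mixed second difference of
    [f]. *)
Lemma avg2_diff2 t R f :
  avg2 t (diff2 R f) = avg (fun v => \sum_w sg v R * sg w R / 2 * kernel' t R v w * f v w).
Proof.
rewrite /avg2 /avg; congr (_ / _).
pose S (g : signs -> signs -> RR) := \sum_v \sum_w kernel' t R v w * g v w.
have Sl g : S (fun v w => g (flip v R) w) = S g.
  rewrite [RHS](reindex_inj (inv_inj (@flipK I R))) /=; apply: eq_bigr => v _.
  by apply: eq_bigr => w _; rewrite kernel'_flipl.
have Sr g : S (fun v w => g v (flip w R)) = S g.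
  apply: eq_bigr => v _; rewrite [RHS](reindex_inj (inv_inj (@flipK I R))) /=.
  by apply: eq_bigr => w _; rewrite kernel'_flipr.
have SE g h : (forall v w, g v w = h v w) -> S g = S h.
  by move=> gh; apply: eq_bigr => v _; apply: eq_bigr => w _; rewrite gh.
have SD g h : S (fun v w => g v w + h v w) = S g + S h.
  by rewrite -big_split; apply: eq_bigr => v _; rewrite -big_split; apply: eq_bigr => w _;
    rewrite mulrDr.
have SZ r g : S (fun v w => r * g v w) = r * S g.
  by rewrite mulr_sumr; apply: eq_bigr => v _; rewrite mulr_sumr; apply: eq_bigr => w _;
    rewrite mulrCA.
pose sf v w := sg v R * sg w R * f v w.
transitivity (S (fun v w => 2^-1 * sf v w)); last first.
  by apply: eq_bigr => v _; apply: eq_bigr => w _; rewrite /sf; field.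
(* With a, b the two signs at R, the factor (1 + t a b) / 2 of the kernel times a b / 4 is (a b + t)
   / 8. As [S] is invariant under flips at R, the part with a b yields four equal sums, and the part
   with t cancels. *)
transitivity (S (fun v w => 8^-1 * ((sf v w + sf (flip v R) w + sf v (flip w R) +
    sf (flip v R) (flip w R)) + t * (f v w + -1 * f (flip v R) w + -1 * f v (flip w R) +
    f (flip v R) (flip w R))))).
  apply: eq_bigr => v _; apply: eq_bigr => w _.
  rewrite /kernel (bigD1 R) //= -/(kernel' t R v w) /diff2 /sf !sg_flip.
  have e1 := sg_sq v R; have e2 := sg_sq w R.
  move: (sg v R) (sg w R) e1 e2 (kernel' _ _ _ _) => a b e1 e2 k.
  have e : (a * b) * (a * b) = 1 by rewrite mulrACA e1 e2 mulr1.
  transitivity (8^-1 * k * ((a * b) * (f v w - f (flip v R) w - f v (flip w R) + f (flip v R) (flip w R)) +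
   t * ((a * b) * (a * b)) * (f v w - f (flip v R) w - f v (flip w R) + f (flip v R) (flip w R)))).
    by field.
  by rewrite e; field.
rewrite !(SZ, SD) (Sl (fun v w => f v (flip w R))) (Sl (fun v w => sf v (flip w R))).
by rewrite !(Sl f, Sr f, Sl sf, Sr sf); field.
Qed.

(* Mean value theorem for the polynomial [t |-> avg2 t f], between independent signs (t = 0) and
   equal signs (t = 1). *)
Lemma interpolation f : exists2 t, -1 <= t <= 1 &
  avg (fun v => f v v) - avg (fun v => avg (f v)) = \sum_R avg2 t (diff2 R f).
Proof.
pose fac v w i : {poly RR} := (2^-1)%:P + (sg v i * sg w i / 2)%:P * 'X.
pose q : {poly RR} := \sum_v \sum_w (f v w / 2 ^+ #|I|)%:P * \prod_i fac v w i.
have facE v w i t : (fac v w i).[t] = (1 + t * (sg v i * sg w i)) / 2.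
  by rewrite /fac hornerD hornerM !hornerC hornerX; field.
have dfac v w i : (fac v w i)^`() = (sg v i * sg w i / 2)%:P.
  by rewrite /fac derivD derivM !derivC derivX mul0r !add0r mulr1.
have qE t : q.[t] = avg2 t f.
  rewrite /q horner_sum /avg2 /avg mulr_suml; apply: eq_bigr => v _.
  rewrite horner_sum mulr_suml; apply: eq_bigr => w _.
  rewrite hornerM hornerC horner_prod (eq_bigr _ (fun i _ => facE v w i t)).
  by rewrite -/(kernel t v w) mulrC mulrA.
have dE t : q^`().[t] = \sum_R avg2 t (diff2 R f).
  under [RHS]eq_bigr do rewrite avg2_diff2.
  rewrite -avg_sum /avg mulr_suml /q linear_sum /= horner_sum; apply: eq_bigr => v _.
  rewrite linear_sum /= horner_sum [X in _ = X / _]exchange_big /= mulr_suml; apply: eq_bigr => w _.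
  rewrite derivM derivC mul0r add0r hornerM hornerC deriv_big_prod ?index_enum_uniq //.
  rewrite horner_sum mulr_sumr mulr_suml; apply: eq_bigr => R _.
  rewrite dfac hornerM hornerC horner_prod (eq_bigr _ (fun i _ => facE v w i t)).
  rewrite -/(kernel' t R v w); move: (kernel' _ _ _ _) => k.
  by field; rewrite expf_neq0 // pnatr_eq0.
have [t /andP[t0 t1]] := poly_mvt q (@ltr01 RR).
rewrite !qE avg2_1 avg2_0 dE subr0 mulr1 => ->; exists t => //.
by move: t0 t1; rewrite !bnd_simp => t0 t1; apply/andP; split; lra.
Qed.

End Interpolation.

(** * Decoupling and the moment recursion *)

Section Decoupling.
Variables (n : nat) (I : finType) (F : I -> 'M[CC]_n).
Hypothesis n0 : (0 < n)%N.
Hypothesis FH : forall i, dagger (F i) = F i.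
Hypothesis FU : forall i, F i * F i = 1.
Hypothesis F_orth : forall i j, i != j -> \tr (F i * F j) = 0.
Variable s : RR.
Hypothesis s0 : 0 <= s.
Hypothesis s_card : s ^+ 2 * #|I|%:R = 1.
Local Notation signs := {ffun I -> bool}.
Local Notation X := (sign_sum F s).
Local Notation M := (moment F s).
Local Notation letter := (letter F s).
Implicit Types v w : signs.
Hypothesis sign_sum_scalar : forall b, exists c : RR, \sum_w X w ^+ b = rc c *: (1%:M : 'M[CC]_n).

Lemma F_orth_unitary : orth_unitary F.
Proof. by split=> [k|k|k l kl]; rewrite ?FH ?FU // F_orth. Qed.

(** Pointwise version of the replacement in [unflip_error], for a run inside an arbitrary word.
    Every telescoping term again has the length of the original word. *)
Lemma word_unflip (vs : 'I_4 -> signs) (j j' : 'I_4) R p k (w1 w2 : seq (I + 'I_4)) :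
  vs j' = flip (vs j) R -> (0 < p)%N -> (size w1 + size w2 + k)%N = p.*2 ->
  `|tau (word (letter vs) (w1 ++ nseq k (inr j') ++ w2)) -
    tau (word (letter vs) (w1 ++ nseq k (inr j) ++ w2))|
   <= 2 * s * k%:R * (1 + \sum_j tau (X (vs j) ^+ p.*2)).
Proof.
move=> vE p0 sz; set B := 1 + _.
have E : tau (word (letter vs) (w1 ++ nseq k (inr j) ++ w2)) -
    tau (word (letter vs) (w1 ++ nseq k (inr j') ++ w2)) =
  \sum_(g < k) 2 * s * sg (vs j) R *
    tau (word (letter vs) (w1 ++ nseq g (inr j) ++ [:: inl R] ++ nseq (k - g.+1) (inr j') ++ w2)).
  rewrite !word_cat !word_nseq /= -tauN -tauD -mulrBr -mulrBl sub_exprs vE sign_sum_flip.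
  rewrite mulr_suml mulr_sumr tau_sum; apply: eq_bigr => g _.
  rewrite scale_mulr !scale_mull scale_mulr tauZ !word_cat !word_nseq /=.
  rewrite word_cons word_cat word_nseq /= vE.
  by rewrite -(mulrA (X _ ^+ _) (F R)) -(mulrA (X _ ^+ _) (F R * _)) -(mulrA (F R)).
rewrite -normrN opprB E; apply: le_trans (ler_norm_sum _ _ _) _.
rewrite [leRHS](_ : _ = \sum_(c < k) 2 * s * B); last first.
  by rewrite sumr_const card_ord -[RHS]mulr_natl; ring.
apply: ler_sum => g _; rewrite normrM.
have -> : `|2 * s * sg (vs j) R| = 2 * s.
  by rewrite !normrM [`|2|]ger0_norm // ger0_norm // /sg; case: (vs j R);
     rewrite ?normrN normr1 mulr1.
apply: ler_wpM2l; first by rewrite mulr_ge0.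
by apply: tau_word_le => //; word_size; have := ltn_ord g; lia.
Qed.

Lemma tau_alt (A B C D : 'M[CC]_n) : tau A - tau B - tau C + tau D = tau (A - B - C + D).
Proof. by rewrite !(tauD, tauN). Qed.

(** The crossing pattern P, R, P, R which a second mixed difference at R creates in tau(P X^a P
    Y^b). The primed vectors will be the flips at R, which come from telescoping, and are then
    replaced by v and w. *)
Definition tau8 P R c a e b v v' w w' : RR :=
  tau (F P * (X v ^+ c * (F R * (X v' ^+ a * (F P * (X w ^+ e * (F R * X w' ^+ b))))))).

Lemma tau8_unflip p P R c a e b v w : (0 < p)%N -> (c + a + e + b + 4)%N = p.*2 ->
  `|tau8 P R c a e b v (flip v R) w (flip w R) - tau8 P R c a e b v v w w| <=
  2 * s * (a + b)%:R * (1 + (tau (X v ^+ p.*2) + tau (X (flip v R) ^+ p.*2) +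
    tau (X w ^+ p.*2) + tau (X (flip w R) ^+ p.*2))).
Proof.
move=> p0 E.
pose vs (j : 'I_4) := nth v [:: v; flip v R; w; flip w R] j.
pose j0 : 'I_4 := inord 0; pose j1 : 'I_4 := inord 1.
pose j2 : 'I_4 := inord 2; pose j3 : 'I_4 := inord 3.
have v0 : vs j0 = v by rewrite /vs inordK.
have v1 : vs j1 = flip v R by rewrite /vs inordK.
have v2 : vs j2 = w by rewrite /vs inordK.
have v3 : vs j3 = flip w R by rewrite /vs inordK.
pose l t : seq (I + 'I_4) := [:: t].
pose W k1 k2 := l (inl P) ++ nseq c (inr j0) ++ l (inl R) ++ nseq a (inr k1) ++ l (inl P) ++
   nseq e (inr j2) ++ l (inl R) ++ nseq b (inr k2).
have WE k1 k2 : tau (word (letter vs) (W k1 k2)) = tau8 P R c a e b v (vs k1) w (vs k2).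
  by rewrite /W /l !word_cat !word_nseq /word !big_seq1 /tau8 -v0 -v2 /letter v0 v2.
have SE : \sum_j tau (X (vs j) ^+ p.*2) = tau (X v ^+ p.*2) + tau (X (flip v R) ^+ p.*2) +
    tau (X w ^+ p.*2) + tau (X (flip w R) ^+ p.*2).
  by rewrite !big_ord_recr big_ord0 /= add0r.
have h1 := @word_unflip vs j0 j1 R p a (l (inl P) ++ nseq c (inr j0) ++ l (inl R))
  (l (inl P) ++ nseq e (inr j2) ++ l (inl R) ++ nseq b (inr j3)).
have h2 := @word_unflip vs j2 j3 R p b (l (inl P) ++ nseq c (inr j0) ++ l (inl R) ++
  nseq a (inr j0) ++ l (inl P) ++ nseq e (inr j2) ++ l (inl R)) [::].
rewrite -!catA -!/(W _ _) ?cats0 !WE v0 v1 v2 v3 SE in h1 h2.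
have {}h1 := h1 erefl p0 _; have {}h2 := h2 erefl p0 _.
rewrite (natrD _ a b) (mulrDr (2 * s)) (mulrDl _ _ (1 + _)).
apply: le_trans (ler_distD (tau8 P R c a e b v v w (flip w R)) _ _) _.
by apply: lerD; [apply: h1|apply: h2]; word_size; lia.
Qed.

Lemma tau8_crossing c a e b v w : ~~ odd (c + a + e + b) ->
  `|\sum_R \sum_P tau8 P R c a e b v v w w| <=
  2 * (#|I|%:R * n%:R) * (tau (X v ^+ (c + a + e + b)) + tau (X w ^+ (c + a + e + b))).
Proof.
move=> Ke; have nn : 0 < n%:R :> RR by rewrite ltr0n.
have assoc (T : pzRingType) (y1 y2 y3 y4 y5 y6 y7 : T) :
  y1 * (y2 * (y3 * (y4 * (y5 * (y6 * y7))))) = y1 * y2 * y3 * y4 * y5 * y6 * y7.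
  by rewrite !mulrA.
have E R P : tau8 P R c a e b v v w w =
   rtr (X v ^+ c * F R * X v ^+ a * F P * X w ^+ e * F R * X w ^+ b * F P) / n%:R.
  rewrite /tau8 /tau [X in X / _]rtrC; congr (rtr (_ * _) / _).
  exact: assoc.
under eq_bigr do under eq_bigr do rewrite E.
under eq_bigr do rewrite -mulr_suml.
rewrite -mulr_suml normrM [`|_^-1|]ger0_norm ?invr_ge0 ?ler0n //.
rewrite ler_pdivrMr // /tau -mulrDl -[leRHS]mulrA divfK ?gt_eqF //.
by apply: crossing_bound => //; [exact: F_orth_unitary|exact: sign_sum_herm|exact: sign_sum_herm].
Qed.

(** At correlation 1 the function [f] below gives the averaged expression, at correlation 0 the
    product of moments. The derivative carries s^4: the crossing sum of order m n becomes n s^2 = n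
    / m, small because the family is exponentially larger than the dimension, while the m^2
    unflipping errors keep only their own factor s. *)
Lemma decoupling_error a b p : (0 < p)%N -> (a + b).+2 = p.*2 ->
  `|avg (fun v => s ^+ 2 * \sum_P tau (F P * X v ^+ a * F P * X v ^+ b)) - M a * M b|
   <= (a * b)%:R * (4 * n%:R * s ^+ 2 * M (p - 2).*2 + 2 * s * (a + b)%:R * (1 + 4 * M p.*2)).
Proof.
move=> p0 ab.
pose f v w := s ^+ 2 * \sum_P tau (F P * X v ^+ a * F P * X w ^+ b).
(* With w independent of v, the average of X_w^b is the scalar M b; the two factors P then meet and
   cancel, and s^2 m = 1 removes the sum over P. *)
have f0 : avg (fun v => avg (f v)) = M a * M b.
  have [c Hc] : exists c : RR, \sum_w X w ^+ b = rc c *: (1 : 'M[CC]_n) := sign_sum_scalar b.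
  pose c' := c / 2 ^+ #|I|.
  have Mb : M b = c' by rewrite /moment /avg -tau_sum Hc tauZ tau1 // mulr1.
  have fE v : avg (f v) = c' * tau (X v ^+ a).
    rewrite /f avgZ avg_sum.
    have E P : avg (fun w => tau (F P * X v ^+ a * F P * X w ^+ b)) = c' * tau (X v ^+ a).
      rewrite /avg -tau_sum -mulr_sumr Hc scale_mulr mulr1 tauZ.
      rewrite -(mulrA (F P)) tauC -(mulrA (X v ^+ a)) FU mulr1 /c'; move: (tau _) => T; ring.
    rewrite (eq_bigr _ (fun P _ => E P)) sumr_const -mulr_natl mulrA s_card mul1r //.
  by rewrite (avg_eq fE) avgZ Mb mulrC.
have [t Ht] := interpolation f.
rewrite f0 => ->.
have D R v w : diff2 R f v w = s ^+ 4 * \sum_(c < a) \sum_(e < b) \sum_P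
    tau8 P R c (a - c.+1) e (b - e.+1) v (flip v R) w (flip w R).
  have lin (r A B C D : RR) : r * A - r * B - r * C + r * D = r * (A - B - C + D) by ring.
  rewrite /diff2 /f lin -!sumrB -big_split /=.
  have E P : tau (F P * X v ^+ a * F P * X w ^+ b) - tau (F P * X (flip v R) ^+ a * F P * X w ^+ b)
    - tau (F P * X v ^+ a * F P * X (flip w R) ^+ b) +
    tau (F P * X (flip v R) ^+ a * F P * X (flip w R) ^+ b) =
    4 * s ^+ 2 * sg v R * sg w R * \sum_(c < a) \sum_(e < b)
      tau8 P R c (a - c.+1) e (b - e.+1) v (flip v R) w (flip w R).
    (* The mixed difference is a product of two differences; telescoping each puts one [F R] into
       either half. *)
    transitivity (tau (F P * (X v ^+ a - X (flip v R) ^+ a) * (F P * (X w ^+ b - X (flip w R) ^+ b)))).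
      rewrite tau_alt; apply: congr1.
      have ex (T : pzRingType) (f1 x x' y y' : T) : f1 * x * f1 * y - f1 * x' * f1 * y -
         f1 * x * f1 * y' + f1 * x' * f1 * y' = f1 * (x - x') * (f1 * (y - y')).
        by rewrite !(mulrBr, mulrBl) !mulrA opprB addrA [RHS]addrAC.
      exact: ex.
    rewrite !sub_exprs sign_sum_flip sign_sum_flip
      [F P * \sum_(i < a) _]mulr_sumr [F P * \sum_(i < b) _]mulr_sumr.
    rewrite mulr_suml tau_sum [RHS]mulr_sumr.
    apply: eq_bigr => c _; rewrite [X in tau X]mulr_sumr tau_sum [RHS]mulr_sumr; apply: eq_bigr => e _.
    rewrite !(scale_mulr, scale_mull) !tauZ /tau8.
    rewrite (_ : F P * (X v ^+ c * F R * X (flip v R) ^+ (a - c.+1)) *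
        (F P * (X w ^+ e * F R * X (flip w R) ^+ (b - e.+1))) =
      F P * (X v ^+ c * (F R * (X (flip v R) ^+ (a - c.+1) * (F P * (X w ^+ e *
       (F R * X (flip w R) ^+ (b - e.+1)))))))); last by rewrite -!mulrA.
    by move: (tau _) => T; ring.
  rewrite (eq_bigr _ (fun P _ => E P)) -mulr_sumr.
  under [X in _ = s ^+ 4 * X]eq_bigr do rewrite exchange_big.
  rewrite [X in _ = s ^+ 4 * X]exchange_big /=.
  have e1 := sg_sq v R; have e2 := sg_sq w R.
  move: (sg v R) (sg w R) (\sum_P _) e1 e2 => x y T e1 e2.
  transitivity (s ^+ 4 * (x * x) * (y * y) * T); last by rewrite e1 e2 !mulr1.
  by field.
rewrite -avg2_sum; set m : RR := #|I|%:R.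
pose T4 R v w : RR := tau (X v ^+ p.*2) + tau (X (flip v R) ^+ p.*2) +
    tau (X w ^+ p.*2) + tau (X (flip w R) ^+ p.*2).
(* For p = 1 the subtraction truncates, but then a = b = 0 and the crossing sum is empty. *)
pose K := (p - 2).*2.
pose B v w : RR := 2 * (m * n%:R) * (tau (X v ^+ K) + tau (X w ^+ K)) +
   m * \sum_R 2 * s * (a + b)%:R * (1 + T4 R v w).
have T40 R v w : 0 <= T4 R v w by rewrite /T4 !addr_ge0 // tau_even_ge0 ?sign_sum_herm.
have pt v w : `|\sum_R diff2 R f v w| <= s ^+ 4 * (a * b)%:R * B v w.
  rewrite (eq_bigr _ (fun R _ => D R v w)) -mulr_sumr normrM ger0_norm ?exprn_ge0 //.
  rewrite -mulrA; apply: ler_wpM2l; first exact: exprn_ge0.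
  rewrite exchange_big /=.
  under eq_bigr do rewrite exchange_big /=.
  rewrite natrM -mulrA.
  rewrite [leRHS](_ : _ = \sum_(c < a) \sum_(e < b) B v w); last first.
    by rewrite !sumr_const !card_ord !mulr_natl.
  apply: le_trans (ler_norm_sum _ _ _) _; apply: ler_sum => c _.
  apply: le_trans (ler_norm_sum _ _ _) _; apply: ler_sum => e _.
  have ca := ltn_ord c; have eb := ltn_ord e.
  have KE : (c + (a - c.+1) + e + (b - e.+1))%N = K by rewrite /K; lia.
  have h := @tau8_crossing c (a - c.+1) e (b - e.+1) v w.
  rewrite KE /K odd_double in h; have {}h := h isT.
  pose dd R P := tau8 P R c (a - c.+1) e (b - e.+1) v (flip v R) w (flip w R) -
     tau8 P R c (a - c.+1) e (b - e.+1) v v w w.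
  have -> : \sum_R \sum_P tau8 P R c (a - c.+1) e (b - e.+1) v (flip v R) w (flip w R) =
    \sum_R \sum_P tau8 P R c (a - c.+1) e (b - e.+1) v v w w + \sum_R \sum_P dd R P.
    rewrite -big_split; apply: eq_bigr => R _; rewrite -big_split; apply: eq_bigr => P _.
    by rewrite /dd /= addrC subrK.
  apply: le_trans (ler_normD _ _) _; apply: lerD; first exact: h.
  apply: le_trans (ler_norm_sum _ _ _) _; rewrite mulr_sumr; apply: ler_sum => R _.
  apply: le_trans (ler_norm_sum _ _ _) _.
  rewrite [leRHS](_ : _ = \sum_(P : I) 2 * s * (a + b)%:R * (1 + T4 R v w)); last first.
    by rewrite sumr_const -[RHS]mulr_natl.
  apply: ler_sum => P _; apply: le_trans (@tau8_unflip p _ _ _ _ _ _ _ _ p0 _) _; first by lia.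
  apply: ler_wpM2r; first exact: addr_ge0 ler01 (T40 R v w).
  by apply: ler_wpM2l; [rewrite mulr_ge0|rewrite ler_nat; lia].
have -> : (a * b)%:R * (4 * n%:R * s ^+ 2 * M (p - 2).*2 + 2 * s * (a + b)%:R * (1 + 4 * M p.*2))
   = avg2 t (fun v w => s ^+ 4 * (a * b)%:R * B v w).
  have e1 : avg2 t (fun v w => tau (X v ^+ K) + tau (X w ^+ K)) = 2 * M K.
    exact: (avg2_two t (fun v => tau (X v ^+ K))).
  have e2 R : avg2 t (T4 R) = 4 * M p.*2.
    exact: (avg2_four t (fun v => tau (X v ^+ p.*2)) R).
  rewrite avg2Z /B avg2D !avg2Z e1 avg2_sum -/K.
  rewrite (eq_bigr (fun=> 2 * s * (a + b)%:R * (1 + 4 * M p.*2))) => [|R _]; last first.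
    by rewrite avg2_affine e2.
  have -> (r : RR) : \sum_(R : I) r = m * r by rewrite sumr_const -[LHS]mulr_natl.
  rewrite -/K; move: (M K) (M p.*2) => x y.
  transitivity ((a * b)%:R * ((s ^+ 2 * m) * (s ^+ 2 * n%:R * (4 * x)) +
     (s ^+ 2 * m) * (s ^+ 2 * m) * (2 * s * (a + b)%:R * (1 + 4 * y)))); last by ring.
  by rewrite s_card; ring.
by apply: avg2_norm_le.
Qed.
End Decoupling.

Lemma sum_even_ord (R : nmodType) (q : nat) (G : nat -> R) : (forall a, odd a -> G a = 0) ->
  \sum_(a < q.*2.+1) G a = \sum_(j < q.+1) G j.*2.
Proof.
move=> G0; elim: q => [|q IH]; first by rewrite !big_ord_recr !big_ord0.
rewrite doubleS big_ord_recr [RHS]big_ord_recr -IH /=; congr (_ + _).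
by rewrite big_ord_recr /= G0 ?addr0 //= odd_double.
Qed.

Lemma sum_inv_sq_le q : \sum_(j < q) (j.+1%:R ^- 2 : RR) <= 2.
Proof.
(* The correction 1/(q+1) makes the bound inductive, since 1/(x+1)^2 is at most 1/x - 1/(x+1). *)
suff H : forall q, \sum_(j < q.+1) (j.+1%:R ^- 2 : RR) <= 2 - q.+1%:R^-1.
  case: q => [|q]; first by rewrite big_ord0.
  by apply: le_trans (H q) _; rewrite gerBl invr_ge0.
move=> {}q; elim: q => [|q IH]; first by rewrite big_ord1 expr1n invr1; lra.
rewrite big_ord_recr /=; apply: le_trans (lerD IH (lexx _)) _.
have x0 : 0 < q.+1%:R :> RR by rewrite ltr0n.
rewrite -[q.+2]addn1 natrD; move: (q.+1%:R : RR) x0 => x x0.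
rewrite -subr_ge0.
have -> : 2 - (x + 1)^-1 - (2 - x^-1 + (x + 1) ^- 2) = x^-1 * (x + 1) ^- 2.
  by field; rewrite !gt_eqF // addr_gt0.
by rewrite mulr_ge0 // invr_ge0 ?exprn_ge0 // ltW // addr_gt0.
Qed.

(** With x = j+1 and y = p-j, so that x + y = p+1, the inequality (x + y)^2 <= 2 (x^2 + y^2) divides
    into one between inverse squares. Each of the two remaining sums is at most 2, whence 8 = 2 (2 +
    2). *)
Lemma convolution_inv_sq_le p :
  \sum_(j < p) (j.+1%:R ^- 2 * (p.-1 - j).+1%:R ^- 2 : RR) <= 8 * p.+1%:R ^- 2.
Proof.
have E : \sum_(j < p) ((p.-1 - j).+1%:R ^- 2 : RR) = \sum_(j < p) j.+1%:R ^- 2.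
  rewrite [RHS](reindex_inj rev_ord_inj) /=; apply: eq_bigr => j _.
  by congr (_%:R ^- 2); have := ltn_ord j; lia.
apply: (@le_trans _ _ (2 * p.+1%:R ^- 2 * (\sum_(j < p) (j.+1%:R ^- 2 : RR) +
   \sum_(j < p) ((p.-1 - j).+1%:R ^- 2 : RR)))); last first.
  have p0 : 0 <= p.+1%:R ^- 2 :> RR by rewrite invr_ge0 exprn_ge0.
  have := sum_inv_sq_le p; rewrite E; move: (\sum_(j < p) _) => S S2.
  rewrite (_ : 8 * _ = 2 * p.+1%:R ^- 2 * 4); last by ring.
  by apply: ler_wpM2l; [rewrite mulr_ge0|lra].
rewrite -big_split mulr_sumr; apply: ler_sum => j _ /=.
have -> : p.+1%:R = j.+1%:R + (p.-1 - j).+1%:R :> RR.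
  by rewrite -natrD; congr (_%:R); have := ltn_ord j; lia.
have : 0 < j.+1%:R :> RR by rewrite ltr0n.
have : 0 < (p.-1 - j).+1%:R :> RR by rewrite ltr0n.
move: (j.+1%:R : RR) ((p.-1 - j).+1%:R : RR) => x y y0 x0.
have xy0 : 0 < x + y by rewrite addr_gt0.
rewrite -subr_ge0.
have -> : 2 * (x + y) ^- 2 * (x ^- 2 + y ^- 2) - x ^- 2 * y ^- 2 =
   (x - y) ^+ 2 * ((x + y) ^- 2 * (x ^- 2 * y ^- 2)).
  by field; rewrite !gt_eqF.
by rewrite mulr_ge0 ?sqr_ge0 // !mulr_ge0 // invr_ge0 exprn_ge0 // ltW.
Qed.

(** The polynomial error terms are beaten by m / 2^N, which grows like (3/2)^N; the power 12 is the
    one that appears for the error of order s. Since (1 + 1/40)^13 <= 3/2, Bernoulli provides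
    thirteen linear factors: twelve for the power and one to absorb A. *)
Lemma poly_le_exp (A : RR) : exists N0, forall N, (N0 <= N)%N ->
  A * N.+1%:R ^+ 12 <= (3 / 2) ^+ N.
Proof.
pose B := `|A * 40 ^+ 13|.
exists (Num.bound B) => N hN.
have BN : B <= N.+1%:R.
  apply: le_trans (ltW (archi_boundP (normr_ge0 _))) _.
  by rewrite ler_nat; apply: leq_trans hN _.
have N1 : 0 < N.+1%:R :> RR by rewrite ltr0n.
have h1 : (1 + 40^-1 : RR) ^+ 13 <= 3 / 2 by lra.
have h2 : N.+1%:R / 40 <= (1 + 40^-1 : RR) ^+ N.
  elim: (N) => [|k IH]; first by rewrite expr0; lra.
  have k0 : (0 : RR) <= k%:R by rewrite ler0n.
  rewrite exprS -[k.+2]addn1 natrD.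
  suff : 1 + k%:R / 40 <= (1 + 40^-1 : RR) ^+ k by lra.
  elim: (k) => [|l IHl]; first by rewrite expr0 mul0r addr0.
  have l0 : (0 : RR) <= l%:R by rewrite ler0n.
  by rewrite exprS -[l.+1]addn1 natrD; lra.
apply: (@le_trans _ _ (((1 + 40^-1 : RR) ^+ 13) ^+ N)); last first.
  by apply: lerXn2r => //; rewrite nnegrE ?exprn_ge0 //; lra.
rewrite -exprM mulnC exprM.
apply: (@le_trans _ _ ((N.+1%:R / 40) ^+ 13)); last first.
  apply: lerXn2r => //; rewrite nnegrE ?exprn_ge0 // ?divr_ge0 //; lra.
rewrite expr_div_n ler_pdivlMr ?exprn_gt0 // mulrAC exprS; apply: ler_wpM2r.
  by rewrite exprn_ge0.
exact: le_trans (ler_norm _) BN.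
Qed.

Section MomentBound.
Variables (n : nat) (I : finType) (F : I -> 'M[CC]_n).
Hypothesis n0 : (0 < n)%N.
Hypothesis FH : forall i, dagger (F i) = F i.
Hypothesis FU : forall i, F i * F i = 1.
Hypothesis F_orth : forall i j, i != j -> \tr (F i * F j) = 0.
Variable s : RR.
Hypothesis s0 : 0 <= s.
Hypothesis s_card : s ^+ 2 * #|I|%:R = 1.
Local Notation X := (sign_sum F s).
Local Notation M := (moment F s).
Hypothesis sign_sum_scalar : forall b, exists c : RR, \sum_w X w ^+ b = rc c *: (1%:M : 'M[CC]_n).

(** Triangle inequality: X has norm at most s m = sqrt m. This handles the finitely many small N.
    The induction carries a unitary prefix W because each step moves one letter into it. *)
Lemma moment_trivial_le p : M p.*2 <= #|I|%:R ^+ p.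
Proof.
have H q v (W : 'M[CC]_n) : W * dagger W = 1 -> `|tau (W * X v ^+ q)| <= (s * #|I|%:R) ^+ q.
  elim: q W => [|q IH] W WU.
    rewrite !expr0 /tau normrM [`|_^-1|]ger0_norm ?invr_ge0 // ler_pdivrMr ?ltr0n // mul1r.
    apply: le_trans (rtr_cs _ _) _; rewrite WU dagger1 mulr1 rtr1; lra.
  rewrite exprS {1}/sign_sum mulr_suml mulr_sumr tau_sum.
  apply: le_trans (ler_norm_sum _ _ _) _.
  rewrite [leRHS](_ : _ = \sum_(i : I) s * (s * #|I|%:R) ^+ q); last first.
    by rewrite sumr_const -[RHS]mulr_natl exprS; ring.
  apply: ler_sum => i _; rewrite scale_mull scale_mulr tauZ normrM.
  have -> : `|s * sg v i| = s.
    by rewrite normrM ger0_norm // /sg; case: (v i); rewrite ?normrN normr1 mulr1.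
  apply: ler_wpM2l => //; rewrite mulrA; apply: IH.
  by rewrite dagger_mul FH mulrA -(mulrA W) FU mulr1.
have -> : #|I|%:R ^+ p = (s * #|I|%:R) ^+ p.*2.
  rewrite -mul2n exprM; congr (_ ^+ _).
  by transitivity (s ^+ 2 * #|I|%:R * #|I|%:R); [rewrite s_card mul1r|ring].
rewrite -[leRHS](@avg_const I); rewrite /moment; apply: avg_le => v.
apply: le_trans (ler_norm _) _; rewrite -[X v ^+ _]mul1r; apply: H.
by rewrite dagger1 mulr1.
Qed.

Lemma combine_errors (a b u r Y Z T T' P : RR) : 0 <= a -> 0 <= b -> a + b <= u -> 2 <= u ->
  0 <= r -> 0 <= Y -> 0 <= Z -> T - P <= a * b * (Y + 2 * r * (a + b) * Z) ->
  T' - T <= 2 * r * b * Z -> T' <= P + u ^+ 2 * Y + 4 * r * u ^+ 3 * Z.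
Proof.
move=> a0 b0 abu u2 r0 Y0 Z0 h1 h2.
have rZ : 0 <= r * Z by rewrite mulr_ge0.
have ab2 : a * b <= u ^+ 2 by rewrite expr2; apply: ler_pM => //; lra.
have e1 : a * b * Y <= u ^+ 2 * Y by apply: ler_wpM2r.
have e2 : a * b * (a + b) * (r * Z) <= u ^+ 3 * (r * Z).
  apply: ler_wpM2r => //; rewrite [u ^+ 3]exprSr; apply: ler_pM => //; first exact: mulr_ge0.
  exact: addr_ge0.
have e3 : b * (r * Z) <= u ^+ 3 * (r * Z).
  apply: ler_wpM2r => //; apply: (@le_trans _ _ u); first by lra.
  by rewrite exprS ler_peMr ?exprn_ege1 //; lra.
move: h1 h2 e1 e2 e3.
have -> : a * b * (Y + 2 * r * (a + b) * Z) = a * b * Y + 2 * (a * b * (a + b) * (r * Z)) by ring.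
have -> : 2 * r * b * Z = 2 * (b * (r * Z)) by ring.
have -> : 4 * r * u ^+ 3 * Z = 4 * (u ^+ 3 * (r * Z)) by ring.
move: (a * b * Y) (a * b * (a + b) * (r * Z)) (b * (r * Z)) (u ^+ 2 * Y) (u ^+ 3 * (r * Z)).
move=> *; lra.
Qed.

Lemma moment_even_term_le a p : (0 < p)%N -> (a < p.*2.-1)%N ->
  s ^+ 2 * \sum_i avg (fun v => tau (F i * X v ^+ a * F i * X (flip v i) ^+ (p.*2.-1 - a.+1)))
  <= M a * M (p.*2.-2 - a) + p.*2%:R ^+ 2 * (4 * n%:R * s ^+ 2 * M (p - 2).*2)
   + 4 * s * p.*2%:R ^+ 3 * (1 + 4 * M p.*2).
Proof.
move=> p0 ap; set b := (p.*2.-1 - a.+1)%N.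
have -> : (p.*2.-2 - a = b)%N by rewrite /b; lia.
have ab : (a + b).+2 = p.*2 by rewrite /b; lia.
set u : RR := p.*2%:R.
have u2 : 2 <= u by rewrite /u ler_nat; lia.
have := decoupling_error n0 FH FU F_orth s0 s_card sign_sum_scalar p0 ab.
rewrite avgZ avg_sum ler_norml => /andP[_ h1].
have h2 : s ^+ 2 * \sum_i avg (fun v => tau (F i * X v ^+ a * F i * X (flip v i) ^+ b)) -
   s ^+ 2 * \sum_i avg (fun v => tau (F i * X v ^+ a * F i * X v ^+ b)) <=
   2 * s * b%:R * (1 + 4 * M p.*2).
  rewrite -mulrBr -sumrB; set B := 2 * s * _ * _.
  have -> : B = s ^+ 2 * (#|I|%:R * B) by rewrite mulrA s_card mul1r.
  apply: ler_wpM2l; first exact: exprn_ge0.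
  rewrite mulr_natl -sumr_const; apply: ler_sum => i _.
  by apply: le_trans (ler_norm _) _; apply: unflip_error.
have M0' := moment_even_ge0 FH s (p - 2); have M1 := moment_even_ge0 FH s p.
have an : 0 <= a%:R :> RR by []. have bn : 0 <= b%:R :> RR by [].
have abu : a%:R + b%:R <= u by rewrite -(natrD _ a b) ler_nat; lia.
rewrite natrM natrD in h1.
apply: combine_errors h1 h2 => //.
  by apply: mulr_ge0 M0'; apply: mulr_ge0; [apply: mulr_ge0|apply: exprn_ge0].
by apply: addr_ge0 => //; apply: mulr_ge0.
Qed.

(** Odd moments vanish under negation of all signs, so only even a survive. The main term is the
    Catalan recursion satisfied by the moments of the semicircle law. *)
Lemma moment_rec p : (0 < p)%N ->
  M p.*2 <= \sum_(j < p) M j.*2 * M (p.-1 - j).*2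
   + p.*2%:R ^+ 3 * (4 * n%:R * s ^+ 2 * M (p - 2).*2) + 4 * s * p.*2%:R ^+ 4 * (1 + 4 * M p.*2).
Proof.
move=> p0; set u : RR := p.*2%:R.
set Y := u ^+ 2 * (4 * n%:R * s ^+ 2 * M (p - 2).*2); set Z := 4 * s * u ^+ 3 * (1 + 4 * M p.*2).
have M0' := moment_even_ge0 FH s (p - 2); have M1 := moment_even_ge0 FH s p.
have u0 : 0 <= u by [].
have Y0 : 0 <= Y.
  apply: mulr_ge0; first exact: exprn_ge0.
  by apply: mulr_ge0 M0'; apply: mulr_ge0; [apply: mulr_ge0|apply: exprn_ge0].
have Z0 : 0 <= Z.
  apply: mulr_ge0; last by apply: addr_ge0 => //; apply: mulr_ge0.
  by apply: mulr_ge0; [apply: mulr_ge0|apply: exprn_ge0].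
have E : M p.*2 = \sum_(a < p.*2.-1) s ^+ 2 * \sum_i
    avg (fun v => tau (F i * X v ^+ a * F i * X (flip v i) ^+ (p.*2.-1 - a.+1))).
  by rewrite -{1}[p.*2]prednK ?double_gt0 // moment_step // -mulr_sumr exchange_big.
have : M p.*2 <= \sum_(a < p.*2.-1) (M a * M (p.*2.-2 - a) + Y + Z).
  by rewrite E; apply: ler_sum => a _; apply: moment_even_term_le.
rewrite !big_split /= !sumr_const card_ord -[Y *+ _]mulr_natl -[Z *+ _]mulr_natl.
have <- : \sum_(a < p.*2.-1) M a * M (p.*2.-2 - a) = \sum_(j < p) M j.*2 * M (p.-1 - j).*2.
  case: p p0 {u Y Z M0' M1 u0 Y0 Z0 E} => // p _.
  rewrite (@sum_even_ord _ p (fun a => M a * M (p.+1.*2.-2 - a))) => [|a ao].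
    by apply: eq_bigr => j _; rewrite /= -doubleB.
  by rewrite moment_odd ?mul0r.
have ku : p.*2.-1%:R <= u by rewrite ler_nat leq_pred.
move=> h; apply: le_trans h _; apply: lerD; first apply: lerD => //.
  apply: le_trans (ler_wpM2r Y0 ku) _; rewrite /Y; move: (M _) => x.
  by rewrite le_eqVlt; apply/orP; left; apply/eqP; ring.
apply: le_trans (ler_wpM2r Z0 ku) _; rewrite /Z; move: (M _) => x.
by rewrite le_eqVlt; apply/orP; left; apply/eqP; ring.
Qed.

(* The factor (p+1)^-2 makes the bound stable under the convolution in [moment_rec]. *)
Lemma moment_induction N :
  (N.+1%:R) ^+ 2 * (2 * (N.*2%:R ^+ 3 * (4 * n%:R * s ^+ 2))) <= 1 ->
  (N.+1%:R) ^+ 2 * (2 * (4 * s * N.*2%:R ^+ 4)) <= 1 ->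
  forall p, (p <= N)%N -> M p.*2 <= 18 ^+ p * p.+1%:R ^- 2.
Proof.
move=> hD hE; elim/ltn_ind => [[|p]] IH pN.
  by rewrite double0 moment0 // expr0 expr1n invr1 mulr1.
have pNw := ltnW pN; have := moment_rec (ltn0Sn p).
set D := p.+1.*2%:R ^+ 3 * _; set E := 4 * s * _.
set S := \sum_(j < _) _.
have M1 := moment_even_ge0 FH s p.+1.
have x0 : 0 < p.+2%:R :> RR by rewrite ltr0n.
have y0 : 0 <= p.+1.*2%:R :> RR by [].
have yN : p.+1.*2%:R <= N.*2%:R :> RR by rewrite ler_nat leq_double.
have xN : p.+2%:R <= N.+1%:R :> RR by rewrite ler_nat ltnS.
have C1 k : 1 <= 18 ^+ k :> RR by rewrite exprn_ege1 // ler1n.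
have hS : S <= 18 ^+ p * (8 * p.+2%:R ^- 2).
  apply: (@le_trans _ _ (18 ^+ p * \sum_(j < p.+1) (j.+1%:R ^- 2 * (p - j).+1%:R ^- 2 : RR))); last first.
    by apply: ler_wpM2l; [rewrite exprn_ge0|apply: (convolution_inv_sq_le p.+1)].
  rewrite mulr_sumr; apply: ler_sum => j _; have jp := ltn_ord j; rewrite ltnS in jp.
  have -> : 18 ^+ p = 18 ^+ j * 18 ^+ (p - j) :> RR by rewrite -exprD subnKC.
  rewrite [leRHS]mulrACA; apply: ler_pM; [exact: moment_even_ge0|exact: moment_even_ge0|
    exact: IH (leq_trans jp pNw)|exact: IH (leq_subr _ _) (leq_trans (leq_subr _ _) pNw)].
have hM2 : M (p.+1 - 2).*2 <= 18 ^+ p.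
  have qp : (p.+1 - 2 <= p)%N by rewrite subSS leq_subr.
  apply: le_trans (IH (p.+1 - 2)%N qp (leq_trans qp pNw)) _.
  rewrite -[leRHS]mulr1; apply: ler_pM; rewrite ?exprn_ge0 ?invr_ge0 ?exprn_ge0 //.
    by apply: ler_weXn2l; [rewrite ler1n|].
  by rewrite invf_le1 ?exprn_gt0 ?ltr0n // exprn_ege1 // ler1n.
have hE' : p.+2%:R ^+ 2 * (2 * E) <= 1.
  apply: le_trans hE; apply: ler_pM; rewrite ?exprn_ge0 ?mulr_ge0 ?exprn_ge0 //.
    by apply: lerXn2r; rewrite ?nnegrE ?(ltW x0).
  by apply: ler_wpM2l => //; apply: ler_wpM2l; [rewrite mulr_ge0|apply: lerXn2r; rewrite ?nnegrE].
have hD' : p.+2%:R ^+ 2 * (2 * D) <= 18 ^+ p.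
  rewrite -[leRHS]mul1r.
  have -> : p.+2%:R ^+ 2 * (2 * D) = p.+2%:R ^+ 2 * (2 * (p.+1.*2%:R ^+ 3 * (4 * n%:R * s ^+ 2)))
       * M (p.+1 - 2).*2 by rewrite /D; ring.
  apply: ler_pM => //; [by rewrite ?mulr_ge0 ?exprn_ge0|exact: moment_even_ge0|].
  apply: le_trans hD; apply: ler_pM; rewrite ?mulr_ge0 ?exprn_ge0 //.
    by apply: lerXn2r; rewrite ?nnegrE ?(ltW x0).
  by apply: ler_wpM2l => //; apply: ler_wpM2r; [rewrite !mulr_ge0 ?exprn_ge0|apply: lerXn2r; rewrite ?nnegrE].
have x2 : 2 <= p.+2%:R :> RR by rewrite ler_nat.
have X2 : 4 <= p.+2%:R ^+ 2 :> RR by rewrite expr2; nra.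
rewrite ler_pdivlMr ?exprn_gt0 // [18 ^+ p.+1]exprS.
have {}hS : p.+2%:R ^+ 2 * S <= 8 * 18 ^+ p.
  apply: le_trans (ler_wpM2l _ hS) _; first by rewrite exprn_ge0.
  move: (p.+2%:R : RR) x0 => x x0; rewrite le_eqVlt; apply/orP; left; apply/eqP.
  by field; rewrite gt_eqF.
have E0 : 0 <= E by rewrite /E !mulr_ge0 ?exprn_ge0.
have E8 : E <= 8^-1 by nra.
have := C1 p; move: (18 ^+ p) hS hD' hE' => c hS hD' hE' c1 h.
move: M1 h X2 hS hD' hE' E0 E8; move: (M p.+1.*2) (p.+2%:R ^+ 2) D E S => m' x' D' E' S' *.
(* As 4 E <= 1/2, the moment of order 2p on the right is absorbed by the left at the price of a
   factor 2. The convolution then contributes 2 * 8 and the two error terms 1 each, which is the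
   constant 18. *)
have h1 : m' <= 2 * S' + 2 * D' + 2 * E' by nra.
have : x' * m' <= x' * (2 * S' + 2 * D' + 2 * E') by apply: ler_wpM2l => //; lra.
rewrite [m' * _]mulrC; lra.
Qed.
End MomentBound.

Lemma moment_bound (c : RR) : 0 < c -> exists C : RR, 1 <= C /\
  forall (N : nat) (I : finType) (F : I -> 'M[CC]_(2 ^ N)) (s : RR),
  (forall i, dagger (F i) = F i) -> (forall i, F i * F i = 1) ->
  (forall i j, i != j -> \tr (F i * F j) = 0) -> 0 <= s -> s ^+ 2 * #|I|%:R = 1 ->
  (forall b, exists c : RR, \sum_w sign_sum F s w ^+ b = rc c *: (1%:M : 'M[CC]_(2 ^ N))) ->
  c * 3 ^+ N <= #|I|%:R -> (#|I| <= 4 ^ N)%N ->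
  moment F s N.*2 <= C ^+ N.
Proof.
move=> c0; have [N0 HN0] := poly_le_exp (2 ^+ 14 / c).
(* For N < N0 the trivial bound m^N <= (4^N)^N is enough; for larger N the induction gives 18^N. *)
exists (4 ^+ N0 + 18); split; first by apply: ler_wpDl; [exact: exprn_ge0|lra].
move=> N I F s FH FU Fo s0 sc Xs mlow mup.
have n0 : (0 < 2 ^ N)%N by rewrite expn_gt0.
case: (leqP N0 N) => [NN|NN]; last first.
  apply: le_trans (moment_trivial_le n0 FH FU s0 sc N) _.
  apply: lerXn2r; rewrite ?nnegrE // ?addr_ge0 ?exprn_ge0 //.
  apply: (@le_trans _ _ (4 ^ N)%:R); first by rewrite ler_nat.
  rewrite natrX; apply: (@le_trans _ _ (4 ^+ N0)); last by rewrite lerDl.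
  by apply: ler_weXn2l; [rewrite ler1n|apply: ltnW].
have {HN0} := HN0 N NN.
rewrite mulrAC ler_pdivrMr // => H.
set x : RR := N.+1%:R in H.
have x1 : 1 <= x by rewrite ler1n.
have m0 : 0 < #|I|%:R :> RR by apply: lt_le_trans mlow; rewrite mulr_gt0 ?exprn_gt0.
have sE : s ^+ 2 = #|I|%:R^-1 by apply: (mulIf (lt0r_neq0 m0)); rewrite sc mulVf ?gt_eqF.
have y0 : 0 <= N.*2%:R :> RR by [].
have yx : N.*2%:R <= 2 * x by rewrite -natrM ler_nat; lia.
have xp k l : (k <= l)%N -> x ^+ k <= x ^+ l by move=> kl; apply: ler_weXn2l.
have h3 : (3 / 2) ^+ N * 2 ^+ N = 3 ^+ N :> RR by rewrite -exprMn; congr (_ ^+ _); field.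
have p2 : 1 <= 2 ^+ N :> RR by rewrite exprn_ege1 // ler1n.
have h32 : (3 / 2) ^+ N * c <= c * 3 ^+ N.
  by rewrite mulrC -h3; apply: ler_wpM2l; [lra|rewrite ler_peMr // exprn_ge0 //; lra].
have hD : x ^+ 2 * (2 * (N.*2%:R ^+ 3 * (4 * (2 ^ N)%:R * s ^+ 2))) <= 1.
  have n2 : (2 ^ N)%:R = 2 ^+ N :> RR by rewrite natrX.
  rewrite sE n2; move: (#|I|%:R^-1) (mulVf (lt0r_neq0 m0)) => mi mi1.
  have mi0 : 0 <= mi by rewrite -(pmulr_lge0 _ m0) mi1.
  rewrite -[leRHS]mi1 [leRHS]mulrC; set u : RR := N.*2%:R.
  have -> : x ^+ 2 * (2 * (u ^+ 3 * (4 * 2 ^+ N * mi))) = 2 ^+ N * (8 * x ^+ 2 * u ^+ 3) * mi by ring.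
  apply: ler_wpM2r => //; apply: le_trans mlow.
  have -> : c * 3 ^+ N = 2 ^+ N * ((3 / 2) ^+ N * c) by rewrite -h3; ring.
  apply: ler_wpM2l; first lra.
  apply: le_trans H.
  apply: (@le_trans _ _ (8 * x ^+ 2 * (2 * x) ^+ 3)).
    apply: ler_wpM2l; first by rewrite mulr_ge0 ?exprn_ge0 //; lra.
    by apply: lerXn2r; rewrite ?nnegrE //; lra.
  have -> : 8 * x ^+ 2 * (2 * x) ^+ 3 = 64 * x ^+ 5 by ring.
  by apply: ler_pM; rewrite ?exprn_ge0 ?xp //; lra.
have hE : x ^+ 2 * (2 * (4 * s * N.*2%:R ^+ 4)) <= 1.
  have e0 : 0 <= x ^+ 2 * (2 * (4 * s * N.*2%:R ^+ 4)).
    by rewrite !mulr_ge0 ?exprn_ge0 //; lra.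
  (* Squaring replaces s by s^2 = 1/m, to which the lower bound on m applies. *)
  rewrite -(@ler_pXn2r _ 2) ?nnegrE // expr1n.
  have -> : (x ^+ 2 * (2 * (4 * s * N.*2%:R ^+ 4))) ^+ 2 =
    (64 * x ^+ 4 * N.*2%:R ^+ 8) * s ^+ 2 by ring.
  rewrite sE ler_pdivrMr // mul1r; apply: le_trans mlow; apply: le_trans h32; apply: le_trans H.
  apply: (@le_trans _ _ (64 * x ^+ 4 * (2 * x) ^+ 8)).
    apply: ler_wpM2l; first by rewrite mulr_ge0 ?exprn_ge0 //; lra.
    by apply: lerXn2r; rewrite ?nnegrE //; lra.
  by rewrite le_eqVlt; apply/orP; left; apply/eqP; ring.
apply: le_trans (moment_induction n0 FH FU Fo s0 sc Xs hD hE (leqnn N)) _.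
rewrite -[leRHS]mulr1; apply: ler_pM; rewrite ?exprn_ge0 ?invr_ge0 ?exprn_ge0 //.
  by apply: lerXn2r; rewrite ?nnegrE // ?addr_ge0 ?exprn_ge0 // lerDr exprn_ge0.
by rewrite invf_le1 ?exprn_gt0 ?ltr0n // exprn_ege1 // ler1n.
Qed.

(** * Tensor products of qubit matrices *)

Section Bits.
Variable N : nat.

Lemma bit_decomp M i : (i < 2 ^ M)%N -> i = (\sum_(k < M) (i %/ 2 ^ k) %% 2 * 2 ^ k)%N.
Proof.
elim: M i => [|M IH] i iM; first by rewrite big_ord0; move: iM; rewrite expn0; case: i.
rewrite big_ord_recl expn0 divn1 muln1 {1}(divn_eq i 2) addnC; congr (_ + _)%N.
have h : (i %/ 2 < 2 ^ M)%N by rewrite ltn_divLR // -expnSr.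
rewrite [in LHS](IH _ h) big_distrl; apply: eq_bigr => k _ /=.
by rewrite /bump add1n -divnMA -expnS -mulnA -expnSr.
Qed.

Definition bits (i : 'I_(2 ^ N)) : {ffun 'I_N -> 'I_2} := [ffun k => bitk i k].

Lemma bits_inj : injective bits.
Proof.
move=> i j ij; apply: val_inj; rewrite /= (bit_decomp (ltn_ord i)) (bit_decomp (ltn_ord j)).
apply: eq_bigr => k _; have /ffunP/(_ k) := ij; rewrite !ffunE => /(congr1 val).
by rewrite /bitk /= !inordK ?ltn_mod // => ->.
Qed.

Lemma bits_bij : bijective bits.
Proof. by apply: inj_card_bij bits_inj _; rewrite card_ffun !card_ord. Qed.

Lemma sum_bits (R : comPzRingType) (f : 'I_N -> 'I_2 -> R) :
  \sum_(i < 2 ^ N) \prod_k f k (bitk i k) = \prod_k \sum_b f k b.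
Proof.
rewrite bigA_distr_bigA (reindex bits) /=; last exact: onW_bij bits_bij.
by apply: eq_bigr => i _; apply: eq_bigr => k _; rewrite ffunE.
Qed.

Lemma eq_bits (i j : 'I_(2 ^ N)) : (i == j) = [forall k, bitk i k == bitk j k].
Proof.
apply/eqP/forallP => [-> k|H]; first exact: eqxx.
by apply: bits_inj; apply/ffunP => k; rewrite !ffunE; apply/eqP.
Qed.
End Bits.

Section Tensor.
Variable N : nat.
Implicit Types G H : 'I_N -> 'M[CC]_2.

Definition tensor G : 'M[CC]_(2 ^ N) :=
  \matrix_(i, j) \prod_(k < N) G k (bitk i k) (bitk j k).

Lemma eq_tensor G H : G =1 H -> tensor G = tensor H.
Proof. by move=> GH; apply/matrixP => i j; rewrite !mxE; apply: eq_bigr => k _; rewrite GH. Qed.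

Lemma tensorM G H : tensor G * tensor H = tensor (fun k => G k * H k).
Proof.
apply/matrixP => i j; rewrite !mxE.
under eq_bigr do rewrite !mxE -big_split /=.
rewrite (sum_bits (fun k b => G k (bitk i k) b * H k b (bitk j k))).
by apply: eq_bigr => k _; rewrite mxE.
Qed.

Lemma prod_bool (b : 'I_N -> bool) : \prod_k ((b k)%:R : CC) = [forall k, b k]%:R.
Proof.
case: forallP => [H|/forallP]; first by apply: big1 => k _; rewrite H.
by rewrite negb_forall => /existsP[k /negbTE nb]; rewrite (bigD1 k) //= nb mul0r.
Qed.

Lemma tensor1 : tensor (fun=> 1) = 1.
Proof.
apply/matrixP => i j; rewrite !mxE; under eq_bigr do rewrite mxE.
by rewrite prod_bool -eq_bits.
Qed.

Lemma tr_tensor G : \tr (tensor G) = \prod_k \tr (G k).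
Proof.
rewrite -(sum_bits (fun k b => G k b b)).
by apply: eq_bigr => i _; rewrite mxE.
Qed.

Lemma dagger_tensor G : dagger (tensor G) = tensor (fun k => dagger (G k)).
Proof.
apply/matrixP => i j; rewrite daggerE !mxE rmorph_prod /=.
by apply: eq_bigr => k _; rewrite daggerE.
Qed.

Lemma tensorZ (c : 'I_N -> CC) G : tensor (fun k => c k *: G k) = (\prod_k c k) *: tensor G.
Proof.
by apply/matrixP => i j; rewrite !mxE -big_split; apply: eq_bigr => k _; rewrite mxE.
Qed.
End Tensor.

(** * Pauli operators *)

Section OneQubit.
(* The Pauli matrices, numbered 0 = identity, 1 = X, 2 = Y, 3 = Z. *)
Definition sigma (a : 'I_4) : 'M[CC]_2 := \matrix_(b, c)
  match val a with
  | 0%N => (b == c)%:R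
  | 1%N => (b != c)%:R
  | 2%N => if b == c then 0 else if b == 0 then - 'i else 'i
  | _ => if b == c then if b == 0 then 1 else - 1 else 0
  end.

Definition anticomm (a b : 'I_4) : bool := [&& a != 0, b != 0 & a != b].

Lemma ord2P (P : 'I_2 -> Prop) : P 0 -> P 1 -> forall i, P i.
Proof.
move=> P0 P1 [[|[|//]] h]; [move: P0|move: P1]; congr P; exact: val_inj.
Qed.
Lemma ord4P (P : 'I_4 -> Prop) : P 0 -> P 1 -> P (inord 2) -> P (inord 3) -> forall i, P i.
Proof.
move=> P0 P1 P2 P3 [[|[|[|[|//]]]] h]; [move: P0|move: P1|move: P2|move: P3];
  by congr P; apply: val_inj; rewrite /= ?inordK.
Qed.
Lemma sum_ord2 (R : nmodType) (f : 'I_2 -> R) : \sum_b f b = f 0 + f 1.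
Proof. by rewrite big_ord_recl big_ord1; congr (_ + f _); apply: val_inj. Qed.
Lemma sum_ord4 (R : nmodType) (f : 'I_4 -> R) :
  \sum_b f b = f 0 + f 1 + f (inord 2) + f (inord 3).
Proof.
rewrite !big_ord_recl big_ord0 addr0 !addrA.
by congr (_ + f _ + f _ + f _); apply: val_inj; rewrite /= ?inordK.
Qed.

Lemma sigma_herm a : dagger (sigma a) = sigma a.
Proof.
apply/matrixP; elim/ord4P: a; elim/ord2P; elim/ord2P; rewrite daggerE !mxE /= ?inordK //=;
  by rewrite ?rmorphN /= ?conjCi ?opprK ?conjC0 ?conjC1.
Qed.

Lemma sqr_i : 'i * 'i = -1 :> CC. Proof. by rewrite -expr2 sqrCi. Qed.

Lemma sigma_sq a : sigma a * sigma a = 1.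
Proof.
apply/matrixP; elim/ord4P: a; elim/ord2P; elim/ord2P; rewrite !mxE sum_ord2 !mxE /= ?inordK //=;
  by have := sqr_i; move: 'i => x e; ring: e.
Qed.

Lemma sigma_comm b a : sigma b * sigma a = (-1) ^+ anticomm b a *: (sigma a * sigma b).
Proof.
apply/matrixP; elim/ord4P: a; elim/ord4P: b; elim/ord2P; elim/ord2P;
  rewrite !mxE !sum_ord2 !mxE /anticomm -!val_eqE /= ?inordK //= ?expr0 ?expr1; ring.
Qed.

Lemma sigma_conj b a : sigma b * sigma a * sigma b = (-1) ^+ anticomm b a *: sigma a.
Proof.
rewrite sigma_comm -[LHS]scalemxAl; congr (_ *: _).
by rewrite -[LHS]mulrA sigma_sq mulr1.
Qed.

Lemma sigma_orth a b : a != b -> \tr (sigma a * sigma b) = 0.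
Proof.
elim/ord4P: a; elim/ord4P: b; rewrite // /mxtrace sum_ord2 !mxE !sum_ord2 !mxE /= ?inordK //= ?eqxx // => _;
  by have := sqr_i; move: 'i => x e; ring: e.
Qed.

(** The sum of sigma_t (x) sigma_t over t is twice the swap operator; written in entries, the
    identity multiplies over qubits. *)
Lemma sigma_twirl i a b j :
  \sum_(t : 'I_4) sigma t i a * sigma t b j = 2 * ((i == j) && (a == b))%:R.
Proof.
rewrite sum_ord4 !mxE /= !inordK //=.
move: i a b j; do 4!elim/ord2P; rewrite /=;
  by have := sqr_i; move: 'i => x e; ring: e.
Qed.
End OneQubit.

Section Pauli.
Variable N : nat.
Local Notation pidx := {ffun 'I_N -> 'I_4}.
Implicit Types s t : pidx.

Definition pauli s : 'M[CC]_(2 ^ N) := tensor (fun k => sigma (s k)).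
Definition anti s t : bool := odd (\sum_k anticomm (s k) (t k)).

Lemma pauli_herm s : dagger (pauli s) = pauli s.
Proof. by rewrite dagger_tensor; apply: eq_tensor => k; rewrite sigma_herm. Qed.
Lemma pauli_sq s : pauli s * pauli s = 1.
Proof. by rewrite tensorM -tensor1; apply: eq_tensor => k; rewrite sigma_sq. Qed.
Lemma pauli_orth s t : s != t -> \tr (pauli s * pauli t) = 0.
Proof.
move=> st; rewrite tensorM tr_tensor.
have [k sk] : exists k, s k != t k.
  apply/existsP; rewrite -negb_forall; apply: contra st => /forallP H.
  by apply/eqP/ffunP => k; apply/eqP.
by rewrite (bigD1 k) //= sigma_orth ?mul0r.
Qed.
Lemma pauli_conj s t : pauli s * pauli t * pauli s = (-1) ^+ anti s t *: pauli t.
Proof.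
rewrite !tensorM /anti signr_odd -prodrXr.
under eq_tensor => k do rewrite sigma_conj.
exact: tensorZ.
Qed.
Lemma pauli_twirl (Y : 'M[CC]_(2 ^ N)) :
  \sum_s pauli s * Y * pauli s = (2 ^+ N * \tr Y) *: (1 : 'M[CC]_(2 ^ N)).
Proof.
have E i a b j : \sum_s pauli s i a * pauli s b j = 2 ^+ N * ((i == j) && (a == b))%:R.
  transitivity (\sum_(s : pidx) \prod_k (sigma (s k) (bitk i k) (bitk a k) *
      sigma (s k) (bitk b k) (bitk j k))).
    by apply: eq_bigr => s _; rewrite !mxE -big_split.
  rewrite -(bigA_distr_bigA (fun k (x : 'I_4) => sigma x (bitk i k) (bitk a k) * sigma x (bitk b k) (bitk j k))).
  under eq_bigr do rewrite sigma_twirl.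
  rewrite big_split /= prodr_const card_ord prod_bool !eq_bits; congr (_ * (nat_of_bool _)%:R).
  apply/forallP/andP => [H|[/forallP H1 /forallP H2] k]; last by rewrite H1 H2.
  by split; apply/forallP => k; have /andP[] := H k.
apply/matrixP => i j; rewrite summxE.
transitivity (\sum_a \sum_b Y a b * \sum_s pauli s i a * pauli s b j).
  under [RHS]eq_bigr do under eq_bigr do rewrite mulr_sumr.
  under [RHS]eq_bigr do rewrite exchange_big.
  rewrite [RHS]exchange_big; apply: eq_bigr => s _.
  rewrite [RHS]exchange_big mxE; apply: eq_bigr => b _.
  rewrite mxE mulr_suml; apply: eq_bigr => a _ /=; ring.
rewrite !mxE mulr_sumr mulr_suml; apply: eq_bigr => a _.
rewrite (bigD1 a) //= E eqxx andbT big1 => [|b ba]; first by rewrite addr0; ring.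
by rewrite E [a == b]eq_sym (negbTE ba) andbF !mulr0.
Qed.
End Pauli.

Section PauliFamily.
Variables (N : nat) (I : finType) (f : I -> {ffun 'I_N -> 'I_4}) (s : RR).
Local Notation F := (fun i => pauli (f i)).
Local Notation X := (sign_sum F s).

(** Conjugation by a Pauli negates the members of the family that anticommute with it, which only
    permutes the sign vectors. The sum thus commutes with every Pauli and is scalar by twirling; it
    is a real multiple because it is Hermitian. *)
Lemma pauli_sums_scalar b :
  exists c : RR, \sum_w X w ^+ b = rc c *: (1%:M : 'M[CC]_(2 ^ N)).
Proof.
set Y := \sum_w _.
have YH : dagger Y = Y.
  rewrite dagger_sum; apply: eq_bigr => v _; rewrite daggerX sign_sum_herm // => i.
  exact: pauli_herm.
have Yc t : pauli t * Y * pauli t = Y.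
  pose g (v : {ffun I -> bool}) : {ffun I -> bool} := [ffun i => v i (+) anti t (f i)].
  have gK : involutive g by move=> v; apply/ffunP => i; rewrite !ffunE -addbA addbb addbF.
  rewrite [RHS](reindex_inj (inv_inj gK)) mulr_sumr mulr_suml; apply: eq_bigr => v _.
  have Pt := pauli_sq t; have Pd := pauli_herm t.
  have -> : pauli t * X v ^+ b * pauli t = (pauli t * X v * pauli t) ^+ b.
    by rewrite -{2 4}Pd conjU_X ?Pd.
  congr (_ ^+ _); rewrite mulr_sumr mulr_suml; apply: eq_bigr => i _.
  rewrite scale_mulr scale_mull pauli_conj scalerA; congr (_ *: _).
  rewrite /sg ffunE; case: (v i); case: (anti _ _); rewrite ?expr0 ?expr1 ?mulr1 //.
    by rewrite !rcM rcN rc1; ring.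
  by rewrite !rcM rcN rc1; ring.
have := pauli_twirl Y; under eq_bigr do rewrite Yc.
rewrite sumr_const card_ffun !card_ord => E.
exists (rtr Y / 2 ^+ N).
have tr_real : \tr Y = rc (rtr Y).
  rewrite /rc /rtr /cRe RRe_real //; apply/CrealP; rewrite -{2}YH /mxtrace rmorph_sum.
  by apply: eq_bigr => i _; rewrite daggerE.
have n0 : (4 ^ N)%:R != 0 :> CC by rewrite pnatr_eq0 expn_eq0.
apply: (scalerI n0); rewrite scaler_nat E scalerA; congr (_ *: _).
rewrite tr_real rcM -[rc _^-1]/(rc _^-1) /rc fmorphV rmorphXn rmorph_nat.
have e2 : (2 : CC) ^+ N != 0 by rewrite expf_neq0 // pnatr_eq0.
rewrite natrX (_ : 4 = 2 * 2 :> CC) -?natrM // natrM exprMn; field.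
exact: e2.
Qed.
End PauliFamily.

(** * Pauli strings of a fixed weight and the information in a product effect *)

Section Weight.
Variable N : nat.
Local Notation pidx := {ffun 'I_N -> 'I_4}.
Definition supp (x : pidx) : {set 'I_N} := [set k | x k != 0].
Definition wt (x : pidx) : nat := #|supp x|.

(** The strings with a given support form a product set, on which the sum factors over the
    qubits. *)
Lemma weight_sum (R : comPzRingType) w (g : 'I_N -> 'I_4 -> R) :
  \sum_(x | wt x == w) \prod_k g k (x k) =
  \sum_(S : {set 'I_N} | #|S| == w) \prod_k (if k \in S then \sum_(a | a != 0) g k a else g k 0).
Proof.
rewrite (partition_big supp (fun S => #|S| == w)) //=; apply: eq_bigr => S Sw.
transitivity (\prod_k \sum_(a | (a != 0) == (k \in S)) g k a).
  rewrite bigA_distr_big_dep; apply: eq_bigl => x.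
  apply/andP/familyP => [[_ /eqP <-] k|H].
    by rewrite unfold_in /= inE.
  have e : supp x = S.
    by apply/setP => k; have := H k; rewrite unfold_in /= inE => /eqP.
  by rewrite /wt e.
apply: eq_bigr => k _; case: (k \in S); first by apply: eq_bigl => a; case: (a != 0).
by rewrite (big_pred1 0) // => a; rewrite /= eqbF_neg negbK.
Qed.

Lemma card_weight w : #|{: {x : pidx | wt x == w}}|%:R = 'C(N, w)%:R * 3 ^+ w :> RR.
Proof.
transitivity (\sum_(x : pidx | wt x == w) \prod_(k < N) (1 : RR)).
  by rewrite card_sig -sumr_const; apply: eq_bigr => x _; rewrite big1.
rewrite (weight_sum w (fun _ _ => 1 : RR)).
have e (S : {set 'I_N}) : #|S| == w ->
    \prod_k (if k \in S then \sum_(a : 'I_4 | a != 0) 1 else 1) = 3 ^+ w :> RR.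
  move=> /eqP <-; rewrite -prodr_const [RHS]big_mkcond; apply: eq_bigr => k _.
  by case: (k \in S) => //; rewrite big_mkcond sum_ord4 -!val_eqE /= !inordK //=; ring.
rewrite (eq_bigr _ e) sumr_const -[LHS]mulr_natl; congr (_%:R * _).
by rewrite -[in RHS](card_ord N) -card_draws; apply: eq_card => S; rewrite !inE.
Qed.

Lemma card_weight_le w : (#|{: {x : pidx | wt x == w}}| <= 4 ^ N)%N.
Proof.
rewrite card_sig; apply: leq_trans (max_card _) _.
by rewrite card_ffun !card_ord.
Qed.

(** The Bloch vector of a positive matrix is no longer than its trace: the difference of the squares
    is 4 det A. *)
Lemma psd_qubit (A : 'M[CC]_2) : psd A ->
  \sum_(a | a != 0) rtr (A * sigma a) ^+ 2 <= rtr A ^+ 2.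
Proof.
move=> [AH A0].
have Aij i j : A j i = (A i j)^* by rewrite -[in LHS]AH daggerE.
set p := A 0 0; set q := A 1 1; set z := A 0 1.
have zE : A 1 0 = z^* by rewrite Aij.
have pr : p^* = p by rewrite -Aij. have qr : q^* = q by rewrite -Aij.
have pE : p = rc (cRe p) by rewrite /rc /cRe RRe_real //; apply/CrealP.
have qE : q = rc (cRe q) by rewrite /rc /cRe RRe_real //; apply/CrealP.
pose Z := cRe z ^+ 2 + complex.Im z ^+ 2.
(* Test vectors (l z, -1). For p > 0 the choice l = 1/p gives |z|^2 <= p q; for p = 0 a large l
   would make the form negative unless z = 0. *)
have form (l : RR) : 0 <= l ^+ 2 * Z * cRe p - 2 * l * Z + cRe q.
  have := A0 (\col_i (if i == 0 then rc l * z else -1)).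
  rewrite !mxE sum_ord2 !mxE !sum_ord2 !mxE /= -!/p -!/q -!/z zE.
  rewrite pE qE; move: (cRe p) (cRe q) => a b; rewrite /Z /cRe /rc; case: (z) => x y.
  rewrite lecE => /andP[_] /= h; apply: le_trans h _.
  by rewrite le_eqVlt; apply/orP; left; apply/eqP; ring.
have p0 : 0 <= cRe p.
  have := A0 (\col_i (if i == 0 then 1 else 0)).
  rewrite !mxE sum_ord2 !mxE !sum_ord2 !mxE /= -!/p -!/q -!/z conjC1 conjC0.
  by rewrite !mul0r !mulr0 !addr0 mul1r mulr1 pE lecE => /andP[].
have Z0 : 0 <= Z by rewrite addr_ge0 ?sqr_ge0.
have Zpq : Z <= cRe p * cRe q.
  move: p0 form; move: (cRe p) (cRe q) => a b a0 form.
  have b0 : 0 <= b by have := form 0; rewrite expr0n /= !mul0r mulr0 mul0r subr0 add0r.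
  move: a0; rewrite le_eqVlt => /orP[/eqP a0|a0].
    have [Zz|Zp] := leP Z 0; first by rewrite -a0 mul0r.
    have := form ((b + 1) / (2 * Z)); rewrite -a0 mulr0 sub0r.
    have -> : - (2 * ((b + 1) / (2 * Z)) * Z) + b = -1 by field; rewrite gt_eqF.
    lra.
  have := form a^-1.
  have -> : a^-1 ^+ 2 * Z * a - 2 * a^-1 * Z + b = (a * b - Z) / a by field; rewrite gt_eqF.
  by rewrite pmulr_lge0 ?invr_gt0 // subr_ge0.
rewrite big_mkcond sum_ord4 -!val_eqE /= !inordK //= add0r.
rewrite /rtr /mxtrace !sum_ord2 !mxE !sum_ord2 !mxE /= !inordK //= -/p -/q -/z zE pE qE.
move: Zpq; rewrite /Z; move: (cRe p) (cRe q) => a b; rewrite /cRe /rc; case: (z) => x y /=.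
rewrite -subr_ge0 => h; rewrite -subr_ge0.
set L := (X in 0 <= X); have -> : L = 4 * (a * b - (x ^+ 2 + y ^+ 2)) by rewrite /L; ring.
by rewrite mulr_ge0.
Qed.

Lemma psd_trace_ge0 n (A : 'M[CC]_n) : psd A -> 0 <= rtr A.
Proof.
move=> [_ A0]; rewrite /rtr /mxtrace cRe_sum; apply: sumr_ge0 => i _.
have := A0 (\col_j (j == i)%:R); rewrite mxE (bigD1 i) //= big1 => [|j ji]; last first.
  by rewrite [X in _ * X]mxE (negbTE ji) mulr0.
rewrite [X in _ * X]mxE eqxx mulr1 addr0 mxE (bigD1 i) //= big1 => [|j ji]; last first.
  by rewrite daggerE mxE (negbTE ji) conjC0 mul0r.
rewrite daggerE mxE eqxx conjC1 mul1r addr0.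
by rewrite lecE => /andP[].
Qed.

Lemma tr_herm_mul n (A B : 'M[CC]_n) : dagger A = A -> dagger B = B ->
  \tr (A * B) = rc (rtr (A * B)).
Proof.
move=> AH BH; rewrite /rc /rtr /cRe RRe_real //; apply/CrealP.
have -> : (\tr (A * B))^* = \tr (dagger (A * B)).
  by rewrite /mxtrace rmorph_sum; apply: eq_bigr => i _; rewrite daggerE.
by rewrite dagger_mul AH BH [LHS]mxtrace_mulC.
Qed.

Lemma rtr_tensor_pauli (G : 'I_N -> 'M[CC]_2) x : (forall k, dagger (G k) = G k) ->
  rtr (tensor G * pauli x) = \prod_k rtr (G k * sigma (x k)).
Proof.
move=> GH; rewrite /rtr tensorM tr_tensor.
rewrite (eq_bigr (fun k => rc (rtr (G k * sigma (x k))))) => [|k _].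
  by rewrite -(rmorph_prod (real_complex RR)).
by rewrite tr_herm_mul ?sigma_herm.
Qed.

(** For each support S the sum over its strings factors; the Bloch bound applies on S and the trace
    outside. One term (Tr E)^2 remains per support instead of 3^w, and this saving is where product
    measurements are weak. *)
Lemma tensor_info_le w (G : 'I_N -> 'M[CC]_2) : (forall k, psd (G k)) ->
  \sum_(i : {x : {ffun 'I_N -> 'I_4} | wt x == w}) rtr (tensor G * pauli (val i)) ^+ 2
    <= 'C(N, w)%:R * rtr (tensor G) ^+ 2.
Proof.
move=> Gp; have GH k : dagger (G k) = G k by have [] := Gp k.
rewrite -(big_sub (fun x => wt x == w) (fun x => rtr (tensor G * pauli x) ^+ 2)) /=.
have E x : rtr (tensor G * pauli x) ^+ 2 = \prod_k rtr (G k * sigma (x k)) ^+ 2.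
  by rewrite rtr_tensor_pauli // prodrXl.
rewrite (eq_bigr _ (fun x _ => E x)).
rewrite (weight_sum w (fun k a => rtr (G k * sigma a) ^+ 2)).
have s0 : sigma 0 = 1.
  by apply/matrixP => i j; rewrite !mxE /=.
have E0 : rtr (tensor G) ^+ 2 = \prod_k rtr (G k) ^+ 2.
  rewrite prodrXl; congr (_ ^+ 2); have := @rtr_tensor_pauli G [ffun=> 0] GH.
  have -> : pauli ([ffun=> 0] : {ffun 'I_N -> 'I_4}) = 1.
    by apply: etrans (tensor1 N); apply: eq_tensor => k; rewrite ffunE s0.
  by rewrite mulr1 => ->; apply: eq_bigr => k _; rewrite ffunE s0 mulr1.
rewrite E0 [leRHS](_ : _ = \sum_(S : {set 'I_N} | #|S| == w) \prod_k rtr (G k) ^+ 2); last first.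
  rewrite sumr_const -[RHS]mulr_natl; congr (_%:R * _).
  by rewrite -[in LHS](card_ord N) -card_draws; apply: eq_card => S; rewrite !inE.
apply: ler_sum => S _; apply: ler_prod => k _.
case: (k \in S); last by rewrite s0 mulr1 sqr_ge0 lexx.
by rewrite psd_qubit // andbT sumr_ge0 // => a _; exact: sqr_ge0.
Qed.
End Weight.

Lemma natSr k : k.+1%:R = k%:R + 1 :> RR. Proof. by rewrite -addn1 natrD. Qed.

(** * Weight shells *)

Section BinomialPeak.
Local Notation b9 N w := ('C(N, w)%:R * 9 ^+ w : RR).

Lemma pascal_sum N (f : nat -> RR) :
  \sum_(w < N.+2) b9 N.+1 w * f w =
  \sum_(w < N.+1) b9 N w * f w + 9 * \sum_(w < N.+1) b9 N w * f w.+1.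
Proof.
have -> : \sum_(w < N.+1) b9 N w * f w = \sum_(w < N.+2) b9 N w * f w.
  by rewrite [RHS]big_ord_recr /= bin_small // !mul0r addr0.
rewrite !(big_ord_recl N.+1) /= !bin0 -addrA; congr (_ + _).
rewrite mulr_sumr -big_split; apply: eq_bigr => w _.
by rewrite /bump /= add1n binS natrD [9 ^+ w.+1]exprS; ring.
Qed.

Lemma sum_b9 N : \sum_(w < N.+1) b9 N w = 10 ^+ N.
Proof.
elim: N => [|N IH]; first by rewrite big_ord1 bin0 expr0 mulr1.
have := pascal_sum N (fun=> 1); under eq_bigr do rewrite mulr1.
move=> ->; under eq_bigr do rewrite mulr1.
by rewrite IH [10 ^+ N.+1]exprS; ring.
Qed.

(** The variance 9 N / 100 of the binomial law with success probability 9/10, multiplied by 100 and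
    by the total mass 10^N. *)
Lemma sum_b9_var N :
  \sum_(w < N.+1) b9 N w * (10 * w%:R - 9 * N%:R) ^+ 2 = 9 * N%:R * 10 ^+ N.
Proof.
elim: N => [|N IH]; first by rewrite big_ord1 /= !mulr0 subrr expr0n mulr0 mul0r.
rewrite (pascal_sum N (fun w => (10 * w%:R - 9 * N.+1%:R) ^+ 2)).
rewrite mulr_sumr -big_split /=.
transitivity (\sum_(w < N.+1) (10 * (b9 N w * (10 * w%:R - 9 * N%:R) ^+ 2) + 90 * b9 N w)).
  by apply: eq_bigr => w _; rewrite (natSr N) (natSr w); ring.
by rewrite big_split /= -!mulr_sumr IH sum_b9 (natSr N) [10 ^+ N.+1]exprS; ring.
Qed.

Lemma card_window N (S : {set 'I_N}) (D : nat) :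
  (forall i j, i \in S -> j \in S -> (i <= j + D)%N) -> (#|S| <= D.+1)%N.
Proof.
move=> SD; case: (set_0Vmem S) => [->|[i0 i0S]]; first by rewrite cards0.
pose w0 := [arg min_(i < i0 in S) (i : nat)].
have [w0S w0min] : w0 \in S /\ forall i, i \in S -> (w0 <= i)%N.
  by rewrite /w0; case: arg_minnP.
case: N S SD i0 i0S w0 w0S w0min => [S _ []//|N S SD i0 _ w0 w0S w0min].
have -> : D.+1 = #|'I_D.+1| by rewrite card_ord.
apply: leq_trans (leq_imset_card (fun j : 'I_D.+1 => inord (w0 + j) : 'I_N.+1) _).
apply/subset_leq_card/subsetP => i iS; apply/imsetP.
have h1 := w0min i iS; have h2 := SD i w0 iS w0S.
have e : (w0 + (inord (i - w0) : 'I_D.+1) = i)%N by rewrite inordK ?subnKC //; lia.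
by exists (inord (i - w0)); rewrite // e inord_val.
Qed.

(* Chebyshev's inequality for the binomial distribution with success probability 9/10. *)
Lemma binomial_peak N : (0 < N)%N ->
  exists w, [/\ (0 < w)%N, (w <= N)%N & 10 ^+ N <= 3 * Num.sqrt N%:R * b9 N w].
Proof.
move=> N0.
set r := Num.sqrt (N%:R : RR).
have r1 : 1 <= r by rewrite -[1]sqrtr1 ler_sqrt ?ler1n.
have rN : r ^+ 2 = N%:R by rewrite sqr_sqrtr.
(* The window is |w - 9N/10| <= (3/5) sqrt N, two standard deviations, with at least 3/4 of the
   mass. It contains at most (6/5) sqrt N + 1 <= (11/5) sqrt N weights, and 3/4 divided by 11/5
   exceeds 1/3. *)
pose S : {set 'I_N.+1} := [set w : 'I_N.+1 | (10 * w%:R - 9 * N%:R : RR) ^+ 2 <= 36 * N%:R].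
pose D := Num.truncn (6 / 5 * r).
have D1 : D%:R <= 6 / 5 * r by rewrite truncn_le; lra.
have cS : #|S|%:R <= 11 / 5 * r.
  apply: (@le_trans _ _ (D.+1%:R)); last by rewrite (natSr D); lra.
  rewrite ler_nat; apply: card_window => i j; rewrite !inE => hi hj.
  have E (x : RR) : x ^+ 2 <= 36 * N%:R -> -(6 * r) <= x <= 6 * r.
    rewrite -rN => h; rewrite -ler_norml -(@ler_pXn2r _ 2) ?nnegrE // ?mulr_ge0 //; last lra.
    by rewrite -normrX ger0_norm ?sqr_ge0 // exprMn; apply: le_trans h _; lra.
  have /andP[_ h1] := E _ hi; have /andP[h2 _] := E _ hj.
  have h3 : (i : nat)%:R - (j : nat)%:R <= 6 / 5 * r by lra.
  case: (leqP i j) => ij; first by apply: leq_trans ij (leq_addr _ _).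
  rewrite -leq_subLR; rewrite -(ler_nat RR) natrB ?(ltnW ij) //.
  have := h3; rewrite -natrB ?(ltnW ij) // => h4.
  by rewrite ler_nat /D truncn_ge_nat //; lra.
pose a (w : 'I_N.+1) : RR := b9 N w.
have a0 w : 0 <= a w by rewrite /a mulr_ge0 ?exprn_ge0.
pose w := [arg max_(i > ord0 : 'I_N.+1) a i]%O.
have wmax i : a i <= a w by rewrite /w; case: arg_maxP => // j _; apply.
have main : 3 / 4 * 10 ^+ N <= 11 / 5 * r * a w.
  apply: (@le_trans _ _ (\sum_(i in S) a w)); last first.
    by rewrite sumr_const -[leLHS]mulr_natl; apply: ler_wpM2r.
  apply: (@le_trans _ _ (\sum_(i in S) a i)); last by apply: ler_sum => i _.
  have n0 : 0 < N%:R :> RR by rewrite ltr0n.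
  have tot : \sum_i a i = 10 ^+ N := sum_b9 N.
  have var : \sum_i a i * (10 * i%:R - 9 * N%:R) ^+ 2 = 9 * N%:R * 10 ^+ N := sum_b9_var N.
  rewrite (bigID (mem S)) /= in tot.
  have : 36 * N%:R * \sum_(i | i \notin S) a i <= 9 * N%:R * 10 ^+ N.
    rewrite -var [leRHS](bigID (mem S)) /= mulr_sumr.
    apply: ler_wpDl; first by apply: sumr_ge0 => i _; rewrite mulr_ge0 ?sqr_ge0.
    apply: ler_sum => i; rewrite inE -ltNge => /ltW h.
    by rewrite mulrC; apply: ler_wpM2l.
  move: tot; move: (\sum_(i | i \notin S) a i) (\sum_(i in S) a i) (10 ^+ N) => x y z tot h.
  have {h} : N%:R * (36 * x) <= N%:R * (9 * z) by lra.
  by rewrite ler_pM2l //; lra.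
have p10 : 0 < 10 ^+ N :> RR by rewrite exprn_gt0.
have fin : 10 ^+ N <= 3 * r * a w.
  have : 0 <= r * a w by rewrite mulr_ge0 //; lra.
  lra.
exists w; split => //; last by rewrite -ltnS.
(* Weight 0 would give 10^N <= 3 sqrt N, against 10^N >= 10 N. *)
rewrite lt0n; apply/negP => /eqP w0.
have : 10 ^+ N <= 3 * r by move: fin; rewrite /a w0 bin0 expr0 !mulr1.
have rN' : r <= N%:R by rewrite -rN expr2 ler_peMr //; lra.
have : N%:R * 10 <= 10 ^+ N :> RR.
  rewrite -natrX -natrM ler_nat; case: (N) N0 => // k _.
  by rewrite expnSr leq_mul2r /= ltn_expl.
lra.
Qed.

(** As w <= N, the peak bound gives 10^N <= 3 N m 3^N, and N 9^N <= 9 * 10^N by induction; dividing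
    by N 3^N leaves m >= 3^N / 27. *)
Lemma shell_card_ge N w : (0 < N)%N -> (w <= N)%N ->
  10 ^+ N <= 3 * Num.sqrt N%:R * b9 N w -> 27^-1 * 3 ^+ N <= 'C(N, w)%:R * 3 ^+ w :> RR.
Proof.
move=> N0 wN.
set r := Num.sqrt (N%:R : RR).
have r1 : 1 <= r by rewrite -[1]sqrtr1 ler_sqrt ?ler1n.
have rN : r ^+ 2 = N%:R by rewrite sqr_sqrtr.
have rN' : r <= N%:R by rewrite -rN expr2 ler_peMr //; lra.
set m := 'C(N, w)%:R * 3 ^+ w.
have m0 : 0 <= m by rewrite mulr_ge0 ?exprn_ge0.
have -> : b9 N w = m * 3 ^+ w.
  by rewrite /m -mulrA -exprMn; congr (_ * _ ^+ _); ring.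
move=> h.
have h2 : 10 ^+ N <= 3 * N%:R * m * 3 ^+ N.
  apply: le_trans h _.
  have -> : 3 * r * (m * 3 ^+ w) = r * (3 * m * 3 ^+ w) by ring.
  have -> : 3 * N%:R * m * 3 ^+ N = N%:R * (3 * m * 3 ^+ N) by ring.
  apply: ler_pM => //; [lra|by rewrite !mulr_ge0 ?exprn_ge0|].
  by apply: ler_wpM2l; [rewrite mulr_ge0|apply: ler_weXn2l; rewrite // ler1n].
have h3 : N%:R * 9 ^+ N <= 9 * 10 ^+ N :> RR.
  elim: (N) => [|k IH]; first by rewrite mul0r expr0; lra.
  have : 9 ^+ k <= 10 ^+ k :> RR by apply: lerXn2r; rewrite ?nnegrE; lra.
  by rewrite !exprS (natSr k); lra.
have p3 : 0 < 3 ^+ N :> RR by rewrite exprn_gt0.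
have n0 : 0 < N%:R :> RR by rewrite ltr0n.
have e9 : 9 ^+ N = 3 ^+ N * 3 ^+ N :> RR by rewrite -exprMn; congr (_ ^+ _); ring.
have : (N%:R * 3 ^+ N) * 3 ^+ N <= (N%:R * 3 ^+ N) * (27 * m).
  have -> : N%:R * 3 ^+ N * 3 ^+ N = N%:R * 9 ^+ N :> RR by rewrite e9; ring.
  apply: le_trans h3 _.
  have -> : N%:R * 3 ^+ N * (27 * m) = 9 * (3 * N%:R * m * 3 ^+ N) by ring.
  by apply: ler_wpM2l.
by rewrite ler_pM2l ?mulr_gt0 //; lra.
Qed.
End BinomialPeak.

(** * Operator norm and trace norm *)

Section PsdLemmas.
Variable n : nat.
Implicit Types A B C U : 'M[CC]_n.

Lemma psd_gram m (C : 'M[CC]_(m, n)) : psd (dagger C *m C).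
Proof.
split=> [|v]; first by rewrite daggerM daggerK.
have -> : dagger v *m (dagger C *m C) *m v = dagger (C *m v) *m (C *m v).
  by rewrite daggerM !mulmxA.
by rewrite mxE; apply: sumr_ge0 => i _; rewrite daggerE mulrC mul_conjC_ge0.
Qed.
Lemma psdD A B : psd A -> psd B -> psd (A + B).
Proof.
move=> [AH A0] [BH B0]; split=> [|v]; first by rewrite daggerD AH BH.
by rewrite mulmxDr mulmxDl mxE addr_ge0.
Qed.
Lemma psdZ r A : 0 <= r -> psd A -> psd (rc r *: A).
Proof.
move=> r0 [AH A0]; split=> [|v]; first by rewrite daggerZ AH.
by rewrite -scalemxAr -scalemxAl mxE mulr_ge0 // lecR.
Qed.
Lemma psd1 : psd (1 : 'M[CC]_n).
Proof.
have -> : (1 : 'M[CC]_n) = dagger (1 : 'M[CC]_n) *m 1 by rewrite dagger1 mulmx1.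
exact: psd_gram.
Qed.
Lemma eq_dg (q r : 'I_n -> RR) : q =1 r -> dg q = dg r.
Proof. by move=> qr; apply/matrixP => i j; rewrite !dgE qr. Qed.
Lemma dg_herm r : dagger (dg r) = dg r :> 'M[CC]_n.
Proof.
apply/matrixP => i j; rewrite daggerE !dgE eq_sym; case: eqP => [->|_]; last exact: conjC0.
exact: rc_conj.
Qed.
Lemma dg_gram U r : (forall i, 0 <= r i) ->
  U * dg r * dagger U = dagger (dg (fun i => Num.sqrt (r i)) * dagger U) *
    (dg (fun i => Num.sqrt (r i)) * dagger U).
Proof.
move=> r0; rewrite dagger_mul daggerK dg_herm !mulrA; congr (_ * _).
rewrite -mulrA -expr2 dgX; congr (_ * _); apply: eq_dg => i.
by rewrite sqr_sqrtr.
Qed.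
Lemma psd_dg U r : (forall i, 0 <= r i) -> psd (U * dg r * dagger U).
Proof. by move=> r0; rewrite dg_gram //; apply: psd_gram. Qed.

Lemma psd_conj A C : psd A -> psd (dagger C * A * C).
Proof.
move=> [AH A0]; split=> [|v]; first by rewrite !dagger_mul daggerK AH mulrA.
have -> : dagger v *m (dagger C * A * C) *m v = dagger (C *m v) *m A *m (C *m v).
  by rewrite daggerM !mulmxA.
exact: A0.
Qed.
Lemma psd_diag_ge0 A i : psd A -> 0 <= cRe (A i i).
Proof.
move=> [_ A0].
have := A0 (\col_j (j == i)%:R); rewrite mxE (bigD1 i) //= big1 => [|j ji]; last first.
  by rewrite [X in _ * X]mxE (negbTE ji) mulr0.
rewrite [X in _ * X]mxE eqxx mulr1 addr0 mxE (bigD1 i) //= big1 => [|j ji]; last first.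
  by rewrite daggerE mxE (negbTE ji) conjC0 mul0r.
rewrite daggerE mxE eqxx conjC1 mul1r addr0.
by rewrite lecE => /andP[].
Qed.
Lemma psd_dgP U r : dagger U * U = 1 -> psd (U * dg r * dagger U) -> forall i, 0 <= r i.
Proof.
move=> U1 /(psd_conj U); rewrite !mulrA U1 mul1r -mulrA U1 mulr1 => /psd_diag_ge0 H i.
by have := H i; rewrite dgE eqxx.
Qed.
Lemma psd_sqrt A : psd A -> exists C, A = dagger C * C.
Proof.
move=> pA; have [AH _] := pA; have [U [r [U1 U2 AE]]] := herm_spectral AH.
rewrite AE in pA; have r0 := psd_dgP U1 pA.
by eexists; rewrite AE dg_gram.
Qed.
Lemma psd_mul_trace_ge0 A B : psd A -> psd B -> 0 <= rtr (A * B).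
Proof.
move=> /psd_sqrt[C ->] pB; rewrite -mulrA rtrC; apply: psd_trace_ge0.
by have := psd_conj (dagger C) pB; rewrite daggerK.
Qed.

(** For Hermitian A this is the operator norm bound in the Loewner order, a form in which the
    triangle inequality and the pairing with a positive matrix are immediate. *)
Definition opnorm_le b A := psd (rc b *: (1 : 'M[CC]_n) + A) /\ psd (rc b *: (1 : 'M[CC]_n) - A).

Lemma shift_dg U r b : U * dagger U = 1 ->
  rc b *: (1 : 'M[CC]_n) + U * dg r * dagger U = U * dg (fun i => b + r i) * dagger U.
Proof.
move=> U2; have -> : dg (fun i => b + r i) = rc b *: (1 : 'M[CC]_n) + dg r :> 'M[CC]_n.
  apply/matrixP => i j; rewrite dgE [RHS]mxE dgE !mxE.
  by case: eqP => _; rewrite ?mulr1 ?mulr0 ?addr0 ?rcD.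
by rewrite mulrDr mulrDl scale_mulr scale_mull mulr1 U2.
Qed.

Lemma oppr_dg U r : - (U * dg r * dagger U) = U * dg (fun i => - r i) * dagger U.
Proof.
have -> : dg (fun i => - r i) = - dg r :> 'M[CC]_n.
  by apply/matrixP => i j; rewrite [RHS]mxE !dgE; case: eqP => _; rewrite ?rcN ?oppr0.
by rewrite mulrN mulNr.
Qed.

Lemma opnormN b A : opnorm_le b A -> opnorm_le b (- A).
Proof. by move=> [h1 h2]; split; [exact: h2|rewrite opprK; exact: h1]. Qed.

Lemma opnormD a b A B : opnorm_le a A -> opnorm_le b B -> opnorm_le (a + b) (A + B).
Proof.
move=> [h1 h2] [h3 h4]; rewrite /opnorm_le rcD scalerDl opprD.
by split; rewrite [X in psd X]addrACA; [apply: (psdD h1 h3)|apply: (psdD h2 h4)].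
Qed.

Lemma moment_opnorm b A q : dagger A = A -> 0 <= b -> (0 < q)%N ->
  rtr (A ^+ q.*2) <= b ^+ q.*2 -> opnorm_le b A.
Proof.
move=> /herm_spectral [U [r [U1 U2 ->]]] b0 q0.
rewrite conjU_X // dgX rtr_conjU // rtr_dg => h.
have rb i : `|r i| <= b.
  have e k : 0 <= r k ^+ q.*2 by apply: exprn_even_ge0; rewrite odd_double.
  rewrite -(@ler_pXn2r _ q.*2) ?nnegrE ?double_gt0 // -normrX ger0_norm //.
  apply: le_trans h; rewrite (bigD1 i) //= lerDl; exact: sumr_ge0.
split; rewrite ?oppr_dg (shift_dg _ _ U2); apply: psd_dg => i; have := rb i; rewrite ler_norml; lra.
Qed.

Lemma opnorm_rtr_le b A B : opnorm_le b A -> psd B -> `|rtr (B * A)| <= b * rtr B.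
Proof.
move=> [h1 h2] pB; have := psd_mul_trace_ge0 pB h1; have := psd_mul_trace_ge0 pB h2.
rewrite !mulrDr mulrN scale_mulr mulr1 !rtrD rtrN rtrZ ler_norml; lra.
Qed.

Lemma opnorm_sq_psd b A : dagger A = A -> opnorm_le b A -> psd (rc (b ^+ 2) *: (1 : 'M[CC]_n) - A * A).
Proof.
move=> /herm_spectral [U [r [U1 U2 ->]]] [h1 h2].
rewrite (shift_dg _ _ U2) in h1; have {}h1 := psd_dgP U1 h1.
rewrite oppr_dg (shift_dg _ _ U2) in h2; have {}h2 := psd_dgP U1 h2.
rewrite -expr2 (conjU_X _ _ U1 U2) dgX oppr_dg (shift_dg _ _ U2); apply: psd_dg => i.
have -> : b ^+ 2 - r i ^+ 2 = (b - r i) * (b + r i) by ring.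
exact: mulr_ge0 (h2 i) (h1 i).
Qed.

Lemma char_poly_unitary U r : dagger U * U = 1 -> U * dagger U = 1 ->
  char_poly (U * dg r * dagger U) = \prod_(z <- [seq rc (r i) | i <- enum 'I_n]) ('X - z%:P).
Proof.
move=> U1 U2.
have -> : \prod_(z <- [seq rc (r i) | i <- enum 'I_n]) ('X - z%:P) = char_poly (dg r).
  rewrite char_poly_trig; last first.
    by apply/is_trig_mxP => i j ij; rewrite dgE; case: eqP ij => // ->; rewrite ltnn.
  by rewrite big_map enumT; apply: eq_bigr => i _; rewrite dgE eqxx.
rewrite /char_poly /char_poly_mx.
pose V := map_mx (@polyC CC) U; pose V' := map_mx (@polyC CC) (dagger U).
have VV : V *m V' = 1%:M by rewrite -map_mxM /= mulmxE U2 map_mx1.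
have -> : 'X%:M - map_mx (@polyC CC) (U * dg r * dagger U) =
    V *m ('X%:M - map_mx (@polyC CC) (dg r)) *m V'.
  rewrite mulmxBr mulmxBl !map_mxM; congr (_ - _).
  by rewrite scalar_mxC -mulmxA VV mulmx1.
by rewrite !det_mulmx mulrAC -det_mulmx VV det1 mul1r.
Qed.

Lemma eigvals_unitary U r : dagger U * U = 1 -> U * dagger U = 1 ->
  perm_eq (eigvals (U * dg r * dagger U)) [seq rc (r i) | i <- enum 'I_n].
Proof.
move=> U1 U2; apply: prod_XsubC_eq; rewrite -(char_poly_unitary r U1 U2) /eigvals.
case: (closed_field_poly_normal _) => rs /= E.
by rewrite [RHS]E (monicP (char_poly_monic _)) scale1r.
Qed.

Lemma trnorm_eq A U r : dagger U * U = 1 -> U * dagger U = 1 -> (forall i, 0 <= r i) ->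
  dagger A *m A = U * dg r * dagger U -> trnorm A = \sum_i Num.sqrt (r i).
Proof.
move=> U1 U2 r0 E; rewrite /trnorm E (perm_big _ (eigvals_unitary _ U1 U2)) /= big_map.
rewrite -/(cRe _) cRe_sum enumT; apply: eq_bigr => i _.
rewrite -{1}[r i]sqr_sqrtr // rcX sqrCK //.
by rewrite lecR sqrtr_ge0.
Qed.

(* Cauchy-Schwarz in the form [x <= (t p + q / t) / 2] for all t, optimised over t. *)
Lemma le_sqrt_of_amgm (x p q : RR) : 0 < p -> 0 <= q ->
  (forall t, 0 < t -> x <= (t * p ^+ 2 + q / t) / 2) -> x <= p * Num.sqrt q.
Proof.
move=> p0; rewrite le_eqVlt => /orP[/eqP <- H|q0 H].
  rewrite sqrtr0 mulr0 leNgt; apply/negP => x0.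
  have p2 : 0 < p ^+ 2 by rewrite exprn_gt0.
  have t0 : 0 < x / p ^+ 2 by rewrite divr_gt0.
  by have := H _ t0; rewrite divfK ?gt_eqF // mul0r; lra.
have s0 : 0 < Num.sqrt q by rewrite sqrtr_gt0.
have t0 : 0 < Num.sqrt q / p by rewrite divr_gt0.
have := H _ t0; have := sqr_sqrtr (ltW q0); move: (Num.sqrt q) s0 => y y0 <-.
have -> : (y / p * p ^+ 2 + y ^+ 2 / (y / p)) / 2 = p * y by field; rewrite !gt_eqF.
by [].
Qed.

(** In an eigenbasis U of A^dagger A with eigenvalues r_i, column i of A U has squared norm r_i, and
    row i of U^dagger B has squared norm at most b^2. Cauchy-Schwarz bounds each diagonal entry of
    the product by b sqrt r_i. *)
Lemma trnorm_dual b A B : 0 < b -> dagger B = B -> opnorm_le b B ->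
  `|rtr (B * A)| <= b * trnorm A.
Proof.
move=> b0 BH HB.
suff H C : dagger C = C -> opnorm_le b C -> rtr (C * A) <= b * trnorm A.
  rewrite ler_norml; apply/andP; split; last exact: H.
  rewrite lerNl -rtrN -mulNr; apply: H; last exact: opnormN.
  by rewrite daggerN BH.
move=> {BH HB B} CH HC.
have pA := psd_gram A; have [AH _] := pA.
have [U [r [U1 U2 AE]]] := herm_spectral AH.
have r0 : forall i, 0 <= r i by apply: (psd_dgP U1); rewrite -AE.
rewrite (trnorm_eq U1 U2 r0 AE) mulr_sumr.
pose P := dagger U * C; pose Q := A * U.
have -> : rtr (C * A) = rtr (P * Q).
  by rewrite /P /Q -mulrA [RHS]rtrC -!mulrA U2 mulr1.
rewrite /rtr /mxtrace cRe_sum; apply: ler_sum => i _; apply: le_sqrt_of_amgm => // t t0.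
have PP : \sum_k n2 (P i k) <= b ^+ 2.
  have := psd_diag_ge0 i (psd_conj U (opnorm_sq_psd CH HC)).
  rewrite mulrBr mulrBl scale_mulr scale_mull mulr1 U1.
  have -> : dagger U * (C * C) * U = P * dagger P by rewrite /P dagger_mul daggerK CH !mulrA.
  rewrite mxE [X in X + _]mxE [X in rc _ * X]mxE eqxx mulr1n mulr1 [X in _ + X]mxE.
  rewrite cReD cReN cRe_rc subr_ge0 mxE cRe_sum.
  by congr (_ <= _); apply: eq_bigr => k _; rewrite daggerE.
have QQ : \sum_k n2 (Q k i) = r i.
  have : (dagger Q * Q) i i = rc (r i).
    rewrite /Q dagger_mul mulrA -(mulrA (dagger U)) -[dagger A * A]/(dagger A *m A) AE.
    by rewrite !mulrA U1 mul1r -mulrA U1 mulr1 dgE eqxx.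
  move=> /(congr1 cRe); rewrite cRe_rc => <-; rewrite mxE cRe_sum.
  by apply: eq_bigr => k _; rewrite daggerE mulrC.
apply: (@le_trans _ _ ((t * \sum_k n2 (P i k) + (\sum_k n2 (Q k i)) / t) / 2)); last first.
  by rewrite QQ; have := ler_wpM2l (ltW t0) PP; lra.
rewrite mxE cRe_sum mulr_sumr mulr_suml -big_split mulr_suml; apply: ler_sum => k _ /=.
case: (P i k) (Q k i) => x y [z w]; rewrite /n2 /=.
rewrite !mulrN !opprK -subr_ge0.
set L := (X in 0 <= X).
have -> : L = ((t * x - z) ^+ 2 + (t * y + w) ^+ 2) / (2 * t) by rewrite /L; field; rewrite gt_eqF.
by rewrite divr_ge0 ?addr_ge0 ?sqr_ge0 // mulr_ge0 // ltW.
Qed.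
End PsdLemmas.

Lemma psd_tensor N (G : 'I_N -> 'M[CC]_2) : (forall k, psd (G k)) -> psd (tensor G).
Proof.
move=> Gp; have /fin_all_exists [C CE] k := psd_sqrt (Gp k).
have -> : tensor G = dagger (tensor C) *m tensor C.
  by rewrite dagger_tensor [RHS]tensorM; apply: eq_tensor => k; rewrite CE.
exact: psd_gram.
Qed.

(** * Likelihoods *)

Section Exponential.
Definition ex (x : RR) : RR := Rtrigo_def.exp x.
Lemma exD x y : ex (x + y) = ex x * ex y. Proof. exact: Exp_prop.exp_plus. Qed.
Lemma ex_ge1D x : 1 + x <= ex x. Proof. by apply/RleP; exact: Rpower.exp_ineq1_le. Qed.
Lemma ex0 : ex 0 = 1. Proof. exact: Rtrigo_def.exp_0. Qed.
Lemma ex_gt0 x : 0 < ex x.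
Proof.
have : ex (x / 2) * ex (x / 2) = ex x by rewrite -exD -splitr.
rewrite -expr2 => <-; rewrite lt0r sqr_ge0 andbT expf_neq0 //.
apply/eqP => e; have := exD (x / 2) (- (x / 2)).
by rewrite subrr ex0 e mul0r => /eqP; rewrite oner_eq0.
Qed.
Lemma exN x : ex (- x) = (ex x)^-1.
Proof.
apply: (mulIf (lt0r_neq0 (ex_gt0 x))).
by rewrite -exD addNr ex0 mulVf // gt_eqF ?ex_gt0.
Qed.
Lemma ex_sum (J : Type) (l : seq J) (Q : pred J) (f : J -> RR) :
  ex (\sum_(i <- l | Q i) f i) = \prod_(i <- l | Q i) ex (f i).
Proof. exact: (big_morph ex exD ex0). Qed.
Lemma ex_le_1B x : 0 <= x <= 2^-1 -> ex (- (2 * x)) <= 1 - x.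
Proof.
move=> /andP[x0 x1]; rewrite exN invf_ple ?posrE ?ex_gt0 //; last lra.
apply: le_trans (ex_ge1D (2 * x)); rewrite -[(1 - x)^-1]mul1r ler_pdivrMr; last lra.
by rewrite -subr_ge0 (_ : (_ - _) = x * (1 - 2 * x)); [apply: mulr_ge0; lra|ring].
Qed.
End Exponential.

(** * Outcome records of adaptive protocols *)

Section AdaptiveSum.
Variable O : finType.

Definition pre n (h : {ffun 'I_n -> O}) (t : 'I_n) : {ffun 'I_t -> O} :=
  [ffun i : 'I_t => h (widen_ord (ltnW (ltn_ord t)) i)].

Definition ext n (p : {ffun 'I_n -> O} * O) : {ffun 'I_n.+1 -> O} :=
  [ffun i => oapp p.1 p.2 (unlift ord_max i)].

Lemma ext_bij n : bijective (@ext n).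
Proof.
exists (fun h : {ffun 'I_n.+1 -> O} => ([ffun j => h (lift ord_max j)], h ord_max)).
  move=> [h o]; congr (_, _); last by rewrite ffunE unlift_none.
  by apply/ffunP => j; rewrite !ffunE liftK.
by move=> h; apply/ffunP => i; rewrite ffunE; case: unliftP => [j ->|->]; rewrite /= ?ffunE.
Qed.

Lemma widen_lift n (t : 'I_n) : widen_ord (leqnSn n) t = lift ord_max t.
Proof. by apply: val_inj; rewrite /= /bump leqNgt ltn_ord. Qed.

(** The last outcome is summed first: given the earlier record its conditional weights add up to 1,
    and what remains is the same sum for one copy fewer. *)
Lemma sum_adaptive (R : comPzRingType) n (g : forall t : 'I_n, {ffun 'I_t -> O} -> O -> R) :
  (forall t p, \sum_o g t p o = 1) ->
  \sum_(h : {ffun 'I_n -> O}) \prod_t g t (pre h t) (h t) = 1.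
Proof.
elim: n g => [|n IH] g g1.
  rewrite (eq_bigr (fun=> 1)) => [|h _]; last by rewrite big_ord0.
  by rewrite sumr_const card_ffun card_ord expn0.
rewrite (reindex (@ext n)) /=; last exact: onW_bij (ext_bij n).
pose g' (t : 'I_n) (p : {ffun 'I_t -> O}) (o : O) : R := g (widen_ord (leqnSn n) t) p o.
have E p : \prod_t g t (pre (ext p) t) (ext p t) =
   (\prod_t g' t (pre p.1 t) (p.1 t)) * g ord_max p.1 p.2.
  rewrite big_ord_recr; congr (_ * _).
    apply: eq_bigr => t _; rewrite /g'; congr (g _ _ _).
      apply/ffunP => i; rewrite !ffunE.
      have -> : widen_ord (ltnW (ltn_ord (widen_ord (leqnSn n) t))) i =
         lift ord_max (widen_ord (ltnW (ltn_ord t)) i).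
        by rewrite -widen_lift; apply: val_inj.
      by rewrite liftK.
    by rewrite ffunE widen_lift liftK.
  congr (g _ _ _); last by rewrite ffunE unlift_none.
  apply/ffunP => i; rewrite !ffunE.
  have -> : widen_ord (ltnW (ltn_ord (@ord_max n))) i = lift ord_max i.
    by rewrite -widen_lift; apply: val_inj.
  by rewrite liftK.
rewrite (eq_bigr _ (fun p _ => E p)).
rewrite -(pair_big predT predT (fun (h : {ffun 'I_n -> O}) o =>
  (\prod_t g' t (pre h t) (h t)) * g ord_max h o)) /=.
rewrite -[RHS](IH g') => [|t p]; last exact: g1.
by apply: eq_bigr => h _; rewrite -mulr_sumr g1 mulr1.
Qed.
End AdaptiveSum.

Section Likelihood.
Variables (T : finType) (G : pred T) (oppT : T -> T) (n : nat).
Variables (r : 'I_n -> RR) (D : 'I_n -> T -> RR) (beta : RR).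
Hypothesis neg_signsK : involutive oppT.
Hypothesis G_opp : forall v, G (oppT v) = G v.
Hypothesis D_opp : forall t v, D t (oppT v) = - D t v.
Hypothesis r0 : forall t, 0 <= r t.
Hypothesis D_le : forall t v, G v -> `|D t v| <= r t / 3.
Hypothesis D_var : forall t, \sum_(v | G v) (D t v / r t) ^+ 2 <= beta * #|G|%:R.

(* Pairing v with -v removes the first-order term of the log-likelihood, and Jensen's
   inequality for exp leaves only the second-order one. *)
Lemma likelihood_average :
  #|G|%:R * ex (- (n%:R * beta)) * \prod_t r t <= \sum_(v | G v) \prod_t (r t + D t v).
Proof.
pose d t v := D t v / r t.
(* If [r t] is 0 then [D_le] forces [D t v] to be 0, so the convention x / 0 = 0 is consistent. *)
have dE t v : G v -> D t v = r t * d t v.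
  move=> Gv; rewrite /d; have [rt|rt] := eqVneq (r t) 0; last by rewrite mulrC divfK.
  by have := D_le t Gv; rewrite rt mul0r normr_le0 => /eqP ->; rewrite mul0r.
have d3 t v : G v -> `|d t v| <= 3^-1.
  move=> Gv; rewrite /d normrM normfV (ger0_norm (r0 t)).
  have [->|rt] := eqVneq (r t) 0; first by rewrite invr0 mulr0; lra.
  have rp : 0 < r t by rewrite lt0r rt r0.
  by rewrite ler_pdivrMr //; have := D_le t Gv; lra.
have R0 : 0 <= \prod_t r t by apply: prodr_ge0.
have -> : \sum_(v | G v) \prod_t (r t + D t v) =
    \prod_t r t * \sum_(v | G v) \prod_t (1 + d t v).
  rewrite mulr_sumr; apply: eq_bigr => v Gv; rewrite -big_split; apply: eq_bigr => t _ /=.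
  by rewrite dE // mulrDr mulr1.
rewrite mulrC; apply: ler_wpM2l => //.
pose S v := \sum_t d t v ^+ 2.
have pair v : G v -> ex (- S v) <= (\prod_t (1 + d t v) + \prod_t (1 - d t v)) / 2.
  move=> Gv.
  have pos b t : `|b| = 1 -> 0 <= 1 + b * d t v.
    move=> b1; have : `|b * d t v| <= 3^-1 by rewrite normrM b1 mul1r; exact: d3.
    by rewrite ler_norml; lra.
  have a0 : 0 <= \prod_t (1 + d t v).
    by apply: prodr_ge0 => t _; have := pos 1 t (normr1 _); rewrite mul1r.
  have b0 : 0 <= \prod_t (1 - d t v).
    by apply: prodr_ge0 => t _; have := pos (-1) t (normrN1 _); rewrite mulN1r.
  (* The arithmetic mean of the two products dominates their geometric mean, and (1 + d)(1 - d) = 1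
     - d^2 >= exp(-2 d^2) for |d| <= 1/3. *)
  have ab : ex (- S v) ^+ 2 <= \prod_t (1 + d t v) * \prod_t (1 - d t v).
    rewrite -big_split expr2 -exD -opprD -mulr2n -mulr_natl /S mulr_sumr -sumrN ex_sum.
    apply: ler_prod => t _; rewrite ltW ?ex_gt0 //=.
    have -> : (1 + d t v) * (1 - d t v) = 1 - d t v ^+ 2 by ring.
    apply: ex_le_1B; rewrite sqr_ge0 /=.
    have := d3 t v Gv; have := normr_ge0 (d t v); rewrite -[d t v ^+ 2]ger0_norm ?sqr_ge0 // normrX.
    move: (`|d t v|) => x x0 x3; rewrite expr2; nra.
  move: (\prod_t (1 + d t v)) (\prod_t (1 - d t v)) a0 b0 ab => a b a0 b0 ab.
  have e0 := ltW (ex_gt0 (- S v)).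
  have h0 : 0 <= (a + b) / 2 by rewrite divr_ge0 ?addr_ge0.
  rewrite -(@ler_pXn2r _ 2) ?nnegrE //.
  apply: le_trans ab _; rewrite -subr_ge0.
  have -> : ((a + b) / 2) ^+ 2 - a * b = ((a - b) / 2) ^+ 2 by field.
  exact: sqr_ge0.
have sym : \sum_(v | G v) \prod_t (1 + d t v) =
    \sum_(v | G v) (\prod_t (1 + d t v) + \prod_t (1 - d t v)) / 2.
  have e : \sum_(v | G v) \prod_t (1 - d t v) = \sum_(v | G v) \prod_t (1 + d t v).
    rewrite [RHS](reindex_inj (inv_inj neg_signsK)) /=; apply: eq_big => v; first by rewrite G_opp.
    by move=> _; apply: eq_bigr => t _; rewrite /d D_opp mulNr.
  by rewrite -mulr_suml big_split /= e; field.
rewrite sym.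
(* Jensen's inequality through the tangent line of exp at - n beta; by [D_var] the linear terms have
   a nonnegative sum over [G]. *)
apply: (@le_trans _ _ (\sum_(v | G v) ex (- (n%:R * beta)) * (1 + (n%:R * beta - S v)))); last first.
  apply: ler_sum => v Gv; apply: le_trans (pair v Gv).
  have -> : ex (- S v) = ex (- (n%:R * beta)) * ex (n%:R * beta - S v).
    by rewrite -exD; congr ex; ring.
  by apply: ler_wpM2l; [exact: ltW (ex_gt0 _)|exact: ex_ge1D].
rewrite -mulr_sumr mulrC; apply: ler_wpM2l; first exact: ltW (ex_gt0 _).
have Sle : \sum_(v | G v) S v <= n%:R * beta * #|G|%:R.
  rewrite exchange_big /=; apply: (@le_trans _ _ (\sum_(t < n) beta * #|G|%:R)).
    by apply: ler_sum => t _; exact: D_var.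
  by rewrite sumr_const card_ord -[leLHS]mulr_natl mulrA.
have -> : \sum_(v | G v) (1 + (n%:R * beta - S v)) =
   #|G|%:R + (n%:R * beta * #|G|%:R - \sum_(v | G v) S v).
  rewrite big_split sumrB /= !sumr_const; congr (_ + (_ - _)).
  by rewrite -[LHS]mulr_natr.
by rewrite lerDl subr_ge0.
Qed.
End Likelihood.

Section Records.
Variables (N K n : nat) (P : protocol N K n).
Hypothesis Pv : valid_protocol P.

Definition effect (h : {ffun 'I_n -> outcome N K}) (t : 'I_n) : 'M[CC]_(2 ^ N) :=
  tensor (fun k => @meas N K n P t (Defs.prefix h t) k (h t k)).

Lemma record_probE rho h : record_prob P rho h = \prod_t rtr (effect h t * rho).
Proof. by []. Qed.

Lemma effect_psd h t : psd (effect h t).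
Proof. by apply: psd_tensor => k; have [] := @Pv t (Defs.prefix h t) k. Qed.

Lemma sum_record_prob rho : \tr rho = 1 -> \sum_h record_prob P rho h = 1.
Proof.
move=> tr1.
apply: (@sum_adaptive (outcome N K) RR n (fun t p o =>
  rtr (tensor (fun k => @meas N K n P t p k (o k)) * rho))) => t p.
rewrite -rtr_sum -mulr_suml.
have -> : \sum_(o : outcome N K) tensor (fun k => @meas N K n P t p k (o k)) = 1.
  rewrite -tensor1; apply/matrixP => i j; rewrite summxE [RHS]mxE.
  under eq_bigr do rewrite mxE.
  rewrite -(bigA_distr_bigA (fun k o => @meas N K n P t p k o (bitk i k) (bitk j k))).
  by apply: eq_bigr => k _; have [_ e] := @Pv t p k; rewrite -summxE e.
by rewrite mul1r /rtr tr1.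
Qed.
End Records.

Lemma ex_lt x y : x < y -> ex x < ex y.
Proof.
move=> xy; have -> : y = x + (y - x) by rewrite addrC subrK.
rewrite exD ltr_pMr ?ex_gt0 //; have := ex_ge1D (y - x); lra.
Qed.

Lemma ex_natmul k x : ex (k%:R * x) = ex x ^+ k.
Proof.
elim: k => [|k IH]; first by rewrite mul0r ex0.
by rewrite natSr mulrDl mul1r exD IH exprSr.
Qed.

(** * Counting *)

Section SignCombinatorics.
Variable I : finType.
Local Notation signs := {ffun I -> bool}.
Implicit Types u v : signs.

Lemma avg_sg_sg i j : avg (fun v => sg v i * sg v j) = (i == j)%:R.
Proof.
case: eqP => [<-|/eqP ij].
  by rewrite (avg_eq (g := fun=> 1)) ?avg_const // => v; rewrite sg_sq.
rewrite avg_sg (avg_eq (g := fun=> 0)) ?avg_const ?mul0r // => v.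
by rewrite sg_flip_neq 1?eq_sym // subrr mulr0.
Qed.

Lemma sum_sq_signs (b : I -> RR) :
  \sum_v (\sum_i sg v i * b i) ^+ 2 = 2 ^+ #|I| * \sum_i b i ^+ 2.
Proof.
have p2 : 2 ^+ #|I| != 0 :> RR by rewrite expf_neq0 // pnatr_eq0.
apply: (mulIf (invr_neq0 p2)); rewrite [RHS]mulrAC divff // mul1r.
rewrite -/(avg (fun v => (\sum_i sg v i * b i) ^+ 2)).
rewrite (avg_eq (g := fun v => \sum_i \sum_j b i * b j * (sg v i * sg v j))) => [|v].
  rewrite avg_sum; apply: eq_bigr => i _; rewrite avg_sum (bigD1 i) //= big1 => [|j ji].
    by rewrite avgZ avg_sg_sg eqxx mulr1 addr0.
  by rewrite avgZ avg_sg_sg eq_sym (negbTE ji) mulr0.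
rewrite expr2 mulr_suml; apply: eq_bigr => i _; rewrite mulr_sumr; apply: eq_bigr => j _.
by ring.
Qed.

Definition ham u v : nat := #|[set i | u i != v i]|.

(* Markov's inequality with a factor 1/15 per disagreement, since 15 <= (17/16)^50. *)
Lemma hamming_ball_le v : #|[pred u | (50 * ham u v <= #|I|)%N]|%:R <= (17 / 15) ^+ #|I| :> RR.
Proof.
pose f u : RR := (17 / 16) ^+ #|I| * \prod_i (if u i == v i then 1 else 15^-1).
have f0 u : 0 <= f u.
  rewrite /f mulr_ge0 ?exprn_ge0 //; first lra.
  by apply: prodr_ge0 => i _; case: ifP => _; lra.
apply: (@le_trans _ _ (\sum_u f u)); last first.
  rewrite -mulr_sumr.
  rewrite -(bigA_distr_bigA (fun i (b : bool) => if b == v i then 1 else 15^-1 : RR)).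
  have e i : \sum_(b : bool) (if b == v i then 1 else 15^-1) = 16 / 15 :> RR.
    by rewrite big_bool; case: (v i) => /=; lra.
  rewrite (eq_bigr _ (fun i _ => e i)) prodr_const -exprMn.
  by rewrite (_ : 17 / 16 * (16 / 15) = 17 / 15 :> RR) //; field.
rewrite -sum1_card natr_sum big_mkcond /=; apply: ler_sum => u _.
case: ifP => [|_]; last exact: f0.
rewrite inE => hu.
have -> : f u = (17 / 16) ^+ #|I| * 15^-1 ^+ ham u v.
  congr (_ * _); rewrite -prodr_const [RHS]big_mkcond; apply: eq_bigr => i _.
  by rewrite inE; case: eqP.
rewrite exprVn ler_pdivlMr ?exprn_gt0 // mul1r.
apply: (@le_trans _ _ ((17 / 16) ^+ (50 * ham u v))).
  by rewrite exprM; apply: lerXn2r; rewrite ?nnegrE ?exprn_ge0 //; lra.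
by apply: ler_weXn2l => //; lra.
Qed.

(* The two sign matrices of u and v have a sum which depends only on [code u v]. *)
Definition code u v : {ffun I -> 'I_3} := [ffun i => inord (u i + v i)].
Lemma code_inj u v v' : code u v = code u v' -> v = v'.
Proof.
move=> /ffunP H; apply/ffunP => i; have := H i; rewrite !ffunE => /(congr1 val).
by rewrite /= !inordK; case: (u i); case: (v i); case: (v' i).
Qed.
End SignCombinatorics.

Section Counting.
Variables (I H : finType) (G : pred {ffun I -> bool}) (ok : {ffun I -> bool} -> pred H).
Variables (L0 : {ffun I -> bool} -> H -> RR) (L : {ffun I -> 'I_3} -> H -> RR) (q : RR).
Hypothesis q0 : 0 <= q.
Hypothesis L_ge0 : forall u v h, G u -> G v -> 0 <= L (code u v) h.
Hypothesis L_sum : forall u v, G u -> G v -> \sum_h L (code u v) h = 1.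
Hypothesis ok_ham : forall u v h, G u -> G v -> ok u h -> ok v h -> (50 * ham u v <= #|I|)%N.
Hypothesis L0_ok : forall u, G u -> 9 / 10 <= \sum_(h | ok u h) L0 u h.
Hypothesis L0_le : forall u h, G u -> #|G|%:R * q * L0 u h <= \sum_(v | G v) L (code u v) h.

(* A code determines v from u, so for each record the number of pairs with a given code is at
   most the number of u compatible with that record. *)
Lemma counting_bound : 9 / 10 * #|G|%:R ^+ 2 * q <= 3 ^+ #|I| * (17 / 15) ^+ #|I|.
Proof.
pose b : RR := (17 / 15) ^+ #|I|.
have b0 : 0 <= b by apply: exprn_ge0; lra.
pose S : RR := \sum_(p | G p.1 && G p.2) \sum_(h | ok p.1 h) L (code p.1 p.2) h.
have lower : 9 / 10 * #|G|%:R ^+ 2 * q <= S.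
  rewrite /S -(pair_big G G (fun u v => \sum_(h | ok u h) L (code u v) h)) /=.
  have -> : 9 / 10 * #|G|%:R ^+ 2 * q = \sum_(u | G u) #|G|%:R * q * (9 / 10) :> RR.
    by rewrite sumr_const -[RHS]mulr_natl; ring.
  apply: ler_sum => u Gu; rewrite exchange_big /=.
  apply: (@le_trans _ _ (\sum_(h | ok u h) #|G|%:R * q * L0 u h)).
    rewrite -mulr_sumr; apply: ler_wpM2l; last exact: L0_ok.
    exact: mulr_ge0.
  by apply: ler_sum => h _; exact: L0_le.
apply: le_trans lower _; rewrite /S.
rewrite (partition_big (fun p => code p.1 p.2) predT) //=.
have -> : 3 ^+ #|I| * (17 / 15) ^+ #|I| = \sum_(y : {ffun I -> 'I_3}) b.
  by rewrite sumr_const card_ffun card_ord -[RHS]mulr_natl natrX.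
apply: ler_sum => y _.
(* A code of no good pair contributes an empty sum; for every other code [L y] is a probability
   distribution on the records. *)
have [/existsP[[u0 v0]] /andP[/andP[/= Gu0 Gv0] /eqP cy]|none] :=
  boolP [exists p : {ffun I -> bool} * {ffun I -> bool}, G p.1 && G p.2 && (code p.1 p.2 == y)]; last first.
  rewrite big1 // => p pP; case/existsP: none; by exists p.
have Ly0 h : 0 <= L y h by rewrite -cy; exact: L_ge0.
rewrite (exchange_big_dep predT) //= -[b]mulr1 -(L_sum Gu0 Gv0) cy mulr_sumr.
apply: ler_sum => h _.
rewrite (eq_bigr (fun=> L y h)) => [|p /andP[/andP[_ /eqP ->]]] //.
pose A := [pred p : {ffun I -> bool} * {ffun I -> bool} |
  G p.1 && G p.2 && (code p.1 p.2 == y) && ok p.1 h].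
rewrite (eq_bigl (mem A)) => [|p]; last by rewrite inE.
rewrite sumr_const -[leLHS]mulr_natl; apply: ler_wpM2r => //.
have injA : {in A &, injective (fun p : {ffun I -> bool} * {ffun I -> bool} => p.1)}.
  move=> [u v] [u' v']; rewrite !inE /= => /andP[/andP[_ /eqP e] _] /andP[/andP[_ /eqP e'] _] uu.
  by move: e'; rewrite -uu -e => /code_inj ->.
have [u1|A0] := pickP (mem A); last first.
  by rewrite (eq_card0 A0).
case: u1 => u1 v1; rewrite inE /= => /andP[/andP[/andP[Gu1 _] _] ok1].
apply: le_trans (hamming_ball_le u1).
rewrite ler_nat -(card_in_imset injA) -[leqRHS]cardsE; apply: subset_leq_card.
apply/subsetP => u /imsetP[[u2 v2]]; rewrite !inE /= => /andP[/andP[/andP[Gu2 _] _] ok2] ->.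
exact: ok_ham ok2 ok1.
Qed.
End Counting.

(** Here 3 * 17/15 = 17/5, and exp(1/21) <= 21/20 leaves (17/5)(21/20) < 4 for the growth rate. The
    prefactor (9/10)^3 = 729/1000 is compensated by three of the m factors, hence the condition m >=
    3. *)
Lemma exponent_bound (m : nat) (g x : RR) : (3 <= m)%N -> 0 <= g ->
  9 / 10 * 2 ^+ m <= g -> 9 / 10 * g ^+ 2 * ex (- x) <= 3 ^+ m * (17 / 15) ^+ m ->
  m%:R / 21 <= x.
Proof.
move=> m3 g0 gm H; rewrite leNgt; apply/negP => xm.
have e1 : ex (21^-1) <= 21 / 20.
  rewrite -[21^-1]opprK exN invf_ple ?posrE ?ex_gt0 //; last lra.
  by apply: le_trans (ex_ge1D _); lra.
have em : ex x < (21 / 20) ^+ m.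
  apply: lt_le_trans (ex_lt xm) _; rewrite ex_natmul; apply: lerXn2r => //; rewrite nnegrE ?ltW ?ex_gt0 //.
  lra.
have m21 : (21 / 20) ^+ m <= 729 / 1000 * (20 / 17) ^+ m :> RR.
  rewrite -(subnK m3) !exprD mulrCA.
  have : (21 / 20) ^+ (m - 3) <= (20 / 17) ^+ (m - 3) :> RR.
    by apply: lerXn2r; rewrite ?nnegrE; lra.
  have : 0 <= (21 / 20) ^+ (m - 3) :> RR by apply: exprn_ge0; lra.
  move: (_ ^+ (m - 3)) (_ ^+ (m - 3)) => y z y0 yz.
  by rewrite !exprS expr0; lra.
suff L : 3 ^+ m * (17 / 15) ^+ m < 9 / 10 * g ^+ 2 * ex (- x) by rewrite ltNge H in L.
move: H => _.
have e0 := ex_gt0 x.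
have -> : 3 ^+ m * (17 / 15) ^+ m = (17 / 5) ^+ m :> RR.
  by rewrite -exprMn; congr (_ ^+ _); field.
have lo : 9 / 10 * (9 / 10 * 2 ^+ m) ^+ 2 * ex (- x) <= 9 / 10 * g ^+ 2 * ex (- x).
  apply: ler_wpM2r; first by rewrite ltW ?ex_gt0.
  apply: ler_wpM2l; first lra.
  by apply: lerXn2r; rewrite ?nnegrE // mulr_ge0 ?exprn_ge0 //; lra.
apply: lt_le_trans lo.
rewrite exN ltr_pdivlMr //.
apply: (@lt_le_trans _ _ ((17 / 5) ^+ m * (21 / 20) ^+ m)).
  have p0 : 0 < (17 / 5) ^+ m :> RR by apply: exprn_gt0; lra.
  by rewrite (ltr_pM2l p0).
apply: (@le_trans _ _ ((17 / 5) ^+ m * (729 / 1000 * (20 / 17) ^+ m))).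
  by apply: ler_wpM2l m21; apply: exprn_ge0; lra.
have -> : (9 / 10 * 2 ^+ m) ^+ 2 = 81 / 100 * 4 ^+ m :> RR.
  rewrite exprMn -exprM mulnC exprM; congr (_ * _ ^+ _); by field.
have -> : (17 / 5) ^+ m * (729 / 1000 * (20 / 17) ^+ m) = 729 / 1000 * 4 ^+ m :> RR.
  rewrite mulrCA -exprMn; congr (_ * _ ^+ _); by field.
by rewrite mulrA; apply: ler_wpM2r; [exact: exprn_ge0|lra].
Qed.

(** * The ensemble of states *)

Section LowerBound.
Variables (N w K n : nat) (P : protocol N K n) (eps kappa : RR).
Hypothesis N0 : (0 < N)%N.
Hypothesis w0 : (0 < w)%N.
Hypothesis wN : (w <= N)%N.
Hypothesis Pv : valid_protocol P.
Hypothesis eps0 : 0 < eps.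
Hypothesis kappa0 : 0 < kappa.
Hypothesis eps_kappa : 200 * kappa ^+ 2 * eps <= 1.
Hypothesis success : forall rho, is_state rho -> 9 / 10 <= success_prob P rho eps.

Local Notation I := {x : {ffun 'I_N -> 'I_4} | wt x == w}.
Local Notation signs := {ffun I -> bool}.
Local Notation m := (#|{: I}|%:R : RR).
Local Notation F := (fun i : I => pauli (val i)).
Local Notation s := (Num.sqrt m)^-1.
Local Notation X := (sign_sum F s).
Implicit Types u v : signs.

Hypothesis moment_le : moment F s N.*2 <= (kappa ^+ 2 / 20) ^+ N.

Definition good : pred signs := fun v => rtr (X v ^+ N.*2) <= kappa ^+ N.*2.
(** The factor 50 kappa is what gives the Hamming radius m / 50 in [separation]. By [eps_kappa],
    alpha times kappa is at most 1/4, so X_u + X_v, of norm at most 2 kappa, still encodes a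
    state. *)
Definition alpha := 50 * kappa * eps.
Definition encoded_state (A : 'M[CC]_(2 ^ N)) : 'M[CC]_(2 ^ N) :=
  rc (2 ^- N) *: ((1 : 'M[CC]_(2 ^ N)) + rc alpha *: A).

Lemma cardI : m = 'C(N, w)%:R * 3 ^+ w. Proof. exact: card_weight. Qed.
Lemma bin_gt0R : 0 < 'C(N, w)%:R :> RR. Proof. by rewrite ltr0n bin_gt0. Qed.
Lemma m_ge3 : 3 <= m.
Proof.
rewrite cardI -[leLHS]mul1r; apply: ler_pM => //; first by rewrite ler1n bin_gt0.
by have := ler_weXn2l (ler1n RR 3) w0; rewrite expr1.
Qed.
Lemma s_sq : s ^+ 2 * m = 1.
Proof. by rewrite exprVn sqr_sqrtr // mulVf // gt_eqF //; have := m_ge3; lra. Qed.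
Lemma F_herm i : dagger (F i) = F i. Proof. exact: pauli_herm. Qed.
Lemma pauli_sum_herm v : dagger (X v) = X v. Proof. exact: sign_sum_herm F_herm _ _. Qed.
Lemma alpha_gt0 : 0 < alpha. Proof. by rewrite /alpha !mulr_gt0. Qed.
Lemma alpha_kappa : alpha * kappa <= 4^-1.
Proof. by have := eps_kappa; rewrite /alpha expr2; lra. Qed.

(** Markov's inequality: passing from the normalised to the full trace costs 2^N, and 2^N (kappa^2 /
    20)^N = kappa^(2N) / 10^N, so a fraction of at most 10^-N <= 1/10 of the signs is bad. *)
Lemma card_good : 9 / 10 * 2 ^+ #|{: I}| <= #|good|%:R :> RR.
Proof.
have compl (x y z : RR) : x + y = z -> y <= 10^-1 * z -> 9 / 10 * z <= x.
  by lra.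
have kN : 0 < kappa ^+ N.*2 by rewrite exprn_gt0.
have tot : \sum_v rtr (X v ^+ N.*2) <= 2 ^+ #|{: I}| * (kappa ^+ N.*2 / 10 ^+ N).
  have d0 : 0 < (2 ^ N)%:R :> RR by rewrite ltr0n expn_gt0.
  have p2 : 0 < 2 ^+ #|{: I}| :> RR by rewrite exprn_gt0.
  have -> : \sum_v rtr (X v ^+ N.*2) = 2 ^+ #|{: I}| * ((2 ^ N)%:R * moment F s N.*2).
    have q (x y z : RR) : y != 0 -> z != 0 -> x = y * (z * (x / z / y)).
      by move=> y0 z0; field; rewrite y0.
    by rewrite /moment /avg /tau -mulr_suml -q // gt_eqF.
  apply: (ler_wpM2l (ltW p2)).
  have -> : kappa ^+ N.*2 / 10 ^+ N = (2 ^ N)%:R * (kappa ^+ 2 / 20) ^+ N.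
    rewrite natrX -exprMn -mul2n exprM -expr_div_n; congr (_ ^+ _); by field.
  exact: ler_wpM2l (ltW d0) _ _ moment_le.
have bad : kappa ^+ N.*2 * #|predC good|%:R <= \sum_v rtr (X v ^+ N.*2).
  rewrite [leRHS](bigID good) /=; apply: ler_wpDl.
    apply: sumr_ge0 => v _; rewrite -addnn exprD -{2}(pauli_sum_herm v) -daggerX.
    exact: rtr_sq_ge0.
  rewrite mulr_natr -sumr_const; apply: ler_sum => v.
  by rewrite inE /good -ltNge => /ltW.
apply: (@compl _ #|predC good|%:R); first by rewrite -natrD cardC card_signs.
rewrite -(ler_pM2l kN); apply: le_trans bad _; apply: le_trans tot _.
rewrite mulrCA; apply: (ler_wpM2l (ltW kN)).
rewrite mulrC; apply: ler_wpM2r; first exact: exprn_ge0.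
rewrite lef_pV2 ?posrE ?exprn_gt0 //.
by have := ler_weXn2l (ler1n RR 10) N0; rewrite expr1.
Qed.

Lemma good_opnorm v : good v -> opnorm_le kappa (X v).
Proof. by move=> Gv; apply: (moment_opnorm (q := N)) => //; [exact: pauli_sum_herm|exact: ltW]. Qed.

Lemma good_opp v : good (neg_signs v) = good v.
Proof. by rewrite /good sign_sum_neg -mul2n exprM sqrrN -exprM. Qed.

Lemma tr_F i : \tr (F i) = 0.
Proof.
have -> : F i = pauli (val i) * pauli [ffun=> 0].
  rewrite (_ : pauli [ffun=> 0] = 1) ?mulr1 //.
  apply: etrans (tensor1 N); apply: eq_tensor => k; rewrite ffunE.
  by apply/matrixP => a b; rewrite !mxE /=.
apply: pauli_orth; apply/eqP => e; have /eqP := valP i; rewrite e /wt /supp => e0.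
by move: w0; rewrite -e0 (_ : [set _ | _] = set0) ?cards0 //; apply/setP => k; rewrite !inE ffunE eqxx.
Qed.
Lemma tr_sign_sum v : \tr (X v) = 0.
Proof.
by rewrite /sign_sum raddf_sum big1 //= => i _; rewrite mxtraceZ tr_F mulr0.
Qed.

Lemma rho_state A (k : RR) : \tr A = 0 -> opnorm_le k A -> alpha * k <= 1 -> is_state (encoded_state A).
Proof.
move=> trA [h1 _] ak; split.
  apply: psdZ; first by rewrite invr_ge0 exprn_ge0.
  have -> : (1 : 'M[CC]_(2 ^ N)) + rc alpha *: A =
     rc (1 - alpha * k) *: (1 : 'M[CC]_(2 ^ N)) + rc alpha *: (rc k *: (1 : 'M[CC]_(2 ^ N)) + A).
    rewrite scalerDr scalerA addrA -scalerDl -rcM -rcD subrK.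
    by rewrite rc1 scale1r.
  apply: psdD; first by apply: psdZ; [rewrite subr_ge0|exact: psd1].
  by apply: psdZ h1; exact: ltW alpha_gt0.
rewrite mxtraceZ mxtraceD mxtraceZ trA mulr0 addr0 mxtrace1.
rewrite /rc -(rmorph_nat (real_complex RR)) -rmorphM natrX mulVf ?rmorph1 //.
by rewrite expf_neq0 // pnatr_eq0.
Qed.

Lemma rtr_rho E A : rtr (E * encoded_state A) = 2 ^- N * (rtr E + alpha * rtr (E * A)).
Proof. by rewrite /encoded_state scale_mulr rtrZ mulrDr mulr1 scale_mulr rtrD rtrZ. Qed.

Lemma rho_add E A B : rtr (E * encoded_state (A + B)) =
  rtr (E * encoded_state A) + 2 ^- N * (alpha * rtr (E * B)).
Proof. by rewrite !rtr_rho (mulrDr E) rtrD; ring. Qed.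

(** This is 2 alpha^2 / 3^w, because s^2 = 1/m and m = 'C(N,w) 3^w. The 2 is 16/9 divided by 8/9:
    the first from r >= (3/4) 2^-N Tr E, the second a lower bound for the fraction of good signs. *)
Definition beta := 2 * alpha ^+ 2 * (s ^+ 2 * 'C(N, w)%:R).

Lemma effect_variance h t :
  \sum_v rtr (effect P h t * X v) ^+ 2 <=
  2 ^+ #|{: I}| * (s ^+ 2 * 'C(N, w)%:R * rtr (effect P h t) ^+ 2).
Proof.
set E := effect P h t.
rewrite (eq_bigr (fun v => (\sum_i sg v i * (s * rtr (E * F i))) ^+ 2)) => [|v _].
  rewrite sum_sq_signs; apply: ler_wpM2l; first exact: exprn_ge0.
  under eq_bigr do rewrite exprMn.
  rewrite -mulr_sumr -mulrA; apply: ler_wpM2l; first exact: sqr_ge0.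
  by apply: tensor_info_le => k; have [] := @Pv t (Defs.prefix h t) k.
congr (_ ^+ 2); rewrite mulr_sumr rtr_sum; apply: eq_bigr => i _.
by rewrite scale_mulr rtrZ; ring.
Qed.

(** For a good v the perturbation alpha Tr(E X_v) is at most Tr E / 4 in absolute value. Hence the
    probability under X_u is at least 3/4 of the one under the maximally mixed state, and the
    relative change by X_v is at most 1/3. *)
Lemma likelihood_ratio u h : good u ->
  #|good|%:R * ex (- (n%:R * beta)) * record_prob P (encoded_state (X u)) h
  <= \sum_(v | good v) record_prob P (encoded_state (X u + X v)) h.
Proof.
move=> Gu; set E := effect P h.
have third (y x z q : RR) : y * x <= y * (4^-1 * z) -> y * (3 / 4 * z) <= q -> y * x <= q / 3.
  by lra.
have shrink (y z : RR) : 0 <= y -> 9 / 10 * y <= z -> 8 / 9 * y <= z by lra.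
have c34 : 0 < 3 / 4 :> RR by lra.
have c169 : 0 <= 16 / 9 :> RR by lra.
have ak := alpha_kappa; have a0 := alpha_gt0.
have i0 : 0 < 2 ^- N :> RR by rewrite invr_gt0 exprn_gt0.
pose r t := rtr (E t * encoded_state (X u)); pose D t v := 2 ^- N * (alpha * rtr (E t * X v)).
have T0 t : 0 <= rtr (E t) by apply: psd_trace_ge0; exact: effect_psd.
have b v t : good v -> `|alpha * rtr (E t * X v)| <= 4^-1 * rtr (E t).
  move=> Gv; rewrite normrM (gtr0_norm a0).
  have h1 := opnorm_rtr_le (good_opnorm Gv) (effect_psd Pv h t).
  apply: le_trans (ler_wpM2l (ltW a0) h1) _; rewrite mulrA; apply: ler_wpM2r => //.
have rT t : 2 ^- N * (3 / 4 * rtr (E t)) <= r t.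
  rewrite /r rtr_rho; apply: ler_wpM2l; first exact: ltW.
  by have := b u t Gu; rewrite ler_norml; lra.
have r0 t : 0 <= r t.
  by apply: le_trans (rT t); apply: mulr_ge0; [exact: ltW|have := T0 t; lra].
have D_le t v : good v -> `|D t v| <= r t / 3.
  move=> Gv; rewrite /D normrM (gtr0_norm i0).
  exact: third (ler_wpM2l (ltW i0) (b v t Gv)) (rT t).
have D_opp t v : D t (neg_signs v) = - D t v by rewrite /D sign_sum_neg mulrN rtrN; ring.
have D_var t : \sum_(v | good v) (D t v / r t) ^+ 2 <= beta * #|good|%:R.
  have B0 : 0 <= beta by rewrite /beta; do 2![apply: mulr_ge0]; rewrite ?sqr_ge0.
  have [T_eq|T_neq] := eqVneq (rtr (E t)) 0.
    rewrite big1 => [|v Gv]; first by rewrite mulr_ge0.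
    have := b v t Gv; rewrite T_eq mulr0 normr_le0 => /eqP e.
    by rewrite /D e mulr0 mul0r expr0n.
  have Tp : 0 < rtr (E t) by rewrite lt0r T_neq T0.
  have rp : 0 < r t by apply: lt_le_trans (rT t); rewrite mulr_gt0 // mulr_gt0.
  apply: (@le_trans _ _ (\sum_v (16 / 9 * alpha ^+ 2 / rtr (E t) ^+ 2) * rtr (E t * X v) ^+ 2)).
    rewrite [leRHS](bigID good) /=; apply: ler_wpDr.
      apply: sumr_ge0 => v _; rewrite mulr_ge0 ?sqr_ge0 // divr_ge0 ?sqr_ge0 //.
      by rewrite mulr_ge0 ?sqr_ge0.
    apply: ler_sum => v _; rewrite /D.
    have -> : 16 / 9 * alpha ^+ 2 / rtr (E t) ^+ 2 * rtr (E t * X v) ^+ 2 =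
       (2 ^- N * (alpha * rtr (E t * X v))) ^+ 2 * (2 ^- N * (3 / 4 * rtr (E t))) ^- 2.
      field; rewrite T_neq /=; by rewrite expf_neq0 // pnatr_eq0.
    rewrite exprMn exprVn; apply: ler_wpM2l; first exact: sqr_ge0.
    have q0 : 0 < 2 ^- N * (3 / 4 * rtr (E t)) by rewrite mulr_gt0 // mulr_gt0.
    rewrite lef_pV2 ?posrE ?exprn_gt0 //; apply: lerXn2r; rewrite ?nnegrE ?(ltW q0) ?(ltW rp) //.
  rewrite -mulr_sumr.
  apply: le_trans (ler_wpM2l _ (effect_variance h t)) _.
    by rewrite divr_ge0 ?sqr_ge0 // mulr_ge0 ?sqr_ge0.
  have -> : 16 / 9 * alpha ^+ 2 / rtr (E t) ^+ 2 *
      (2 ^+ #|{: I}| * (s ^+ 2 * 'C(N, w)%:R * rtr (effect P h t) ^+ 2))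
    = beta * (8 / 9 * 2 ^+ #|{: I}|).
    rewrite -/(E t) /beta; move: (s) (2 ^+ #|_|) (rtr _) T_neq => x y z z0; field.
    by [].
  by apply: ler_wpM2l => //; apply: shrink card_good; exact: exprn_ge0.
have := likelihood_average (@neg_signsK _) good_opp D_opp r0 D_le D_var.
rewrite !record_probE; congr (_ <= _); apply: eq_bigr => v _; rewrite record_probE.
by apply: eq_bigr => t _; rewrite rho_add.
Qed.

Lemma trace_sq_combination (c : I -> RR) :
  rtr ((\sum_i rc (c i) *: F i) * (\sum_i rc (c i) *: F i)) = 2 ^+ N * \sum_i c i ^+ 2.
Proof.
rewrite mulr_suml rtr_sum mulr_sumr; apply: eq_bigr => i _.
rewrite mulr_sumr rtr_sum (bigD1 i) //= big1 => [|j ji].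
  rewrite addr0 scale_mull scale_mulr !rtrZ pauli_sq rtr1 natrX.
  by ring.
rewrite scale_mull scale_mulr !rtrZ /rtr pauli_orth ?mulr0 //.
by apply/eqP => /val_inj e; rewrite e eqxx in ji.
Qed.

Lemma sq_dist_signs u v : \sum_i (s * sg u i - s * sg v i) ^+ 2 = 4 * s ^+ 2 * (ham u v)%:R.
Proof.
rewrite /ham -sum1_card natr_sum mulr_sumr [RHS]big_mkcond /=; apply: eq_bigr => i _.
by rewrite inE /sg; case: (u i); case: (v i) => /=; ring.
Qed.

Lemma rtr_mulB (D A B : 'M[CC]_(2 ^ N)) : rtr (D * (A - B)) = rtr (D * A) - rtr (D * B).
Proof. by rewrite mulrBr rtrB. Qed.

(** Both errors are paired with A - B by trace-norm duality; subtracting the two pairings eliminates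
    the estimate [E] and leaves the normalised square of A - B. *)
Lemma close_states A B E k : 0 < k -> dagger (A - B) = A - B -> opnorm_le k (A - B) ->
  trnorm (E - encoded_state A) <= eps -> trnorm (E - encoded_state B) <= eps ->
  alpha * (rtr ((A - B) * (A - B)) / 2 ^+ N) <= 2 * (k * eps).
Proof.
have arith (x d a b al ke y : RR) : `|x - y * (d + al * a)| <= ke ->
    `|x - y * (d + al * b)| <= ke -> al * ((a - b) * y) <= 2 * ke.
  have -> : al * ((a - b) * y) = y * (d + al * a) - y * (d + al * b) by ring.
  by move: (y * (d + al * a)) (y * _) => p q; rewrite !ler_norml; lra.
move=> k0 DH Dk hA hB.
have bA := le_trans (trnorm_dual (E - encoded_state A) k0 DH Dk) (ler_wpM2l (ltW k0) hA).
have bB := le_trans (trnorm_dual (E - encoded_state B) k0 DH Dk) (ler_wpM2l (ltW k0) hB).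
have := rtr_mulB (A - B) A B.
move: (A - B) DH Dk bA bB => D _ _ bA bB.
rewrite rtr_mulB (rtr_rho D A) in bA; rewrite rtr_mulB (rtr_rho D B) in bB.
by move=> ->; exact: arith bA bB.
Qed.

(** The normalised square of X_u - X_v is 4 ham(u, v) / m and its norm is at most 2 kappa; with
    alpha = 50 kappa eps the factors kappa eps cancel. *)
Lemma separation u v E : good u -> good v ->
  trnorm (E - encoded_state (X u)) <= eps -> trnorm (E - encoded_state (X v)) <= eps ->
  (50 * ham u v <= #|{: I}|)%N.
Proof.
have arith (k e q h : RR) : 0 < k * e -> 50 * k * e * (4 * q * h) <= 2 * ((k + k) * e) ->
    50 * (q * h) <= 1.
  by move=> ke le1; rewrite -(ler_pM2l ke); lra.
move=> Gu Gv hu hv.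
have BE : X u - X v = \sum_i rc (s * sg u i - s * sg v i) *: F i.
  by rewrite /sign_sum -sumrB; apply: eq_bigr => i _; rewrite -scalerBl -rmorphB.
have BH : dagger (X u - X v) = X u - X v by rewrite daggerD daggerN !pauli_sum_herm.
have Bn : opnorm_le (kappa + kappa) (X u - X v).
  by apply: opnormD; [|apply: opnormN]; exact: good_opnorm.
have k2 : 0 < kappa + kappa by rewrite addr_gt0.
have := close_states k2 BH Bn hu hv.
have -> : rtr ((X u - X v) * (X u - X v)) / 2 ^+ N = 4 * s ^+ 2 * (ham u v)%:R.
  rewrite BE trace_sq_combination sq_dist_signs mulrC mulKf //.
  by rewrite expf_neq0 // pnatr_eq0.
rewrite /alpha => le1.
have ke : 0 < kappa * eps by rewrite mulr_gt0.
have le2 : 50 * (s ^+ 2 * (ham u v)%:R) <= s ^+ 2 * m.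
  by rewrite s_sq; exact: arith ke le1.
have s2 : 0 < s ^+ 2 by rewrite exprn_gt0 // invr_gt0 sqrtr_gt0; have := m_ge3; apply: lt_le_trans.
by move: le2; rewrite mulrCA (ler_pM2l s2) -natrM ler_nat.
Qed.

(** The entry y i counts the minus signs among the two at i, so the signs add up to 2 - 2 y i. *)
Definition code_sum (y : {ffun I -> 'I_3}) : 'M[CC]_(2 ^ N) :=
  \sum_i rc (s * (2 - 2 * (y i)%:R)) *: F i.

Lemma sign_sum_add u v : X u + X v = code_sum (code u v).
Proof.
rewrite /sign_sum -big_split; apply: eq_bigr => i _ /=; rewrite -scalerDl -rcD; congr (rc _ *: _).
rewrite ffunE inordK; last by case: (u i); case: (v i).
by rewrite /sg; case: (u i); case: (v i) => /=; rewrite ?addn0 ?add0n; ring.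
Qed.

Lemma state_rho1 u : good u -> is_state (encoded_state (X u)).
Proof.
move=> Gu; apply: (rho_state (k := kappa)); [exact: tr_sign_sum|exact: good_opnorm|].
by have := alpha_kappa; lra.
Qed.

Lemma state_rho2 u v : good u -> good v -> is_state (encoded_state (code_sum (code u v))).
Proof.
move=> Gu Gv; rewrite -sign_sum_add; apply: (rho_state (k := kappa + kappa)).
- by rewrite mxtraceD !tr_sign_sum addr0.
- by apply: opnormD; exact: good_opnorm.
- by have := alpha_kappa; lra.
Qed.

Lemma record_prob_ge0 sigma h : is_state sigma -> 0 <= record_prob P sigma h.
Proof.
move=> [ps _]; rewrite record_probE; apply: prodr_ge0 => t _.
by apply: psd_mul_trace_ge0 => //; exact: effect_psd.
Qed.

Lemma copies_ge : 'C(N, w)%:R * 9 ^+ w <= 42 * (50 * kappa * eps) ^+ 2 * n%:R.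
Proof.
have arith (C T a x : RR) : 0 < C -> 0 < T -> C * T / 21 <= x * (2 * a * ((C * T)^-1 * C)) ->
    C * T ^+ 2 <= 42 * a * x.
  move=> C0 T0.
  have -> : x * (2 * a * ((C * T)^-1 * C)) = 2 * a * x / T by field; rewrite !gt_eqF.
  rewrite ler_pdivlMr //.
  have -> : C * T ^+ 2 = 21 * (C * T / 21 * T) by field.
  by move: (C * T / 21 * T) => y; lra.
have cb : 9 / 10 * #|good|%:R ^+ 2 * ex (- (n%:R * beta)) <= 3 ^+ #|{: I}| * (17 / 15) ^+ #|{: I}|.
  apply: (@counting_bound I {ffun 'I_n -> outcome N K} good
    (fun u h => trnorm (estimate P h - encoded_state (X u)) <= eps)
    (fun u h => record_prob P (encoded_state (X u)) h)
    (fun y h => record_prob P (encoded_state (code_sum y)) h)).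
  - exact: ltW (ex_gt0 _).
  - by move=> u v h Gu Gv; apply: record_prob_ge0; exact: state_rho2.
  - by move=> u v Gu Gv; apply: sum_record_prob => //; have [] := state_rho2 Gu Gv.
  - by move=> u v h Gu Gv; exact: separation.
  - by move=> u Gu; exact: success (state_rho1 Gu).
  - move=> u h Gu; apply: le_trans (likelihood_ratio h Gu) _.
    by under eq_bigr do rewrite sign_sum_add.
have m3 : (3 <= #|{: I}|)%N by rewrite -(ler_nat RR); exact: m_ge3.
have := exponent_bound m3 (ler0n _ _) card_good cb.
have m0 : 0 < m by apply: lt_le_trans m_ge3.
have s2 : s ^+ 2 = m^-1 by apply: (mulIf (lt0r_neq0 m0)); rewrite s_sq mulVf ?lt0r_neq0.
rewrite /beta /alpha s2 cardI => H.
have C0 := bin_gt0R.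
have T0 : 0 < 3 ^+ w :> RR by rewrite exprn_gt0.
have -> : 9 = 3 ^+ 2 :> RR by ring.
rewrite -exprM mulnC exprM.
exact: arith C0 T0 H.
Qed.
End LowerBound.

Theorem theorem1 :
  exists c0 eps0 : RR, 0 < c0 /\ 0 < eps0 /\
    forall (N : nat) (eps : RR) (K n : nat) (P : protocol N K n),
      (1 <= N)%N -> 0 < eps -> eps <= eps0 ->
      valid_protocol P ->
      (forall rho : 'M[CC]_(2 ^ N), is_state rho ->
         9 / 10 <= success_prob P rho eps) ->
      c0 * 10 ^+ N / (Num.sqrt (N%:R) * eps ^+ 2) <= n%:R.
Proof.
have c27 : 0 < 27^-1 :> RR by lra.
have [C [C1 HC]] := moment_bound c27.
have C20 : 0 < 20 * C by lra.
(* Chosen so that kappa^2 / 20 = C, as the Markov bound in [card_good] requires. *)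
pose kappa := Num.sqrt (20 * C).
have k0 : 0 < kappa by rewrite sqrtr_gt0.
have k2 : kappa ^+ 2 / 20 = C by rewrite sqr_sqrtr ?(ltW C20) //; field.
have A0 : 0 < 126 * (50 * kappa) ^+ 2 by rewrite mulr_gt0 // exprn_gt0 // mulr_gt0.
have B0 : 0 < 200 * kappa ^+ 2 by rewrite mulr_gt0 // exprn_gt0.
(* 126 = 3 * 42, with 3 from [binomial_peak] and 42 from [copies_ge]; eps0 is the largest value
   allowed by the condition 200 kappa^2 eps <= 1. *)
exists (126 * (50 * kappa) ^+ 2)^-1, (200 * kappa ^+ 2)^-1; do 2![split; first by rewrite invr_gt0].
move=> N eps K n P N0 e0 eps_le Pv success.
have ek : 200 * kappa ^+ 2 * eps <= 1 by rewrite mulrC -ler_pdivlMr // mul1r.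
have [w [w0 wN peak]] := binomial_peak N0.
have moment_le : moment (fun i : {x : {ffun 'I_N -> 'I_4} | wt x == w} => pauli (val i))
    (Num.sqrt (#|{: {x : {ffun 'I_N -> 'I_4} | wt x == w}}|%:R : RR))^-1 N.*2
    <= (kappa ^+ 2 / 20) ^+ N.
  have cw := card_weight N w; have cge := shell_card_ge N0 wN peak.
  rewrite k2; apply: HC.
  - by move=> i; exact: pauli_herm.
  - by move=> i; exact: pauli_sq.
  - by move=> i j ij; apply: pauli_orth; apply/eqP => /val_inj e; rewrite e eqxx in ij.
  - by rewrite invr_ge0 sqrtr_ge0.
  - rewrite exprVn sqr_sqrtr // mulVf // cw lt0r_neq0 //.
    by apply: lt_le_trans cge; rewrite mulr_gt0 // exprn_gt0.
  - by move=> b; exact: pauli_sums_scalar.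
  - by rewrite cw.
  - exact: card_weight_le.
have := copies_ge N0 w0 wN Pv e0 k0 ek success moment_le.
have sN : 0 < Num.sqrt N%:R :> RR by rewrite sqrtr_gt0 ltr0n.
rewrite ler_pdivrMr; last by rewrite mulr_gt0 // exprn_gt0.
rewrite ler_pdivrMl // => H; apply: le_trans peak _.
apply: le_trans (ler_wpM2l _ H) _; first by rewrite mulr_ge0 // ltW.
have -> : (50 * kappa * eps) ^+ 2 = (50 * kappa) ^+ 2 * eps ^+ 2 by rewrite exprMn.
move: (Num.sqrt N%:R) ((50 * kappa) ^+ 2) (eps ^+ 2) (n%:R) => a b c d.
by rewrite le_eqVlt; apply/orP; left; apply/eqP; ring.
Qed.
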